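(* Let $\mathfrak h=\mathbb C^{n-1}$ be the reflection representation of $S_n$. For every $c\in(-1,0)$ the spherical subalgebra $A_c(n):=e_{S_n}H_c(S_n,\mathfrak h)e_{S_n}$ is a simple algebra.
   Context: Let $S$ be the set of reflections (transpositions) of $S_n$ in $\mathfrak h$; for $s\in S$, $\alpha_s\in\mathfrak h^*$, $\alpha_s^\vee\in\mathfrak h$ span the $-1$-eigenspaces of $s$, with $(\alpha_s,\alpha_s^\vee)=2$. $H_c(S_n,\mathfrak h)$ is the quotient of $\mathbb C[S_n]\ltimes T(\mathfrak h\oplus\mathfrak h^* )$ by $[x,x']=0$, $[y,y']=0$, $[y,x]=(y,x)-c\sum_{s\in S}(y,\alpha_s)(x,\alpha_s^\vee)s$ ($x,x'\in\mathfrak h^*$, $y,y'\in\mathfrak h$). $e_{S_n}=\frac1{n!}\sum_{w\in S_n}w$. *)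

(* Defs.v *)
From HB Require Import structures.
From mathcomp Require Import all_boot all_order all_fingroup all_algebra.
From mathcomp Require Import finmap.
From mathcomp Require Import boolp classical_sets reals complex.
From mathcomp Require Import monalg.

Set Implicit Arguments.
Unset Strict Implicit.
Unset Printing Implicit Defensive.

Import GRing.Theory Num.Theory.
Local Open Scope classical_set_scope.
Local Open Scope ring_scope.

Section TwoSidedIdeal.
Variable A : pzRingType.

Definition two_sided_ideal (I : set A) : Prop :=
  [/\ I 0, forall x y, I x -> I y -> I (x + y),
      forall a x, I x -> I (a * x) & forall a x, I x -> I (x * a)].

(* In a unital algebra over a field, a two-sided ideal of the underlying ring
   is automatically a subspace, so this is also simplicity as an algebra. *)
Definition simple_ring : Prop :=
  (1 : A) <> 0 /\
  forall I : set A, two_sided_ideal I -> I = [set 0] \/ I = setT.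

Definition ideal_generated (S : set A) : set A := smallest two_sided_ideal S.

Lemma ideal_generated_ideal S : two_sided_ideal (ideal_generated S).
Proof.
split.
- by move=> I [[]].
- by move=> x y Ix Iy I hI; have [[I0 ID Il Ir] _] := hI; apply: ID; [exact: Ix | exact: Iy].
- by move=> a x Ix I hI; have [[I0 ID Il Ir] _] := hI; apply: Il; exact: Ix.
- by move=> a x Ix I hI; have [[I0 ID Il Ir] _] := hI; apply: Ir; exact: Ix.
Qed.

Definition in_ideal (S : set A) : pred A := [pred x | `[< ideal_generated S x >]].

Lemma in_idealP S x : reflect (ideal_generated S x) (x \in in_ideal S).
Proof. exact: asboolP. Qed.

Lemma in_ideal_zmod_closed S : zmod_closed (in_ideal S).
Proof.
have [h0 hD hl _] := ideal_generated_ideal S.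
split=> [|x y]; first exact/in_idealP.
move=> /in_idealP hx /in_idealP hy; apply/in_idealP; apply: hD => //.
by rewrite -mulN1r; apply: hl.
Qed.
HB.instance Definition _ S :=
  GRing.isZmodClosed.Build A (in_ideal S) (in_ideal_zmod_closed S).

End TwoSidedIdeal.

Section QuotientRing.
Local Open Scope quotient_scope.
Variables (A : pzRingType) (S : set A).

Let I : zmodClosed A := GRing.ZmodClosed.clone A (in_ideal S) _.

Definition quot_ring : Type := Quotient.quot I.
HB.instance Definition _ := GRing.Zmodule.copy quot_ring (Quotient.quot I).

Definition quot_proj (x : A) : quot_ring := \pi_(Quotient.quot I) x.

Lemma quot_proj_surj (u : quot_ring) : exists x, u = quot_proj x.
Proof. by exists (generic_quotient.repr (u : Quotient.quot I)); rewrite /quot_proj generic_quotient.reprK. Qed.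

Lemma quot_proj_eq x y : quot_proj x = quot_proj y <-> ideal_generated S (x - y).
Proof.
split=> [/eqP | h]; first by rewrite -Quotient.idealrBE => /in_idealP.
by apply/eqP; rewrite -Quotient.idealrBE; apply/in_idealP.
Qed.

Lemma quot_proj_is_zmod_morphism : zmod_morphism quot_proj.
Proof. by move=> x y; rewrite /quot_proj !piE. Qed.
HB.instance Definition _ :=
  GRing.isZmodMorphism.Build A quot_ring quot_proj quot_proj_is_zmod_morphism.

Definition quot_lift (u : quot_ring) : A := generic_quotient.repr (u : Quotient.quot I).
Lemma quot_liftK u : quot_proj (quot_lift u) = u.
Proof. by rewrite /quot_proj /quot_lift generic_quotient.reprK. Qed.

Definition quot_one : quot_ring := quot_proj 1.
Definition quot_mul (u v : quot_ring) : quot_ring :=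
  quot_proj (quot_lift u * quot_lift v).

Lemma quot_mulE x y : quot_mul (quot_proj x) (quot_proj y) = quot_proj (x * y).
Proof.
apply/quot_proj_eq.
have [_ hD hl hr] := ideal_generated_ideal S.
have -> : quot_lift (quot_proj x) * quot_lift (quot_proj y) - x * y =
  (quot_lift (quot_proj x) - x) * quot_lift (quot_proj y)
  + x * (quot_lift (quot_proj y) - y).
  by rewrite mulrBl mulrBr addrA subrK.
by apply: hD; [apply: hr|apply: hl]; apply/quot_proj_eq; rewrite quot_liftK.
Qed.

Lemma quot_mulA : associative quot_mul.
Proof.
by move=> u v w; rewrite -[u]quot_liftK -[v]quot_liftK -[w]quot_liftK !quot_mulE mulrA.
Qed.
Lemma quot_mul1r : left_id quot_one quot_mul.
Proof. by move=> u; rewrite -[u]quot_liftK quot_mulE mul1r. Qed.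
Lemma quot_mulr1 : right_id quot_one quot_mul.
Proof. by move=> u; rewrite -[u]quot_liftK quot_mulE mulr1. Qed.
Lemma quot_mulDl : left_distributive quot_mul +%R.
Proof.
move=> u v w; rewrite -[u]quot_liftK -[v]quot_liftK -[w]quot_liftK.
by rewrite -raddfD !quot_mulE mulrDl raddfD.
Qed.
Lemma quot_mulDr : right_distributive quot_mul +%R.
Proof.
move=> u v w; rewrite -[u]quot_liftK -[v]quot_liftK -[w]quot_liftK.
by rewrite -raddfD !quot_mulE mulrDr raddfD.
Qed.
HB.instance Definition _ := GRing.Zmodule_isPzRing.Build quot_ring
  quot_mulA quot_mul1r quot_mulr1 quot_mulDl quot_mulDr.

Lemma quot_proj_is_monoid_morphism : monoid_morphism quot_proj.
Proof. by split=> [//|x y]; rewrite -quot_mulE. Qed.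
HB.instance Definition _ :=
  GRing.isMonoidMorphism.Build A quot_ring quot_proj quot_proj_is_monoid_morphism.

End QuotientRing.

(* The algebra e A e, with unit e, for an idempotent e. *)
Section Corner.
Variables (A : pzRingType) (e : A) (e_idem : e * e = e).

Definition in_corner : pred A := [pred x | `[< exists a, x = e * a * e >]].

Lemma in_cornerP x : reflect (exists a, x = e * a * e) (x \in in_corner).
Proof. exact: asboolP. Qed.

Lemma in_corner_zmod_closed : zmod_closed in_corner.
Proof.
split=> [|x y]; first by apply/in_cornerP; exists 0; rewrite mulr0 mul0r.
move=> /in_cornerP[a ->] /in_cornerP[b ->]; apply/in_cornerP; exists (a - b).
by rewrite mulrBr mulrBl.
Qed.
HB.instance Definition _ := GRing.isZmodClosed.Build A in_corner in_corner_zmod_closed.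

Record corner : predArgType := Corner { corner_val : A; _ : corner_val \in in_corner }.
HB.instance Definition _ := [isSub for corner_val].
HB.instance Definition _ := [Choice of corner by <:].
HB.instance Definition _ := [SubChoice_isSubZmodule of corner by <:].

Definition corner_ring of e * e = e : Type := corner.
Notation B := (corner_ring e_idem).
HB.instance Definition _ := GRing.Zmodule.on B.

Lemma corner_one_subproof : e \in in_corner.
Proof. by apply/in_cornerP; exists 1; rewrite mulr1 e_idem. Qed.
Lemma corner_mul_subproof (x y : B) : corner_val x * corner_val y \in in_corner.
Proof.
case: x y => [x /= /in_cornerP[a ->]] [y /= /in_cornerP[b ->]].
by apply/in_cornerP; exists (a * e * e * b); rewrite !mulrA.
Qed.
Definition corner_one : B := Corner corner_one_subproof.
Definition corner_mul (x y : B) : B := Corner (corner_mul_subproof x y).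

Lemma corner_mulA : associative corner_mul.
Proof. by move=> x y z; apply: val_inj; rewrite /= mulrA. Qed.
Lemma corner_mul1r : left_id corner_one corner_mul.
Proof.
by case=> x hx; apply: val_inj => /=; have /in_cornerP[a ->] := hx; rewrite !mulrA e_idem.
Qed.
Lemma corner_mulr1 : right_id corner_one corner_mul.
Proof.
by case=> x hx; apply: val_inj => /=; have /in_cornerP[a ->] := hx; rewrite -mulrA e_idem.
Qed.
Lemma corner_mulDl : left_distributive corner_mul +%R.
Proof. by move=> x y z; apply: val_inj; rewrite /= mulrDl. Qed.
Lemma corner_mulDr : right_distributive corner_mul +%R.
Proof. by move=> x y z; apply: val_inj; rewrite /= mulrDr. Qed.
HB.instance Definition _ := GRing.Zmodule_isPzRing.Build B
  corner_mulA corner_mul1r corner_mulr1 corner_mulDl corner_mulDr.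
End Corner.

(* The tensor algebra T(V), as the free associative algebra on the basis of V
   vbasis {:V} of V. *)
Section TensorAlgebra.
Variable K : fieldType.

Section Def.
Variable V : vectType K.
Definition tensor_alg : Type := {malg K[{fmonom 'I_(\dim {:V})}]}.
HB.instance Definition _ := GRing.Lalgebra.on tensor_alg.

Lemma tensor_scalerAr (k : K) (x y : tensor_alg) : k *: (x * y) = x * (k *: y).
Proof.
rewrite [in RHS](malgMEw (fsubset_refl _) (msuppZ_le k y)) malgME scaler_sumr.
apply: eq_bigr => m1 _; rewrite scaler_sumr; apply: eq_bigr => m2 _.
by apply/malgP => m; rewrite !(mcoeffZ, mcoeffU) mulrnAr mulrCA.
Qed.
HB.instance Definition _ := GRing.Lalgebra_isAlgebra.Build K tensor_alg tensor_scalerAr.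

Definition tensor_gen (i : 'I_(\dim {:V})) : tensor_alg := << fmu i >>.
Definition tensor_inj (v : V) : tensor_alg := \sum_i coord (vbasis {:V}) i v *: tensor_gen i.

Lemma tensor_inj_is_linear : linear tensor_inj.
Proof.
move=> k u v; rewrite /tensor_inj scaler_sumr -big_split /=; apply: eq_bigr => i _.
by rewrite linearP scalerDl scalerA.
Qed.
HB.instance Definition _ :=
  GRing.isLinear.Build K V tensor_alg _ tensor_inj tensor_inj_is_linear.

Lemma tensor_injE (i : 'I_(\dim {:V})) : tensor_inj (vbasis {:V})`_i = tensor_gen i.
Proof.
have fr : free (vbasis {:V}) by exact: basis_free (vbasisP _).
rewrite /tensor_inj (bigD1 i) //= coord_free // eqxx scale1r big1 ?addr0 // => j ji.
by rewrite coord_free // eq_sym (negbTE ji) scale0r.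
Qed.

Section Lift.
Variables (A : algType K) (f : V -> A).

Definition tensor_lift_word (m : {fmonom 'I_(\dim {:V})}) : A :=
  \prod_(i <- (m : seq _)) f (vbasis {:V})`_i.

Lemma tensor_lift_word_mmorphism : mmorphism tensor_lift_word.
Proof.
split=> [m1 m2|]; first by rewrite /tensor_lift_word fmM big_cat.
by rewrite /tensor_lift_word fm1 big_nil.
Qed.
HB.instance Definition _ := monalg.isMultiplicative.Build _ A tensor_lift_word
  tensor_lift_word_mmorphism.

(* The algebra morphism T(V) -> A extending a linear map f : V -> A. *)
Definition tensor_lift (x : tensor_alg) : A :=
  mmap (in_alg A) tensor_lift_word x.

Lemma tensor_lift_is_zmod_morphism : zmod_morphism tensor_lift.
Proof. exact: (@mmap_is_additive _ _ _ (in_alg A) tensor_lift_word). Qed.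
HB.instance Definition _ := GRing.isZmodMorphism.Build tensor_alg A tensor_lift
  tensor_lift_is_zmod_morphism.

Lemma tensor_lift_is_monoid_morphism : monoid_morphism tensor_lift.
Proof.
have [hM h1] := @commr_mmap_is_multiplicative _ _ _ (in_alg A) tensor_lift_word
  (fun g m m' => etrans (mulr_algl _ _) (esym (mulr_algr _ _))).
by split.
Qed.
HB.instance Definition _ := GRing.isMonoidMorphism.Build tensor_alg A tensor_lift
  tensor_lift_is_monoid_morphism.

Lemma tensor_lift_is_scalable : scalable tensor_lift.
Proof. by move=> k x; rewrite /tensor_lift mmapZ /= mulr_algl. Qed.
HB.instance Definition _ := GRing.isScalable.Build K tensor_alg A _ tensor_lift
  tensor_lift_is_scalable.

Lemma tensor_lift_gen i : tensor_lift (tensor_gen i) = f (vbasis {:V})`_i.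
Proof.
by rewrite /tensor_lift mmapU /= scale1r mul1r /tensor_lift_word fmU big_seq1.
Qed.
End Lift.

Lemma tensor_lift_inj (A : algType K) (f : {linear V -> A}) v :
  tensor_lift f (tensor_inj v) = f v.
Proof.
rewrite /tensor_inj linear_sum [in RHS](coord_vbasis (memvf v)) linear_sum.
by apply: eq_bigr => i _; rewrite !linearZ /= tensor_lift_gen.
Qed.

Lemma tensor_morph_eq (A : algType K) (F G : {lrmorphism tensor_alg -> A}) :
  (forall v, F (tensor_inj v) = G (tensor_inj v)) -> F =1 G.
Proof.
move=> eqFG x.
pose W (m : {fmonom 'I_(\dim {:V})}) : tensor_alg := << m >>.
have eqW m : F (W m) = G (W m).
  case: m; elim=> [|i s IHs].
    have -> : W (FMonom [::]) = 1 by rewrite /W -fmoneE.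
    by rewrite !rmorph1.
  have -> : W (FMonom (i :: s)) = tensor_gen i * W (FMonom s).
    rewrite /W /tensor_gen [RHS]fgmulUU mulr1; congr (<< _ >>).
    by apply/eqP; rewrite fmP fmM fmU.
  rewrite (rmorphM F) (rmorphM G).
  congr (_ * _); last exact: IHs.
  by have := eqFG (vbasis {:V})`_i; rewrite tensor_injE; apply.
have -> : x = \sum_(m <- msupp x) x@_m *: W m.
  rewrite [LHS]monalgE; apply: eq_bigr => m _.
  by apply/malgP => m'; rewrite mcoeffZ !mcoeffU mulrnAr mulr1.
by rewrite !linear_sum; apply: eq_bigr => m _; rewrite !linearZ; congr (_ *: _); exact: eqW.
Qed.

End Def.
End TensorAlgebra.

Arguments tensor_inj {K V} v.
Arguments tensor_lift {K V A} f x.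

Section TensorFunctor.
Variable K : fieldType.

Definition tensor_map (V W : vectType K) (f : 'Hom(V, W)) : tensor_alg V -> tensor_alg W :=
  tensor_lift (fun v => tensor_inj (f v)).
HB.instance Definition _ (V W : vectType K) (f : 'Hom(V, W)) := GRing.LRMorphism.on (@tensor_map V W f).

Lemma tensor_map_inj (V W : vectType K) (f : 'Hom(V, W)) v :
  tensor_map f (tensor_inj v) = tensor_inj (f v).
Proof. exact: (tensor_lift_inj (tensor_inj \o f)). Qed.

Lemma tensor_map_id (V : vectType K) : tensor_map (\1%VF : 'End(V)) =1 id.
Proof.
apply: (tensor_morph_eq (F := tensor_map \1%VF) (G := idfun)) => v.
by rewrite /= tensor_map_inj id_lfunE.
Qed.

Lemma tensor_map_comp (U V W : vectType K) (f : 'Hom(V, W)) (g : 'Hom(U, V)) :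
  tensor_map (f \o g)%VF =1 tensor_map f \o tensor_map g.
Proof.
apply: (tensor_morph_eq (F := tensor_map (f \o g)%VF) (G := tensor_map f \o tensor_map g)).
by move=> v; rewrite /= !tensor_map_inj comp_lfunE.
Qed.
End TensorFunctor.

Record linear_rep (K : fieldType) (gT : finGroupType) (V : vectType K) := LinearRep {
  rep_fun :> gT -> 'End(V);
  rep1 : rep_fun 1%g = \1%VF;
  repM : forall g h, rep_fun (g * h)%g = (rep_fun g \o rep_fun h)%VF
}.

Record alg_action (K : fieldType) (gT : finGroupType) (A : algType K) := AlgAction {
  alg_act :> gT -> {lrmorphism A -> A};
  alg_act1 : forall a, alg_act 1%g a = a;
  alg_actM : forall g h a, alg_act (g * h)%g a = alg_act g (alg_act h a)
}.

Section Reps.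
Variables (K : fieldType) (gT : finGroupType).

Section Dual.
Variables (V : vectType K) (rho : linear_rep gT V).

Definition dual_act (g : gT) (x : 'Hom(V, K^o)) : 'Hom(V, K^o) :=
  (x \o rho g^-1%g)%VF.
Lemma dual_act_is_linear g : linear (dual_act g).
Proof. by move=> k x y; rewrite /dual_act comp_lfunDl comp_lfunZl. Qed.
HB.instance Definition _ g := GRing.isLinear.Build K 'Hom(V, K^o) 'Hom(V, K^o) _
  (dual_act g) (dual_act_is_linear g).

Lemma dual_rep1 : linfun (dual_act 1%g) = \1%VF.
Proof. by apply/lfunP => x; rewrite lfunE id_lfunE /= /dual_act invg1 rep1 comp_lfun1r. Qed.
Lemma dual_repM g h :
  linfun (dual_act (g * h)%g) = (linfun (dual_act g) \o linfun (dual_act h))%VF.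
Proof.
by apply/lfunP => x; rewrite comp_lfunE !lfunE /= /dual_act invMg repM comp_lfunA.
Qed.
Definition dual_rep : linear_rep gT 'Hom(V, K^o) := LinearRep dual_rep1 dual_repM.
End Dual.

Section Sum.
Variables (V W : vectType K) (rho : linear_rep gT V) (sigma : linear_rep gT W).

Definition sum_act (g : gT) (u : V * W) : V * W := (rho g u.1, sigma g u.2).
Lemma sum_act_is_linear g : linear (sum_act g).
Proof. by move=> k x y; rewrite /sum_act /= !linearP. Qed.
HB.instance Definition _ g := GRing.isLinear.Build K (V * W)%type (V * W)%type _
  (sum_act g) (sum_act_is_linear g).

Lemma sum_rep1 : linfun (sum_act 1%g) = \1%VF.
Proof. by apply/lfunP => -[v w]; rewrite lfunE id_lfunE /= /sum_act !rep1 !id_lfunE. Qed.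
Lemma sum_repM g h :
  linfun (sum_act (g * h)%g) = (linfun (sum_act g) \o linfun (sum_act h))%VF.
Proof.
by apply/lfunP => -[v w]; rewrite comp_lfunE !lfunE /= /sum_act /= !repM !comp_lfunE.
Qed.
Definition sum_rep : linear_rep gT (V * W)%type := LinearRep sum_rep1 sum_repM.
End Sum.

Section TensorAction.
Variables (V : vectType K) (rho : linear_rep gT V).
Definition tensor_act (g : gT) : {lrmorphism tensor_alg V -> tensor_alg V} :=
  tensor_map (rho g).
Lemma tensor_act1 a : tensor_act 1%g a = a.
Proof. by rewrite /= rep1 tensor_map_id. Qed.
Lemma tensor_actM g h a : tensor_act (g * h)%g a = tensor_act g (tensor_act h a).
Proof. by rewrite /= repM tensor_map_comp. Qed.
Definition tensor_action : alg_action gT (tensor_alg V) :=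
  AlgAction tensor_act1 tensor_actM.
End TensorAction.
End Reps.

(* The algebra K[G] |x A: the function f stands for the sum of the f(g) g, and
   g a = (g . a) g. *)
Section SmashProduct.
Variables (K : fieldType) (gT : finGroupType) (A : algType K) (act : alg_action gT A).

Definition smash_of of alg_action gT A : Type := {ffun gT -> A}.
Notation smash := (smash_of act).
HB.instance Definition _ := GRing.Lmodule.copy smash {ffun gT -> A}.

Definition smash_one : smash := [ffun g => (g == 1%g)%:R].
Definition smash_mul (u v : smash) : smash :=
  [ffun k => \sum_g u g * act g (v (g^-1 * k)%g)].

Definition smash_alg (a : A) : smash := [ffun g => if g == 1%g then a else 0].
Definition smash_grp (g : gT) : smash := [ffun h => (h == g)%:R].

Lemma smash_mulA : associative smash_mul.
Proof.
move=> u v w; apply/ffunP => k; rewrite !ffunE.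
transitivity (\sum_g \sum_h u g * act g (v h) * act (g * h)%g (w (h^-1 * (g^-1 * k))%g)).
  apply: eq_bigr => g _; rewrite ffunE raddf_sum mulr_sumr; apply: eq_bigr => h _.
  by rewrite alg_actM -mulrA; congr (_ * _); exact: (rmorphM (act g)).
under [RHS]eq_bigr do rewrite ffunE mulr_suml.
rewrite [RHS]exchange_big; apply: eq_bigr => g _ /=.
rewrite [RHS](reindex_inj (mulgI g)) /=; apply: eq_bigr => h _.
by rewrite mulKg invMg mulgA.
Qed.
Lemma smash_mul1r : left_id smash_one smash_mul.
Proof.
move=> u; apply/ffunP => k; rewrite !ffunE (bigD1 1%g) //= big1 ?addr0.
  by rewrite ffunE eqxx mul1r alg_act1 invg1 mul1g.
by move=> g /negbTE g1; rewrite ffunE g1 mul0r.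
Qed.
Lemma smash_mulr1 : right_id smash_one smash_mul.
Proof.
move=> u; apply/ffunP => k; rewrite !ffunE (bigD1 k) //= big1 ?addr0.
  by rewrite ffunE mulVg eqxx rmorph1 mulr1.
move=> g gk; rewrite ffunE -eq_mulVg1 (negbTE gk) raddf0 mulr0 //.
Qed.
Lemma smash_mulDl : left_distributive smash_mul +%R.
Proof.
move=> u v w; apply/ffunP => k; rewrite !ffunE -big_split; apply: eq_bigr => g _.
by rewrite ffunE mulrDl.
Qed.
Lemma smash_mulDr : right_distributive smash_mul +%R.
Proof.
move=> u v w; apply/ffunP => k; rewrite !ffunE -big_split; apply: eq_bigr => g _.
by rewrite ffunE raddfD mulrDr.
Qed.
Lemma smash_one_neq0 : smash_one != 0.
Proof.
apply/eqP => /ffunP/(_ 1%g); rewrite !ffunE eqxx => /eqP.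
by rewrite oner_eq0.
Qed.
HB.instance Definition _ := GRing.Zmodule_isNzRing.Build smash
  smash_mulA smash_mul1r smash_mulr1 smash_mulDl smash_mulDr smash_one_neq0.

Lemma smash_scalerAl (k : K) (u v : smash) : k *: (u * v) = (k *: u) * v.
Proof.
apply/ffunP => h; rewrite !ffunE scaler_sumr; apply: eq_bigr => g _.
by rewrite ffunE scalerAl.
Qed.
HB.instance Definition _ := GRing.Lmodule_isLalgebra.Build K smash smash_scalerAl.
Lemma smash_scalerAr (k : K) (u v : smash) : k *: (u * v) = u * (k *: v).
Proof.
apply/ffunP => h; rewrite !ffunE scaler_sumr; apply: eq_bigr => g _.
by rewrite ffunE linearZ scalerAr.
Qed.
HB.instance Definition _ := GRing.Lalgebra_isAlgebra.Build K smash smash_scalerAr.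

Lemma smash_grpM g h : smash_grp (g * h)%g = smash_grp g * smash_grp h.
Proof.
apply/ffunP => k; rewrite !ffunE (bigD1 g) //= big1 ?addr0.
  by rewrite !ffunE eqxx mul1r rmorph_nat -(can2_eq (mulKVg g) (mulKg g)).
by move=> g' /negbTE g'g; rewrite ffunE g'g mul0r.
Qed.
End SmashProduct.

Section ReflectionRepresentation.
Variables (K : fieldType) (n : nat).

Definition coord_sum (v : 'rV[K]_n) : K^o := \sum_i v 0 i.
Lemma coord_sum_is_linear : linear coord_sum.
Proof.
move=> k u v; rewrite /coord_sum scaler_sumr -big_split /=; apply: eq_bigr => i _.
by rewrite !mxE.
Qed.
HB.instance Definition _ :=
  GRing.isLinear.Build K 'rV[K]_n K^o _ coord_sum coord_sum_is_linear.

(* The vectors of K^n with zero coordinate sum. *)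
Definition refl_space : Type := subvs_of (lker (linfun coord_sum)).
HB.instance Definition _ := Vector.on refl_space.

Lemma refl_spaceP (v : 'rV[K]_n) :
  reflect (\sum_i v 0 i = 0) (v \in lker (linfun coord_sum)).
Proof. by rewrite memv_ker lfunE; apply: eqP. Qed.

Lemma dim_refl_space : dim refl_space = n.-1.
Proof.
pose f := linfun coord_sum; change (\dim (lker f) = n.-1).
have dimV : \dim {:'rV[K]_n} = n by rewrite dimvf /dim /= mul1n.
have := limg_ker_dim f fullv; rewrite capfv dimV.
have [n0|n_gt0] := posnP n.
  move: (\dim (lker f)) (\dim (f @: fullv)%VS) => d d'.
  by rewrite n0 => /eqP; rewrite addn_eq0 => /andP[/eqP].
suff -> : (f @: fullv)%VS = fullv.
  by rewrite dimvf addn1; move: (\dim _) => d <-.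
apply/eqP; rewrite eqEsubv subvf /=; apply/subvP => a _.
have -> : a = f (a *: delta_mx 0 (Ordinal n_gt0)).
  rewrite lfunE /= /coord_sum (bigD1 (Ordinal n_gt0)) //= big1 ?addr0.
    by rewrite !mxE !eqxx mulr1.
  by move=> i /negbTE i0; rewrite !mxE i0 andbF mulr0.
exact/memv_img/memvf.
Qed.

(* The product of 'S_n is (g * h) i = h (g i), so that permuting coordinates by
   (g . v)_i = v_(g i) is a left action. *)
Definition refl_act (g : 'S_n) (v : refl_space) : refl_space :=
  vsproj _ (col_perm g (vsval v)).

Lemma refl_actE g v : vsval (refl_act g v) = col_perm g (vsval v).
Proof.
rewrite vsprojK //; apply/refl_spaceP.
have /refl_spaceP v0 := subvsP v; rewrite -[RHS]v0 [RHS](reindex_inj (@perm_inj _ g)).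
by apply: eq_bigr => i _; rewrite mxE.
Qed.

Lemma refl_act_is_linear g : linear (refl_act g).
Proof.
move=> k u v; apply: val_inj.
change (vsval (refl_act g (k *: u + v)) =
        k *: vsval (refl_act g u) + vsval (refl_act g v)).
rewrite !refl_actE.
by apply/rowP => i; rewrite !mxE.
Qed.
HB.instance Definition _ g :=
  GRing.isLinear.Build K refl_space refl_space _ (refl_act g) (refl_act_is_linear g).

Lemma refl_rep1 : linfun (refl_act 1%g) = \1%VF.
Proof.
by apply/lfunP => v; rewrite lfunE id_lfunE; apply: val_inj; rewrite /= refl_actE col_perm1.
Qed.
Lemma refl_repM g h :
  linfun (refl_act (g * h)%g) = (linfun (refl_act g) \o linfun (refl_act h))%VF.
Proof.
apply/lfunP => v; rewrite comp_lfunE !lfunE; apply: val_inj; rewrite /= !refl_actE.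
by apply/rowP => i; rewrite !mxE permM.
Qed.
Definition refl_rep : linear_rep 'S_n refl_space := LinearRep refl_rep1 refl_repM.

Definition transpositions : {set 'S_n} :=
  [set tperm ij.1 ij.2 | ij : 'I_n * 'I_n & ij.1 != ij.2]%SET.

End ReflectionRepresentation.

Notation refl_dual K n := 'Hom(refl_space K n, K^o).

Definition end_eigenspace (K : fieldType) (V : vectType K) (f : 'End(V)) (a : K) :
  {vspace V} := lker (f - a *: \1%VF).

(* alpha s and alphav s span the -1-eigenspaces of s in h^* and h; the pairing
   of y : h with x : h^* is x y. *)
Definition is_root_datum (K : fieldType) (n : nat)
    (alpha : 'S_n -> refl_dual K n) (alphav : 'S_n -> refl_space K n) : Prop :=
  forall s, s \in transpositions n ->
    [/\ end_eigenspace (dual_rep (refl_rep K n) s) (-1) = <[alpha s]>%VS,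
        end_eigenspace (refl_rep K n s) (-1) = <[alphav s]>%VS
      & alpha s (alphav s) = 2].

Section RationalCherednikAlgebra.
Variables (K : numFieldType) (n : nat).
Notation h := (refl_space K n).
Notation h' := (refl_dual K n).

Definition smash_tensor : Type :=
  smash_of (tensor_action (sum_rep (refl_rep K n) (dual_rep (refl_rep K n)))).
HB.instance Definition _ := GRing.Algebra.on smash_tensor.

Definition grp_elt (w : 'S_n) : smash_tensor := smash_grp _ w.
Definition y_elt (y : h) : smash_tensor := smash_alg _ (tensor_inj ((y, 0) : h * h')).
Definition x_elt (x : h') : smash_tensor := smash_alg _ (tensor_inj ((0, x) : h * h')).

Section Presentation.
Variables (alpha : 'S_n -> h') (alphav : 'S_n -> h) (c : K).

Definition commutator (a b : smash_tensor) : smash_tensor := a * b - b * a.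

Definition cherednik_relations : set smash_tensor :=
  [set r | exists x x' : h', r = commutator (x_elt x) (x_elt x')] `|`
  [set r | exists y y' : h, r = commutator (y_elt y) (y_elt y')] `|`
  [set r | exists (y : h) (x : h'), r = commutator (y_elt y) (x_elt x) -
     ((x y)%:A - c *: \sum_(s in transpositions n)
                        (alpha s y * x (alphav s)) *: grp_elt s)].

Definition cherednik : Type := quot_ring cherednik_relations.
HB.instance Definition _ := GRing.PzRing.on cherednik.

Definition symmetrizer : smash_tensor := n`!%:R^-1 *: \sum_w grp_elt w.

Lemma symmetrizer_idem : symmetrizer * symmetrizer = symmetrizer.
Proof.
rewrite /symmetrizer -scalerAl -scalerAr mulr_suml.
under eq_bigr => w _.
  rewrite mulr_sumr (reindex_inj (mulgI w^-1%g)) /=.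
  under eq_bigr => v _ do rewrite -[grp_elt _ * _]smash_grpM mulKVg.
  over.
rewrite sumr_const card_Sn -scaler_nat !scalerA -mulrA mulVf ?mulr1 //.
by rewrite pnatr_eq0 -lt0n fact_gt0.
Qed.

Definition cherednik_e : cherednik := quot_proj cherednik_relations symmetrizer.

Lemma cherednik_e_idem : cherednik_e * cherednik_e = cherednik_e.
Proof. by rewrite -rmorphM symmetrizer_idem. Qed.

Definition spherical : Type := corner_ring cherednik_e_idem.
HB.instance Definition _ := GRing.PzRing.on spherical.

End Presentation.
End RationalCherednikAlgebra.

(* Main.v *)
(** Let [D_i] be the Dunkl operators with parameter [c] and [e] the symmetrizer.  The
    algebra acts on the fraction field of [C[h]] by multiplications, permutations and the
    [D_i], and the action is faithful on [H_c e]: the PBW monomials [x^a y^b e] span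
    [H_c e], and they stay independent since iterated commutators with invariant
    polynomials, combined by Lagrange interpolation at the [x_i], act as differentiations
    in [y] up to lower order.

    Let [I] be a nonzero ideal of [e H_c e].  Commuting with invariant polynomials lowers
    the order, so [I] contains some nonzero [f e] with [f] polynomial.  The [T] in [H_c e]
    with [e H_c T] inside [I] form a left ideal [J]; let [a] be the ideal of the
    polynomials [f] with [f e] in [J], and suppose [1] is not in [a].  Choose a
    maximal set of roots whose product [delta] has no power in [a]; that a root does not
    belong to this set is then an equivalence relation [~] on the indices.  After
    localizing at [delta], only the reflections inside the blocks of [~] survive in the
    Dunkl operators.  If all the blocks are trivial, the localization of [a] is stable
    under derivations and hence contains [1].  Otherwise take a block [B] with [k >= 2]
    elements.  The coordinates of [B], centred at their mean, are nilpotent modulo [J].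
    The sum of their squares, the sum of the squares of the corresponding Dunkl operators
    and the Euler element [h] form an [sl_2]-triple, which yields a vector that [h]
    multiplies by an integer [r >= 0].  On its nonzero multiples by monomials of top degree
    [d], the operator [sum of the s_ij with i <> j in B, plus 2 d + t] vanishes, with a
    constant [t > 0] precisely because [-1 < c < 0].  But on the words of weight [d] that
    operator is positive definite, being a sum of squares plus [t]: a contradiction. *)
Require Import Defs.
From HB Require Import structures.
From mathcomp Require Import all_boot all_order all_fingroup all_algebra.
From mathcomp Require Import boolp reals complex mpoly ring lra zify.
From mathcomp Require monalg.

Set Implicit Arguments.
Unset Strict Implicit.
Unset Printing Implicit Defensive.
Import Order.TTheory GRing.Theory Num.Theory.
Local Open Scope ring_scope.

(** * Endomorphisms of a field over a base field *)

(** Over h, the module [H e / J] is supported on the zero set of [ann]. At the points of this set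
    where [delta] does not vanish, every root outside [Pi] vanishes, so the blocks of [~] describe
    the parabolic subgroup that fixes a generic point of a stratum of the support. The main obstacle
    is that [ann] records what happens to [e] alone, while the [sl_2] argument needs nilpotency on
    further vectors, which are invariant only under the permutations preserving each block. Right
    multiplication of [f e] by [T e] gives a sum over all of [S_n]; multiplying by differences of
    coordinates removes the permutations that move some index to another block. The constant [t] is
    forced. Let S be the sum of the reflections over ordered pairs in B. On monomials of top degree
    d, [h] acts by [r + d] and also by [(c S - (k - 1)) / 2]. Hence [S + 2 d + t] vanishes, with [t
    = (k - 1 + 2 r) / (- c) + 2 d (1 / (- c) - 1)]. The first summand is positive since [c < 0] and
    [k >= 2], the second is nonnegative since [-1 < c]. *)

Section Endomorphisms.
Variables (K F : fieldType) (cst : {rmorphism K -> F}).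

(** F is a field without a K-module structure, so linearity over K is expressed through [cst].
    Compatibility with subtraction already yields zero, opposites and sums. *)
Record endo := Endo {
  endo_fun :> F -> F;
  endoB : forall u v, endo_fun (u - v) = endo_fun u - endo_fun v;
  endoZ : forall a u, endo_fun (cst a * u) = cst a * endo_fun u }.

Lemma endoP (S T : endo) : (forall u, S u = T u) -> S = T.
Proof.
case: S T => [f fB fZ] [g gB gZ] /= /funext fg; subst g.
by congr Endo; apply: Prop_irrelevance.
Qed.

HB.instance Definition _ := gen_eqMixin endo.
HB.instance Definition _ := gen_choiceMixin endo.

Lemma endo0 (T : endo) : T 0 = 0.
Proof. by rewrite -[X in T X](subrr (0 : F)) endoB subrr. Qed.
Lemma endoN (T : endo) u : T (- u) = - T u.
Proof. by rewrite -[X in T X]sub0r endoB endo0 sub0r. Qed.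
Lemma endoD (T : endo) u v : T (u + v) = T u + T v.
Proof. by rewrite -[v in LHS]opprK endoB endoN opprK. Qed.

Fact zero_endoB (u v : F) : 0 = 0 - 0 :> F. Proof. by rewrite subrr. Qed.
Fact zero_endoZ (a : K) (u : F) : 0 = cst a * 0. Proof. by rewrite mulr0. Qed.
Definition zero_endo := @Endo (fun=> 0) zero_endoB zero_endoZ.

Fact opp_endoB (T : endo) u v : - T (u - v) = - T u - - T v.
Proof. by rewrite endoB opprD. Qed.
Fact opp_endoZ (T : endo) a u : - T (cst a * u) = cst a * - T u.
Proof. by rewrite endoZ mulrN. Qed.
Definition opp_endo (T : endo) := Endo (opp_endoB T) (opp_endoZ T).

Fact add_endoB (S T : endo) u v : S (u - v) + T (u - v) = S u + T u - (S v + T v).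
Proof. by rewrite !endoB opprD addrACA. Qed.
Fact add_endoZ (S T : endo) a u : S (cst a * u) + T (cst a * u) = cst a * (S u + T u).
Proof. by rewrite !endoZ mulrDr. Qed.
Definition add_endo (S T : endo) := Endo (add_endoB S T) (add_endoZ S T).

Fact add_endoA : associative add_endo.
Proof. by move=> S T U; apply: endoP => u /=; rewrite addrA. Qed.
Fact add_endoC : commutative add_endo.
Proof. by move=> S T; apply: endoP => u /=; rewrite addrC. Qed.
Fact add0endo : left_id zero_endo add_endo.
Proof. by move=> S; apply: endoP => u /=; rewrite add0r. Qed.
Fact addNendo : left_inverse zero_endo opp_endo add_endo.
Proof. by move=> S; apply: endoP => u /=; rewrite addNr. Qed.
HB.instance Definition _ :=
  GRing.isZmodule.Build endo add_endoA add_endoC add0endo addNendo.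

Definition one_endo := @Endo id (fun _ _ => erefl) (fun _ _ => erefl).
Fact mul_endoB (S T : endo) u v : S (T (u - v)) = S (T u) - S (T v).
Proof. by rewrite !endoB. Qed.
Fact mul_endoZ (S T : endo) a u : S (T (cst a * u)) = cst a * S (T u).
Proof. by rewrite !endoZ. Qed.
Definition mul_endo (S T : endo) := Endo (mul_endoB S T) (mul_endoZ S T).

Fact mul_endoA : associative mul_endo. Proof. by move=> S T U; apply: endoP. Qed.
Fact mul1endo : left_id one_endo mul_endo. Proof. by move=> S; apply: endoP. Qed.
Fact mulendo1 : right_id one_endo mul_endo. Proof. by move=> S; apply: endoP. Qed.
Fact mul_endoDl : left_distributive mul_endo +%R.
Proof. by move=> S T U; apply: endoP. Qed.
Fact mul_endoDr : right_distributive mul_endo +%R.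
Proof. by move=> S T U; apply: endoP => u /=; rewrite endoD. Qed.
Fact one_endo_neq0 : one_endo != 0.
Proof.
apply/eqP => /(congr1 (fun T : endo => T 1)) /= /eqP; exact/negP/oner_neq0.
Qed.
HB.instance Definition _ := GRing.Zmodule_isNzRing.Build endo
  mul_endoA mul1endo mulendo1 mul_endoDl mul_endoDr one_endo_neq0.

Fact scale_endoB a (T : endo) u v : cst a * T (u - v) = cst a * T u - cst a * T v.
Proof. by rewrite endoB mulrBr. Qed.
Fact scale_endoZ a (T : endo) b u : cst a * T (cst b * u) = cst b * (cst a * T u).
Proof. by rewrite endoZ mulrCA. Qed.
Definition scale_endo a (T : endo) := Endo (scale_endoB a T) (scale_endoZ a T).

Fact scale_endoA a b T : scale_endo a (scale_endo b T) = scale_endo (a * b) T.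
Proof. by apply: endoP => u /=; rewrite rmorphM mulrA. Qed.
Fact scale1endo : left_id 1 scale_endo.
Proof. by move=> T; apply: endoP => u /=; rewrite rmorph1 mul1r. Qed.
Fact scale_endoDr : right_distributive scale_endo +%R.
Proof. by move=> a S T; apply: endoP => u /=; rewrite mulrDr. Qed.
Fact scale_endoDl T : {morph scale_endo^~ T : a b / a + b}.
Proof. by move=> a b; apply: endoP => u /=; rewrite rmorphD mulrDl. Qed.
HB.instance Definition _ := GRing.Zmodule_isLmodule.Build K endo
  scale_endoA scale1endo scale_endoDr scale_endoDl.
Fact scale_endoAl a (S T : endo) : a *: (S * T) = (a *: S) * T.
Proof. exact: endoP. Qed.
HB.instance Definition _ := GRing.Lmodule_isLalgebra.Build K endo scale_endoAl.
Fact scale_endoAr a (S T : endo) : a *: (S * T) = S * (a *: T).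
Proof. by apply: endoP => u /=; rewrite endoZ. Qed.
HB.instance Definition _ := GRing.Lalgebra_isAlgebra.Build K endo scale_endoAr.

Lemma addEndoE (S T : endo) u : (S + T) u = S u + T u. Proof. by []. Qed.
Lemma oppEndoE (T : endo) u : (- T) u = - T u. Proof. by []. Qed.
Lemma mulEndoE (S T : endo) u : (S * T) u = S (T u). Proof. by []. Qed.
Lemma scaleEndoE a (T : endo) u : (a *: T) u = cst a * T u. Proof. by []. Qed.
Lemma sumEndoE I (r : seq I) (P : pred I) (f : I -> endo) u :
  (\sum_(i <- r | P i) f i) u = \sum_(i <- r | P i) f i u.
Proof. by elim/big_rec2: _ => // i x y _ <-. Qed.

Fact mulop_endoB (f u v : F) : f * (u - v) = f * u - f * v.
Proof. exact: mulrBr. Qed.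
Fact mulop_endoZ (f : F) a u : f * (cst a * u) = cst a * (f * u).
Proof. exact: mulrCA. Qed.
Definition mulop (f : F) := Endo (mulop_endoB f) (mulop_endoZ f).

Fact mulop_is_zmod_morphism : zmod_morphism mulop.
Proof. by move=> f g; apply: endoP => u /=; rewrite mulrBl. Qed.
HB.instance Definition _ := GRing.isZmodMorphism.Build F endo mulop mulop_is_zmod_morphism.
Fact mulop_is_monoid_morphism : monoid_morphism mulop.
Proof. by split=> [|f g]; apply: endoP => u /=; rewrite ?mul1r ?mulrA. Qed.
HB.instance Definition _ := GRing.isMonoidMorphism.Build F endo mulop mulop_is_monoid_morphism.

Lemma mulopE f u : mulop f u = f * u. Proof. by []. Qed.
Lemma mulopC f g : mulop f * mulop g = mulop g * mulop f.
Proof. by rewrite -!rmorphM mulrC. Qed.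
Lemma mulop_cst a : mulop (cst a) = a%:A.
Proof. exact: endoP. Qed.
End Endomorphisms.

(** * Rational functions on the reflection representation *)

(* An interface for the fraction field of K[h], with its S_n-action and the derivations
   along the projections of the basis vectors of K^n; [rf_x i] is the i-th coordinate.
   Working with it abstractly keeps fractions of polynomials from being unfolded. *)
Record refl_field (K : numFieldType) (m : nat) := ReflField {
  rf_sort :> fieldType;
  rf_cst : {rmorphism K -> rf_sort};
  rf_x : 'I_m.+1 -> rf_sort;
  rf_act : 'S_m.+1 -> {rmorphism rf_sort -> rf_sort};
  rf_der : 'I_m.+1 -> rf_sort -> rf_sort;
  rf_sum_x : \sum_i rf_x i = 0;
  rf_act_cst : forall w a, rf_act w (rf_cst a) = rf_cst a;
  rf_act_x : forall w i, rf_act w (rf_x i) = rf_x (w^-1%g i);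
  rf_derB : forall i u v, rf_der i (u - v) = rf_der i u - rf_der i v;
  rf_derM : forall i u v, rf_der i (u * v) = rf_der i u * v + u * rf_der i v;
  rf_der_cst : forall i a, rf_der i (rf_cst a) = 0;
  rf_der_x : forall i j, rf_der i (rf_x j) = (i == j)%:R - m.+1%:R^-1;
  rf_inj : forall p, mmap rf_cst (fun i => rf_x (lift ord_max i)) p = 0 -> p = 0;
  rf_frac : forall u, exists p q : {mpoly K[m]}, q != 0 /\
    u = mmap rf_cst (fun i => rf_x (lift ord_max i)) p /
        mmap rf_cst (fun i => rf_x (lift ord_max i)) q }.

Section ReflField.
Variables (K : numFieldType) (m : nat) (F : refl_field K m).
Local Notation n := m.+1.
Implicit Types (i j k l : 'I_n) (w : 'S_n) (f g u v : F).
Local Notation cst := (rf_cst F).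
Local Notation x := (@rf_x K m F).
Local Notation act := (@rf_act K m F).
Local Notation der := (@rf_der K m F).

(** The coordinates sum to zero, and those other than the last are free: K[h] is a polynomial ring
    in m variables. *)
Definition ev : {mpoly K[m]} -> F := mmap cst (fun i : 'I_m => x (lift ord_max i)).
HB.instance Definition _ := GRing.RMorphism.on ev.

Lemma ev_eq0 p : (ev p == 0) = (p == 0).
Proof. by apply/eqP/eqP => [/rf_inj //|->]; rewrite raddf0. Qed.
Lemma ev_frac u : exists p q, q != 0 /\ u = ev p / ev q.
Proof. exact: rf_frac. Qed.
Lemma evC a : ev a%:MP = cst a. Proof. exact: mmapC. Qed.
Lemma evX (i : 'I_m) : ev 'X_i = x (lift ord_max i).
Proof. by rewrite /ev mmapX mmap1U. Qed.

Lemma x_max : x ord_max = - \sum_(i < m) x (lift ord_max i).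
Proof.
have := rf_sum_x F; rewrite big_ord_recr /= => /eqP; rewrite addrC addr_eq0 => /eqP ->.
by congr (- _); apply: eq_bigr => i _; congr (x _); apply: val_inj; exact: esym (lift_max i).
Qed.

Definition pol : pred F := [pred f | `[< exists p, f = ev p >]].
Lemma polP f : reflect (exists p, f = ev p) (f \in pol).
Proof. exact: asboolP. Qed.

Lemma pol_subring_closed : subring_closed pol.
Proof.
split=> [|f g|f g]; first by apply/polP; exists 1; rewrite rmorph1.
  by move=> /polP[p ->] /polP[q ->]; apply/polP; exists (p - q); rewrite rmorphB.
by move=> /polP[p ->] /polP[q ->]; apply/polP; exists (p * q); rewrite rmorphM.
Qed.
HB.instance Definition _ := GRing.isSubringClosed.Build F pol pol_subring_closed.

Lemma pol_ev p : ev p \in pol. Proof. by apply/polP; exists p. Qed.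
Lemma pol_cst a : cst a \in pol. Proof. by rewrite -evC pol_ev. Qed.
Lemma pol_x i : x i \in pol.
Proof.
case: (unliftP ord_max i) => [j ->|->]; first by rewrite -evX pol_ev.
by rewrite x_max rpredN rpred_sum // => j _; rewrite -evX pol_ev.
Qed.

Lemma pol_ind (P : F -> Prop) :
  (forall a, P (cst a)) -> (forall i, P (x i)) ->
  (forall f g, P f -> P g -> P (f + g)) -> (forall f g, P f -> P g -> P (f * g)) ->
  forall f, f \in pol -> P f.
Proof.
move=> Pc Px PD PM f /polP[p ->].
elim/mpolyind: p => [|a e p _ _ IH]; first by rewrite raddf0 -(rmorph0 cst).
have -> : ev (a *: 'X_[e] + p) = cst a * mmap1 (fun i : 'I_m => x (lift ord_max i)) e + ev p.
  by rewrite /ev [LHS]mmapD mmapZ mmapX.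
apply: PD => //.
apply: (PM) => //; rewrite /mmap1.
apply: (big_ind P) => [|u v|i _]; [by rewrite -(rmorph1 cst)|exact: PM|].
by elim: (e i) => [|k IHk]; rewrite ?expr0 -?(rmorph1 cst) // exprS; apply: PM.
Qed.

Lemma pol_frac u : exists f g, [/\ f \in pol, g \in pol, g != 0 & u = f / g].
Proof.
have [p [q [q0 ->]]] := ev_frac u; exists (ev p), (ev q).
by rewrite !pol_ev ev_eq0.
Qed.

(** On a quotient, [d (f / g * g)] reduces to [d (f / g) * phi g], and [phi g] is nonzero. The twist
    by [phi] serves [act_der], where the difference of the two sides is a derivation relative to
    [act w]. *)
Lemma twisted_der_ext (phi : {rmorphism F -> F}) (d : F -> F) :
  (forall u v, d (u + v) = d u + d v) ->
  (forall u v, d (u * v) = d u * phi v + phi u * d v) ->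
  (forall a, d (cst a) = 0) -> (forall i, d (x i) = 0) -> forall u, d u = 0.
Proof.
move=> dD dM dc dx u.
have dpol f : f \in pol -> d f = 0.
  elim/pol_ind => // f' g' d1 d2; first by rewrite dD d1 d2 addr0.
  by rewrite dM d1 d2 mul0r mulr0 addr0.
have [f [g [fP gP g0 ->]]] := pol_frac u.
have : d (f / g * g) = 0 by rewrite divfK // dpol.
rewrite dM (dpol g) // mulr0 addr0 => /eqP; rewrite mulf_eq0 => /orP[/eqP //|].
by rewrite fmorph_eq0 (negPf g0).
Qed.

Lemma rmorph_ext (phi psi : {rmorphism F -> F}) :
  (forall a, phi (cst a) = psi (cst a)) -> (forall i, phi (x i) = psi (x i)) ->
  phi =1 psi.
Proof.
move=> hc hx u.
have hp f : f \in pol -> phi f = psi f.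
  elim/pol_ind => // f' g' h1 h2; first by rewrite !rmorphD h1 h2.
  by rewrite !rmorphM h1 h2.
by have [f [g [fP gP g0 ->]]] := pol_frac u; rewrite !fmorph_div !hp.
Qed.

Lemma rf_act1 : act 1%g =1 id.
Proof.
apply: (rmorph_ext (psi := idfun)) => [a|i] /=; first exact: rf_act_cst.
by rewrite rf_act_x invg1 perm1.
Qed.
Lemma rf_actM (w1 w2 : 'S_n) : act (w1 * w2)%g =1 act w1 \o act w2.
Proof.
apply: (rmorph_ext (psi := act w1 \o act w2)) => [a|i] /=.
  by rewrite !rf_act_cst.
by rewrite !rf_act_x invMg permM.
Qed.
Lemma pol_act w f : f \in pol -> act w f \in pol.
Proof.
elim/pol_ind => [a|i|u v hu hv|u v hu hv]; rewrite ?rf_act_cst ?pol_cst //.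
- by rewrite rf_act_x pol_x.
- by rewrite rmorphD rpredD.
- by rewrite rmorphM rpredM.
Qed.

Lemma der0 i : der i 0 = 0.
Proof. by rewrite -[X in der i X](subrr (0 : F)) rf_derB subrr. Qed.
Lemma derD i u v : der i (u + v) = der i u + der i v.
Proof.
by rewrite -[v in LHS]opprK rf_derB -[- v]sub0r rf_derB der0 sub0r opprK.
Qed.
Lemma act_der w i u : act w (der i u) = der (w^-1%g i) (act w u).
Proof.
apply/eqP; rewrite -subr_eq0; apply/eqP; move: u.
apply: (twisted_der_ext (phi := act w)
  (d := fun u => act w (der i u) - der (w^-1%g i) (act w u))) => [u v|u v|a|k] /=.
- by rewrite !(rmorphD, derD) opprD addrACA.
- by rewrite !(rf_derM, rmorphD, rmorphM) /=; ring.
- by rewrite rf_der_cst rf_act_cst rf_der_cst rmorph0 subrr.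
- by rewrite rf_act_x !rf_der_x rmorphB fmorphV !rmorph_nat (inj_eq perm_inj) subrr.
Qed.
Lemma pol_der i f : f \in pol -> der i f \in pol.
Proof.
suff: f \in pol -> f \in pol /\ der i f \in pol by move=> h /h [].
elim/pol_ind => [a|j|u v [hu du] [hv dv]|u v [hu du] [hv dv]].
- by rewrite rf_der_cst rpred0 pol_cst.
- by rewrite rf_der_x -!(rmorph_nat cst) -fmorphV -rmorphB pol_cst pol_x.
- by rewrite derD !rpredD.
- by rewrite rf_derM rpredD ?rpredM.
Qed.

End ReflField.

(** * Dunkl operators *)

Lemma commutator_jacobi (R : pzRingType) (a b c : R) :
  (a * b - b * a) * c - c * (a * b - b * a) =
  (a * (b * c - c * b) - (b * c - c * b) * a) - (b * (a * c - c * a) - (a * c - c * a) * b).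
Proof.
rewrite !(mulrBl, mulrBr, mulrA) !opprB.
move: (a * b * c) (b * a * c) (c * a * b) (c * b * a) (a * c * b) (b * c * a).
move=> {a b c} abc bac cab cba acb bca.
by rewrite [RHS](AC ((2*2)*(2*2)) (((1*8)*(3*6))*((2*5)*(4*7))))/= !addNr !addr0.
Qed.

Section DunklOperators.
Variables (K : numFieldType) (m : nat) (F : refl_field K m).
Local Notation n := m.+1.
Implicit Types (i j k l : 'I_n) (w : 'S_n) (f g u v : F).
Local Notation cst := (rf_cst F).
Local Notation x := (@rf_x K m F).
Local Notation act := (@rf_act K m F).
Local Notation der := (@rf_der K m F).
Local Notation E := (endo cst).
Local Notation mu := (mulop cst).
Local Notation pol := (@pol K m F).

Fact act_endoB w u v : act w (u - v) = act w u - act w v.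
Proof. exact: rmorphB. Qed.
Fact act_endoZ w a u : act w (cst a * u) = cst a * act w u.
Proof. by rewrite rmorphM rf_act_cst. Qed.
Definition sg w : E := Endo (act_endoB w) (act_endoZ w).

Fact der_endoZ i a u : der i (cst a * u) = cst a * der i u.
Proof. by rewrite rf_derM rf_der_cst mul0r add0r. Qed.
Definition dd i : E := Endo (@rf_derB _ _ F i) (der_endoZ i).

Definition xroot i j : F := x i - x j.

Lemma xroot_neq0 i j : i != j -> xroot i j != 0.
Proof.
move=> ij; apply/eqP => /(congr1 (der i)).
rewrite rf_derB !rf_der_x eqxx (negPf ij) der0 opprB addrA subrK subr0 => /eqP.
by rewrite oner_eq0.
Qed.
Lemma pol_xroot i j : xroot i j \in pol.
Proof. by rewrite rpredB ?pol_x. Qed.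
Lemma act_xroot w i j : act w (xroot i j) = xroot (w^-1%g i) (w^-1%g j).
Proof. by rewrite /xroot rmorphB !rf_act_x. Qed.
Lemma xrootN i j : - xroot i j = xroot j i. Proof. exact: opprB. Qed.

Lemma sg1 : sg 1%g = 1.
Proof. by apply: endoP => u /=; rewrite rf_act1. Qed.
Lemma sgM (w1 w2 : 'S_n) : sg (w1 * w2)%g = sg w1 * sg w2.
Proof. by apply: endoP => u /=; rewrite rf_actM. Qed.
Lemma sg_mu w f : sg w * mu f = mu (act w f) * sg w.
Proof. by apply: endoP => u /=; rewrite rmorphM. Qed.
Lemma dd_mu i f : dd i * mu f = mu f * dd i + mu (der i f).
Proof. by apply: endoP => u /=; rewrite rf_derM addrC. Qed.
Lemma sg_dd w i : sg w * dd i = dd (w^-1%g i) * sg w.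
Proof. by apply: endoP => u /=; rewrite act_der. Qed.

Variable cc : 'I_n -> 'I_n -> K.
Local Notation s i j := (sg (tperm i j)).

(* The parameter may depend on the reflection: setting it to 0 outside a parabolic
   subgroup gives the Dunkl operators of that subgroup. *)
Fact dunkl_key : unit. Proof. by []. Qed.
Definition dunkl i : E := locked_with dunkl_key
  (dd i - \sum_(j | j != i) cc i j *: (mu (xroot i j)^-1 * (1 - s i j))).
Lemma dunklE i :
  dunkl i = dd i - \sum_(j | j != i) cc i j *: (mu (xroot i j)^-1 * (1 - s i j)).
Proof. by rewrite [LHS]unlock. Qed.

Lemma dunkl_mu i f : dunkl i * mu f = mu f * dunkl i + mu (der i f)
  - \sum_(j | j != i) cc i j *: (mu ((f - act (tperm i j) f) / xroot i j) * s i j).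
Proof.
rewrite !dunklE mulrBl mulrBr dd_mu mulr_suml mulr_sumr.
rewrite [_ - _ + mu (der i f)]addrAC -[RHS]addrA -opprD -big_split; congr (_ - _); apply: eq_bigr => j _ /=.
by apply: endoP => u /=; rewrite rmorphM /=; ring.
Qed.

(** The divided differences vanish for the reflections that fix [f]. This applies to
    [S_n]-invariants, to powers of [delta] once the parameter is restricted to the blocks, and to
    every [f] when the blocks are trivial. *)
Lemma dunkl_mu_inv i f : (forall j, j != i -> cc i j != 0 -> act (tperm i j) f = f) ->
  dunkl i * mu f = mu f * dunkl i + mu (der i f).
Proof.
move=> inv; rewrite dunkl_mu big1 ?subr0 // => j ji.
have [->|ccij] := eqVneq (cc i j) 0; first by rewrite scale0r.
by rewrite inv // subrr mul0r rmorph0 mul0r scaler0.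
Qed.

Lemma sg_dunkl w i : (forall i j, cc (w i) (w j) = cc i j) ->
  sg w * dunkl i = dunkl (w^-1%g i) * sg w.
Proof.
move=> ccw; rewrite !dunklE mulrBl mulrBr sg_dd; congr (_ - _).
have [k ->] : exists k, i = w k by exists (w^-1%g i); rewrite permKV.
rewrite permK mulr_sumr mulr_suml (reindex_inj (@perm_inj _ w)) /=.
apply: eq_big => [j|j _]; first by rewrite (inj_eq perm_inj).
rewrite ccw -scalerAr -scalerAl; congr (_ *: _).
rewrite mulrA sg_mu fmorphV act_xroot !permK -!mulrA; congr (_ * _).
rewrite mulrBr mulrBl mulr1 mul1r -!sgM; congr (_ - sg _).
by rewrite -tpermJ conjgE mulKVg.
Qed.

(** The constant [n^-1] arises because [der i] differentiates along the projection of the i-th basis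
    vector to the vectors of coordinate sum zero. *)
Lemma dunkl_x i j : dunkl i * mu (x j) - mu (x j) * dunkl i =
  if i == j then (1 - m.+1%:R^-1)%:A - \sum_(k | k != i) cc i k *: s i k
  else (- m.+1%:R^-1)%:A + cc i j *: s i j.
Proof.
rewrite dunkl_mu addrAC [mu (x j) * _ + _]addrC addrK rf_der_x.
have -> : (i == j)%:R - n%:R^-1 = cst ((i == j)%:R - n%:R^-1) :> F.
  by rewrite rmorphB fmorphV !rmorph_nat.
rewrite mulop_cst; case: eqVneq => [<-|ij].
  congr (_ - _); apply: eq_bigr => k ki; congr (_ *: _).
  by rewrite rf_act_x tpermV tpermL divff ?xroot_neq0 1?eq_sym // rmorph1 mul1r.
rewrite sub0r (bigD1 j) 1?eq_sym //= big1 ?addr0 => [|k /andP[ki kj]].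
  rewrite -scalerN -mulNr -rmorphN rf_act_x tpermV tpermR -/(xroot j i) -xrootN.
  by rewrite mulNr opprK divff ?xroot_neq0 // rmorph1 mul1r.
by rewrite rf_act_x tpermV tpermD // subrr mul0r rmorph0 mul0r scaler0.
Qed.

Lemma dunkl_cst i a : dunkl i (cst a) = 0.
Proof.
rewrite dunklE addEndoE oppEndoE sumEndoE big1 ?subr0 => [|j _] /=; first exact: rf_der_cst.
by rewrite rf_act_cst subrr !mulr0.
Qed.

(** Commuting with the coordinates makes [T] linear over K[h] and, after clearing denominators, over
    F; so [T] is determined by its value at 1. *)
Lemma commute_pol_eq0 (T : E) :
  (forall i, T * mu (x i) = mu (x i) * T) -> T 1 = 0 -> T = 0.
Proof.
move=> Tx T1; apply: endoP => u.
have TM f g : f \in pol -> T (f * g) = f * T g.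
  move=> fP; elim/pol_ind: fP g => [a|i|f1 f2 h1 h2|f1 f2 h1 h2] g.
  - exact: endoZ.
  - by have := congr1 (fun S : E => S g) (Tx i).
  - by rewrite mulrDl endoD h1 h2 mulrDl.
  - by rewrite -!mulrA h1 h2.
have [f [g [fP gP g0 ->]]] := pol_frac u.
apply: (mulfI g0); rewrite -TM // mulr0 mulrC divfK //.
by rewrite -[f]mulr1 TM // T1 mulr0.
Qed.
End DunklOperators.

(** * Commutativity of the Dunkl operators *)

Section ConstantParameter.
Variables (K : numFieldType) (m : nat) (F : refl_field K m) (c : K).
Local Notation n := m.+1.
Implicit Types (i j k l : 'I_n).
Local Notation D := (dunkl F (fun _ _ : 'I_n => c)).
Local Notation mu := (mulop (rf_cst F)).
Local Notation x := (@rf_x K m F).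
Local Notation s i j := (sg F (tperm i j)).

Lemma s_dunkl i j k : s i j * D k = D (tperm i j k) * s i j.
Proof. by rewrite sg_dunkl // tpermV. Qed.

(** The commutator kills 1, so it is enough that it commutes with each [x k]. By the Jacobi identity
    this involves only the brackets of [D i] and [D j] with constants and reflections; for k equal
    to i or j the remaining multiples of [(D i - D j) * s i j] cancel. *)
Lemma dunkl_comm i j : D i * D j = D j * D i.
Proof.
have [->//|ij] := eqVneq i j.
apply/eqP; rewrite -subr_eq0; apply/eqP; apply: commute_pol_eq0 => [k|]; last first.
  by rewrite addEndoE oppEndoE !mulEndoE -(rmorph1 (rf_cst F)) !dunkl_cst !endo0 subrr.
apply/eqP; rewrite -subr_eq0 commutator_jacobi !dunkl_x.
have commD (a : K) (S T : endo (rf_cst F)) :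
    T * (a%:A + S) - (a%:A + S) * T = T * S - S * T.
  by rewrite mulrDr mulrDl mulr_algr mulr_algl opprD addrACA subrr add0r.
have comm_s p q l : l != p -> l != q -> D l * (c *: s p q) - (c *: s p q) * D l = 0.
  by move=> lp lq; rewrite -scalerAl s_dunkl tpermD 1?eq_sym // -scalerAr subrr.
have comm_sum p q : q != p -> D q * (\sum_(l | l != p) c *: s p l) -
    (\sum_(l | l != p) c *: s p l) * D q = c *: ((D q - D p) * s p q).
  move=> qp; rewrite mulr_sumr mulr_suml -sumrB (bigD1 q) //= big1 ?addr0.
    by rewrite -scalerAr -scalerAl s_dunkl tpermR mulrBl scalerBr.
  by move=> l /andP[lp lq]; rewrite comm_s // eq_sym.
have comm_j p q : q != p -> D q * (c *: s p q) - (c *: s p q) * D q = c *: ((D q - D p) * s p q).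
  by move=> qp; rewrite -scalerAr -scalerAl s_dunkl tpermR mulrBl scalerBr.
case: (eqVneq j k) => [<-|jk].
  rewrite (negPf ij) !commD mulrN mulNr -opprD comm_sum // comm_j 1?eq_sym //.
  by rewrite (tpermC j i) -opprD -scalerDr -mulrDl addrA subrK subrr mul0r scaler0 oppr0.
case: (eqVneq i k) => [<-|ik].
  rewrite !commD mulrN mulNr -opprD opprK comm_sum 1?eq_sym // comm_j //.
  by rewrite (tpermC j i) -scalerDr -mulrDl addrA subrK subrr mul0r scaler0.
by rewrite !commD !comm_s ?subrr // 1?eq_sym.
Qed.

End ConstantParameter.

(** * Swap operators on words *)

Section SwapOperator.
Variables (K : numClosedFieldType) (n M : nat) (B : {set 'I_n}).
Local Notation word := {ffun 'I_n -> 'I_M}.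
Implicit Types (a b : word) (f : word -> K) (i j : 'I_n).

Definition swap i j a : word := [ffun l => a (tperm i j l)].
(** A word is read as the exponent vector of a monomial; the weight is its degree in the variables
    of the block. *)
Definition weight a : nat := \sum_(i in B) a i.
Definition setw i (q : 'I_M) a : word := [ffun l => if l == i then q else a l].

Lemma swapK i j : involutive (swap i j).
Proof. by move=> a; apply/ffunP => l; rewrite !ffunE tpermK. Qed.
Lemma swapC i j a : swap i j a = swap j i a.
Proof. by rewrite /swap tpermC. Qed.
Lemma weight_swap i j a : i \in B -> j \in B -> weight (swap i j a) = weight a.
Proof.
move=> iB jB; rewrite /weight [RHS](reindex_inj (@perm_inj _ (tperm i j))) /=.
apply: eq_big => [l|l _]; last by rewrite ffunE.
by case: tpermP => [->|->|//]; rewrite ?iB ?jB.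
Qed.

(** Raising the letter of [x.1] at [i] from p to q gives a word [a] with [a i = q]. For [i != j] it
    has [a j = p], and raising the letter at [j] instead gives [swap i j a]. The pair is recovered
    from [a] as [(setw i p a, a i)]. *)
Lemma sum_setw (f g : word -> K) i j (p : 'I_M) :
  \sum_(x : word * 'I_M | [&& x.1 i == p, x.1 j == p & (p < x.2)%N])
     f (setw i x.2 x.1) * g (setw j x.2 x.1) =
  if i == j then \sum_(a : word | (p < a i)%N) f a * g a
  else \sum_(a : word | (a j == p) && (p < a i)%N) f a * g (swap i j a).
Proof.
case: eqVneq => [<-|ij].
  rewrite [RHS](reindex_onto (fun x : word * 'I_M => setw i x.2 x.1)
    (fun a => (setw i p a, a i))) /=; last first.
    by move=> a _; apply/ffunP => l; rewrite !ffunE; case: eqP => // ->.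
  apply: eq_big => [[b q]|[b q] _ //] /=; rewrite ffunE eqxx.
  case: ltnP => pq; rewrite ?andbF //= xpair_eqE eqxx !andbT andbb.
  apply/eqP/eqP => [bp|<-]; last by rewrite !ffunE eqxx.
  by apply/ffunP => l; rewrite !ffunE; case: eqP => // ->.
rewrite [RHS](reindex_onto (fun x : word * 'I_M => setw i x.2 x.1)
    (fun a => (setw i p a, a i))) /=; last first.
  by move=> a _; apply/ffunP => l; rewrite !ffunE; case: eqP => // ->.
apply: eq_big => [[b q]|[b q] /and3P[/= /eqP bi /eqP bj _]] /=.
  rewrite [X in _ = _ && X](_ : _ = (b i == p)); last first.
    rewrite xpair_eqE [setw i q b i]ffunE !eqxx andbT; apply/eqP/eqP => [<-|bp]; first by rewrite !ffunE eqxx.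
    by apply/ffunP => l; rewrite !ffunE; case: eqP => // ->.
  by rewrite !ffunE eqxx [j == i]eq_sym (negPf ij) [RHS]andbC.
congr (_ * g _); apply/ffunP => l; rewrite !ffunE.
case: tpermP => [->|->|/eqP li /eqP lj].
- by rewrite (negPf ij) eq_sym (negPf ij) bi bj.
- by rewrite !eqxx.
- by rewrite (negPf li) (negPf lj).
Qed.

Lemma sum_ltn_ord (u : K) (k : nat) : (k <= M)%N -> \sum_(p < M | (p < k)%N) u = u *+ k.
Proof.
by move=> kM; rewrite -(big_ord_widen M (fun=> u) kM) sumr_const card_ord.
Qed.

(* A Casimir identity: moving one letter p up to q > p, and its adjoint, turn
   the sum of all swaps plus the weight into a sum of squares. *)
Lemma swap_sum_of_squares f :
  \sum_(p : 'I_M) \sum_(x : word * 'I_M | (p < x.2)%N)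
    `|\sum_(i in B | x.1 i == p) f (setw i x.2 x.1)| ^+ 2 =
  \sum_(i in B) \sum_(j in B | j != i) \sum_(a : word | (a j < a i)%N) (f a)^* * f (swap i j a)
  + \sum_a `|f a| ^+ 2 *+ weight a.
Proof.
transitivity (\sum_(p : 'I_M) \sum_(i in B) \sum_(j in B)
  \sum_(x : word * 'I_M | [&& x.1 i == p, x.1 j == p & (p < x.2)%N])
     (f (setw i x.2 x.1))^* * f (setw j x.2 x.1)).
  apply: eq_bigr => p _.
  transitivity (\sum_(x : word * 'I_M | (p < x.2)%N) \sum_(i in B | x.1 i == p)
     \sum_(j in B | x.1 j == p) (f (setw i x.2 x.1))^* * f (setw j x.2 x.1)).
    apply: eq_bigr => x _; rewrite normCK mulrC rmorph_sum mulr_suml.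
    by apply: eq_bigr => i _; rewrite mulr_sumr.
  rewrite (exchange_big_dep (mem B)) /= => [|x i _ /andP[]//]; apply: eq_bigr => i iB.
  under eq_bigr do rewrite big_mkcondr /=.
  rewrite [RHS](eq_bigr (fun j => \sum_(x : word * 'I_M | (p < x.2)%N && (x.1 i == p))
     if x.1 j == p then (f (setw i x.2 x.1))^* * f (setw j x.2 x.1) else 0)).
    by rewrite exchange_big; apply: eq_bigr => j _; apply: eq_bigl => x; rewrite iB.
  move=> j _; rewrite -big_mkcondr; apply: eq_bigl => x.
  by rewrite andbA andbC andbA.
under eq_bigr do under eq_bigr do under eq_bigr do rewrite (sum_setw (fun a => (f a)^*) f).
rewrite exchange_big /=.
under eq_bigr => i iB do rewrite exchange_big (bigD1 i) //= eqxx.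
rewrite big_split /= addrC; congr (_ + _).
  apply: eq_bigr => i iB; apply: eq_bigr => j /andP[jB ji].
  rewrite eq_sym (negPf ji) [RHS](partition_big (fun a => a j) xpredT) //=.
  apply: eq_bigr => p _; apply: eq_bigl => a.
  by rewrite [RHS]andbC; case: eqP => //= ->.
transitivity (\sum_(i in B) \sum_a `|f a| ^+ 2 *+ a i).
  apply: eq_bigr => i _; rewrite (exchange_big_dep xpredT) //=; apply: eq_bigr => a _.
  rewrite (sum_ltn_ord _ (ltnW (ltn_ord (a i)))) normCK; congr (_ *+ _); exact: mulrC.
by rewrite exchange_big; apply: eq_bigr => a _; rewrite sumrMnr.
Qed.

(** Pair the equation with [f]. The swaps with [a i = a j] give [Q >= 0], the others give [2 T];
    since [T + W] is a sum of squares [SS], what remains is [2 SS + Q + t N = 0] with N the squared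
    norm of [f]. *)
Lemma swap_operator_inj f (t : K) : 0 < t ->
  (forall a, \sum_(i in B) \sum_(j in B | j != i) f (swap i j a)
             + ((weight a).*2%:R + t) * f a = 0) ->
  forall a, f a = 0.
Proof.
move=> t0 fker.
have sum0 : \sum_(a : word) (f a)^* * (\sum_(i in B) \sum_(j in B | j != i) f (swap i j a)
             + ((weight a).*2%:R + t) * f a) = 0.
  by apply: big1 => a _; rewrite fker mulr0.
pose T := \sum_(i in B) \sum_(j in B | j != i)
  \sum_(a : word | (a j < a i)%N) (f a)^* * f (swap i j a).
pose Q := \sum_(i in B) \sum_(j in B | j != i)
  \sum_(a : word | a j == a i) (f a)^* * f (swap i j a).
have Q0 : 0 <= Q.
  apply: sumr_ge0 => i _; apply: sumr_ge0 => j _; apply: sumr_ge0 => a /eqP aij.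
  suff -> : swap i j a = a by rewrite mulrC -normCK exprn_ge0.
  by apply/ffunP => l; rewrite ffunE; case: tpermP => [->|->|].
have decomp : \sum_(a : word) (f a)^* * (\sum_(i in B) \sum_(j in B | j != i) f (swap i j a))
    = T *+ 2 + Q.
  transitivity (\sum_(i in B) \sum_(j in B | j != i) \sum_a (f a)^* * f (swap i j a)).
    under eq_bigr do rewrite mulr_sumr.
    rewrite exchange_big; apply: eq_bigr => i _.
    under eq_bigr do rewrite mulr_sumr.
    by rewrite exchange_big.
  (* Exchanging the roles of i and j identifies the sum over [a i < a j] with the one over
     [a j < a i]. *)
  have -> : T *+ 2 = T + \sum_(i in B) \sum_(j in B | j != i)
      \sum_(a : word | (a i < a j)%N) (f a)^* * f (swap i j a).
    rewrite mulr2n; congr (_ + _); rewrite (exchange_big_dep (mem B)) /=; last first.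
      by move=> i j _ /andP[].
    apply: eq_bigr => i iB; apply: eq_big => [j|j _]; first by rewrite iB eq_sym.
    by apply: eq_bigr => a _; rewrite swapC.
  rewrite -!big_split; apply: eq_bigr => i _; rewrite -!big_split; apply: eq_bigr => j _ /=.
  rewrite (bigID (fun a : word => (a j < a i)%N)) -addrA; congr (_ + _).
  rewrite (bigID (fun a : word => (a i < a j)%N)); congr (_ + _); apply: eq_bigl => a /=.
    by case: ltngtP.
  by rewrite -val_eqE /=; case: ltngtP.
have termE a : (f a)^* * (((weight a).*2%:R + t) * f a) =
    `|f a| ^+ 2 *+ weight a *+ 2 + t * `|f a| ^+ 2.
  by rewrite normCK -mulrnA muln2 -[_ *+ _ in RHS]mulr_natl; ring.
pose W := \sum_a `|f a| ^+ 2 *+ weight a; pose N := \sum_a `|f a| ^+ 2.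
have {}sum0 : T *+ 2 + Q + (W *+ 2 + t * N) = 0.
  rewrite -decomp -sumrMnl mulr_sumr -!big_split -[RHS]sum0 /=.
  by apply: eq_bigr => a _; rewrite mulrDr termE.
have := swap_sum_of_squares f; rewrite -/T -/W; set SS := \sum_(p < M) _ => SSE.
have SS0 : 0 <= SS by do 2!apply: sumr_ge0 => ? _; apply: exprn_ge0.
have N0 : 0 <= N by apply: sumr_ge0 => a _; apply: exprn_ge0.
have /eqP : SS *+ 2 + Q + t * N = 0 by rewrite -sum0 SSE mulrnDl; ring.
rewrite paddr_eq0 ?addr_ge0 ?mulrn_wge0 ?mulr_ge0 ?(ltW t0) // => /andP[_].
rewrite mulf_eq0 gt_eqF //= psumr_eq0 => [/allP Na a|a _]; last exact: exprn_ge0.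
by have := Na a; rewrite mem_index_enum sqrf_eq0 normr_eq0 => /(_ isT) /eqP.
Qed.

(** An injective operator on a finite-dimensional space is onto. The preimage [g] of the indicator
    of [a0] supplies the coefficients by which the relations of [block_vanishing] combine to a
    single monomial. *)
Lemma swap_operator_surj (t : K) (a0 : word) : 0 < t -> exists g : word -> K,
  forall a, \sum_(i in B) \sum_(j in B | j != i) g (swap i j a)
             + ((weight a).*2%:R + t) * g a = (a == a0)%:R.
Proof.
move=> t0.
pose phi (g : {ffun word -> K^o}) : {ffun word -> K^o} :=
  [ffun a => \sum_(i in B) \sum_(j in B | j != i) g (swap i j a)
             + ((weight a).*2%:R + t) * g a].
have phi_lin : linear phi.
  move=> k u v; apply/ffunP => a; rewrite !ffunE /= scalerDr addrACA; congr (_ + _).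
    rewrite scaler_sumr -big_split; apply: eq_bigr => i _ /=.
    by rewrite scaler_sumr -big_split; apply: eq_bigr => j _ /=; rewrite !ffunE.
  by rewrite mulrDr; congr (_ + _); rewrite /GRing.scale /= mulrCA.
pose phiL := GRing.isLinear.Build K {ffun word -> K^o} {ffun word -> K^o} _ phi phi_lin.
pose Phi : {linear {ffun word -> K^o} -> {ffun word -> K^o}} := HB.pack phi phiL.
have kerPhi : lker (linfun Phi) == 0%VS.
  apply/lker0P => u v; rewrite !lfunE => /eqP; rewrite -subr_eq0 -raddfB => /eqP uv.
  apply/eqP; rewrite -subr_eq0; apply/eqP/ffunP => a.
  have -> := swap_operator_inj (f := u - v) t0 => [|b]; first by rewrite ffunE.
  by have /ffunP/(_ b) := uv; rewrite !ffunE.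
have : [ffun a => (a == a0)%:R] \in limg (linfun Phi).
  by rewrite (lker0_limgf kerPhi) memvf.
move=> /memv_imgP[g _]; rewrite lfunE /= => /ffunP gE.
by exists g => a; have := gE a; rewrite !ffunE.
Qed.
End SwapOperator.

(** * The sl_2 argument for one block *)

Section BlockRepresentation.
Variables (K : numClosedFieldType) (A : comNzRingType) (E : algType K).
Variables (mu : {rmorphism A -> E}) (n : nat) (B : {set 'I_n}) (c : K).
Variables (xi : 'I_n -> A) (Y : 'I_n -> E) (s : 'I_n -> 'I_n -> E).
Implicit Types i j l : 'I_n.
Hypothesis cardB : (1 < #|B|)%N.
Hypothesis c_bounds : -1 < c < 0.
Local Notation k := (#|B|%:R : K).
Local Notation X i := (mu (xi i)).

(** The bracket of [Y i] and [X j] in the Cherednik algebra of the symmetric group of the block;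
    [k^-1] is due to centring the coordinates at their mean. *)
Definition block_comm i j : E :=
  if i == j then (1 - k^-1)%:A - c *: \sum_(l in B | l != i) s i l
  else (- k^-1)%:A + c *: s i j.

Hypothesis YX : forall i j, i \in B -> j \in B -> Y i * X j = X j * Y i + block_comm i j.
Hypothesis sC : forall i j, s i j = s j i.
Hypothesis sX : forall i j l, i \in B -> j \in B -> s i j * X l = X (tperm i j l) * s i j.
Hypothesis sumX : \sum_(i in B) xi i = 0.

(** Normalized so that [[h, Ef] = 2 Ef] and [[Fh, Ef] = 4 h]. *)
Let Ef : A := \sum_(i in B) xi i ^+ 2.
Let Fh : E := \sum_(i in B) Y i ^+ 2.
Let h : E := 2^-1 *: \sum_(i in B) (X i * Y i + Y i * X i).

Lemma block_comm_diag i :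
  block_comm i i = (1 - k^-1)%:A - c *: \sum_(l in B | l != i) s i l.
Proof. by rewrite /block_comm eqxx. Qed.
Lemma block_comm_off i j : i != j -> block_comm i j = (- k^-1)%:A + c *: s i j.
Proof. by rewrite /block_comm => /negPf ->. Qed.

(** This sum is [[Y j, Ef]]. Moving the [X i] past the reflections makes the diagonal and
    off-diagonal contributions of the reflections cancel, and [k^-1] multiplies the sum of the
    [X i], which is zero. *)
Lemma sum_block_comm j : j \in B ->
  \sum_(i in B) (X i * block_comm j i + block_comm j i * X i) = X j *+ 2.
Proof.
move=> jB; rewrite (bigD1 j) //=.
pose S := \sum_(i in B | i != j) (X i * s j i + X j * s j i).
have -> : \sum_(i in B | i != j) (X i * block_comm j i + block_comm j i * X i) =
    (- k^-1) *: (\sum_(i in B | i != j) X i) *+ 2 + c *: S.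
  rewrite !scaler_sumr -sumrMnl -big_split /=.
  apply: eq_bigr => i /andP[iB ij]; rewrite block_comm_off 1?eq_sym // mulrDr mulrDl.
  rewrite mulr_algr mulr_algl addrACA -mulr2n; congr (_ + _).
  by rewrite -scalerAr -scalerAl sX // tpermR scalerDr.
have -> : X j * block_comm j j + block_comm j j * X j = (1 - k^-1) *: X j *+ 2 - c *: S.
  rewrite block_comm_diag mulrBr mulrBl mulr_algr mulr_algl addrACA -mulr2n.
  rewrite -scalerAr -scalerAl -opprD -scalerDr mulr_sumr mulr_suml -big_split /=.
  congr (_ - _ *: _); apply: eq_bigr => i /andP[iB ij].
  by rewrite sX // tpermL addrC.
rewrite [Z in _ + Z]addrC addrA subrK.
rewrite scalerBl scale1r mulrnBl -addrA -[RHS]addr0; congr (_ + _).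
rewrite addrC scaleNr mulNrn -opprD -mulrnDl -scalerDr.
have /(congr1 mu) := sumX; rewrite raddf_sum (bigD1 j) //= raddf0 addrC => ->.
by rewrite scaler0 mul0rn oppr0.
Qed.

Lemma block_commC i j : block_comm i j = block_comm j i.
Proof. by rewrite /block_comm eq_sym; case: eqVneq => [->|_] //; rewrite sC. Qed.

Lemma Y_Ef i : i \in B -> Y i * mu Ef = mu Ef * Y i + X i *+ 2.
Proof.
move=> iB; rewrite -sum_block_comm // rmorph_sum mulr_sumr mulr_suml -big_split /=.
apply: eq_bigr => j jB; rewrite expr2 rmorphM mulrA YX // mulrDl -mulrA YX //.
by rewrite mulrDr mulrA -addrA.
Qed.

(** As [block_comm] is symmetric, the bracket of [2 h] with [X j] is the sum already evaluated for
    [[Y j, Ef]]. *)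
Lemma h_X j : j \in B -> h * X j = X j * h + X j.
Proof.
move=> jB; have -> : X j * h + X j = 2^-1 *: (X j * (h *+ 2) + X j *+ 2).
  rewrite mulrnAr -mulrnDl -scalerMnr scalerMnl -mulr_natr mulVf ?scale1r //.
  by rewrite pnatr_eq0.
rewrite -scalerAl; congr (_ *: _).
rewrite -sum_block_comm // {1}/h scalerMnl -mulr_natr mulVf ?pnatr_eq0 // scale1r.
rewrite mulr_suml mulr_sumr -big_split /=; apply: eq_bigr => i iB.
have XC u v : mu u * mu v = mu v * mu u by rewrite -!rmorphM mulrC.
rewrite block_commC mulrDl mulrDr addrACA; congr (_ + _).
  by rewrite -[X i * Y i * X j]mulrA YX // mulrDr mulrA XC mulrA.
by rewrite -[Y i * X i * X j]mulrA XC mulrA YX // mulrDl mulrA.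
Qed.

Lemma Fh_Ef : Fh * mu Ef = mu Ef * Fh + h *+ 4.
Proof.
have -> : h *+ 4 = \sum_(i in B) (X i * Y i + Y i * X i) *+ 2.
  rewrite sumrMnl (mulrnA _ 2 2) {1}/h scalerMnl -mulr_natr mulVf ?pnatr_eq0 //.
  by rewrite scale1r.
rewrite mulr_suml mulr_sumr -big_split /=; apply: eq_bigr => i iB.
rewrite expr2 -mulrA Y_Ef // mulrDr mulrA Y_Ef // mulrDl !mulrA -addrA; congr (_ + _).
by rewrite mulrnAl mulrnAr -mulrnDl.
Qed.

Lemma h_Ef : h * mu Ef = mu Ef * (h + 2%:R).
Proof.
rewrite mulrDr mulr_natr rmorph_sum mulr_sumr mulr_suml -sumrMnl -big_split /=.
apply: eq_bigr => i iB; rewrite expr2 rmorphM mulrA h_X // mulrDl -mulrA h_X //.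
by rewrite mulrDr mulrA -addrA -mulr2n.
Qed.

(** Each of the N + 1 factors contributes [4 h], and moving [h] past the powers of [Ef] to its right
    shifts it by 0, 2, ..., 2N; the average shift is N. *)
Lemma Fh_Ef_exp N : Fh * mu Ef ^+ N.+1 =
  mu Ef ^+ N.+1 * Fh + (mu Ef ^+ N * (h + N%:R)) *+ (4 * N.+1).
Proof.
elim: N => [|N IH]; first by rewrite !expr1 expr0 mul1r addr0 Fh_Ef.
have hE : (h + N%:R) * mu Ef = mu Ef * (h + (2 + N)%:R).
  by rewrite mulrDl h_Ef mulr_natl natrD [in RHS]addrA [RHS]mulrDr mulr_natr.
rewrite exprSr mulrA IH mulrDl -mulrA Fh_Ef mulrDr mulrA -exprSr -addrA; congr (_ + _).
have aux (P H : E) (a b : nat) : P * (H + a%:R) *+ b = P * H *+ b + P *+ (a * b).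
  by rewrite mulrDr mulr_natr mulrnDl mulrnA.
rewrite mulrnAr mulrnAl -mulrA hE mulrA -exprSr !aux addrA -mulrnDr.
by congr (_ *+ _ + _ *+ _); lia.
Qed.

Let hwt := fun (f : A) (d : nat) => h * mu f = mu f * (h + d%:R).

Lemma hwtM f g d e : hwt f d -> hwt g e -> hwt (f * g) (d + e).
Proof.
rewrite /hwt => hf hg; rewrite rmorphM mulrA hf -!mulrA mulrDl hg mulr_natl.
by rewrite natrD; congr (_ * _); rewrite !mulrDr !mulr_natr -!addrA [in RHS](addrC (_ *+ d)).
Qed.

Lemma hwt1 : hwt 1 0.
Proof. by rewrite /hwt rmorph1 mulr1 mul1r addr0. Qed.

Lemma hwtX f d r : hwt f d -> hwt (f ^+ r) (d * r).
Proof.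
move=> hf; elim: r => [|r IH]; first by rewrite expr0 muln0; exact: hwt1.
by rewrite exprS mulnS; apply: hwtM.
Qed.

Lemma hwt_x i : i \in B -> hwt (xi i) 1.
Proof. by move=> iB; rewrite /hwt h_X // mulrDr mulr1. Qed.

Let mon := fun a : 'I_n -> nat => \prod_(i in B) xi i ^+ a i.

Lemma hwt_mon a : hwt (mon a) (\sum_(i in B) a i).
Proof.
rewrite /mon; apply: (big_ind2 hwt) => [|f d g e|i iB]; first exact: hwt1.
  exact: hwtM.
by rewrite -[Z in hwt _ Z]mul1n; apply/hwtX/hwt_x.
Qed.

Lemma s_Ef i j : i \in B -> j \in B -> s i j * mu Ef = mu Ef * s i j.
Proof.
move=> iB jB; rewrite rmorph_sum mulr_sumr mulr_suml.
rewrite [RHS](reindex_inj (@perm_inj _ (tperm i j))) /=.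
apply: eq_big => [l|l lB]; first by case: tpermP => [->|->|//]; rewrite ?iB ?jB.
by rewrite expr2 rmorphM mulrA sX // -mulrA sX // mulrA -rmorphM -expr2.
Qed.

Lemma s_mon i j a : i \in B -> j \in B ->
  s i j * mu (mon a) = mu (mon (fun l => a (tperm i j l))) * s i j.
Proof.
move=> iB jB.
have -> : mon (fun l => a (tperm i j l)) = \prod_(l in B) xi (tperm i j l) ^+ a l.
  rewrite /mon [LHS](reindex_inj (@perm_inj _ (tperm i j))) /=.
  apply: eq_big => [l|l lB]; last by rewrite tpermK.
  by case: tpermP => [->|->|//]; rewrite ?iB ?jB.
apply: (big_ind2 (fun f g => s i j * mu f = mu g * s i j)).
- by rewrite rmorph1 mulr1 mul1r.
- by move=> f1 g1 f2 g2 e1 e2; rewrite !rmorphM mulrA e1 -mulrA e2 mulrA.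
- move=> l lB; elim: (a l) => [|r IH]; first by rewrite !expr0 rmorph1 mulr1 mul1r.
  by rewrite !exprS !rmorphM mulrA sX // -mulrA IH mulrA.
Qed.

(** The form adapted to top degree: [Y i * X i] first raises the degree, hence vanishes there, and
    leaves [h] as a scalar plus reflections. The constant [k - 1] is the sum of the k diagonal terms
    [1 - k^-1]. *)
Lemma h_expand : h *+ 2 = (\sum_(i in B) Y i * X i) *+ 2 - (k - 1)%:A
  + c *: \sum_(i in B) \sum_(l in B | l != i) s i l.
Proof.
have k0 : k != 0 by rewrite pnatr_eq0 -lt0n ltnW.
have -> : (k - 1)%:A = \sum_(i in B) (1 - k^-1)%:A :> E.
  by rewrite sumr_const -scaler_nat scalerA mulrBr mulr1 mulfV.
rewrite scaler_sumr -sumrMnl -sumrB -big_split /=.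
rewrite /h scalerMnl -mulr_natr mulVf ?pnatr_eq0 // scale1r.
apply: eq_bigr => i iB; rewrite mulr2n -!addrA addrC YX // -!addrA; congr (_ + _).
rewrite block_comm_diag; move: (_%:A) (c *: _) => p q; set T := _ + (p - q).
by rewrite [RHS](AC (2*(1*(1*1))) ((1*3)*(2*4)*5))/= subrr addNr !add0r.
Qed.

(** Computing modulo [N] replaces passing to a quotient module. In the application [N] is the
    localized left ideal [loc J], and [V] consists of the vectors [linv] fixed by the permutations
    preserving each block. *)
Variables N V : E -> Prop.
Hypothesis ND : forall S T, N S -> N T -> N (S + T).
Hypothesis NZ : forall a T, N T -> N (a *: T).
Hypothesis NX : forall i T, i \in B -> N T -> N (X i * T).
Hypothesis NY : forall i T, i \in B -> N T -> N (Y i * T).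
Hypothesis VF : forall T, V T -> V ((\sum_(i in B) Y i ^+ 2) * T).
Hypothesis Vs : forall i j T, i \in B -> j \in B -> V T -> s i j * T = T.
Hypothesis VE : exists r, forall T, V T -> N (mu (\sum_(i in B) xi i ^+ 2) ^+ r * T).
Hypothesis VX : forall i, exists r, forall T, i \in B -> V T -> N (X i ^+ r * T).

Lemma N_sum I (r : seq I) (P : pred I) (f : I -> E) T0 : N T0 ->
  (forall t, P t -> N (f t)) -> N (\sum_(t <- r | P t) f t).
Proof.
move=> NT Nf; apply: (big_ind N) => [|S T|//]; last exact: ND.
by rewrite -(scale0r T0); exact: NZ.
Qed.

Lemma N_B S T : N S -> N T -> N (S - T).
Proof. by move=> NS NT; apply: ND => //; rewrite -scaleN1r; exact: NZ. Qed.

Lemma NX_exp i r T : i \in B -> N T -> N (X i ^+ r * T).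
Proof.
move=> iB NT; elim: r => [|r IH]; first by rewrite expr0 mul1r.
by rewrite exprS -mulrA; exact: NX.
Qed.

Lemma N_mon a T : N T -> N (mu (mon a) * T).
Proof.
rewrite /mon => NT; pose Q f := forall T, N T -> N (mu f * T).
suff : Q (\prod_(i in B) xi i ^+ a i) by exact.
apply: (big_ind Q) => [S NS|f g hf hg S NS|i iB S NS]; first by rewrite rmorph1 mul1r.
  by rewrite rmorphM -mulrA; apply/hf/hg.
by rewrite rmorphXn; exact: NX_exp.
Qed.

Lemma N_Ef T : N T -> N (mu Ef * T).
Proof.
move=> NT; rewrite rmorph_sum mulr_suml; apply: (N_sum _ NT) => i iB.
by rewrite rmorphXn; exact: NX_exp.
Qed.

(** With r + 1 the least power of [Ef] that sends all of [V] into [N], and [w] in [V] not killed by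
    the power r, the vector is [Ef ^+ r * w]. Minimality over all of [V] at once matters, since it
    is applied to [w] and to [Fh * w]. *)
Lemma block_eigenvector : ~ (forall T, V T -> N T) ->
  exists (r : nat) (v : E), [/\ ~ N v, N (h * v - v *+ r),
    forall i j, i \in B -> j \in B -> s i j * v = v &
    forall i, i \in B -> exists p, N (X i ^+ p * v)].
Proof.
move=> nV; pose P r := `[< forall T, V T -> N (mu Ef ^+ r * T) >].
have exP : exists r, P r by have [r hr] := VE; exists r; apply/asboolP.
case: (ex_minnP exP) => -[/asboolP h0|r /asboolP hr minr].
  by case: nV => T VT; rewrite -[T]mul1r -(expr0 (mu Ef)); exact: h0.
have : ~ (forall T, V T -> N (mu Ef ^+ r * T)).
  by move/asboolP => /minr; rewrite ltnn.
move=> /existsNP[w /not_implyP[Vw nNw]].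
exists r, (mu Ef ^+ r * w); split=> //.
- have NF : N (Fh * (mu Ef ^+ r.+1 * w)).
    rewrite /Fh mulr_suml; apply: (N_sum _ (hr w Vw)) => i iB.
    by rewrite expr2 -mulrA; apply: NY => //; apply: NY => //; exact: hr.
  (* Both [Fh * Ef ^+ r.+1 * w] and [Ef ^+ r.+1 * Fh * w] lie in [N], hence so does
     [Ef ^+ r * (h + r) * w]. *)
  have := N_B NF (hr _ (VF Vw)).
  rewrite mulrA -/Fh Fh_Ef_exp mulrDl -mulrA addrC addKr mulrnAl => /(NZ (4 * r.+1)%:R^-1).
  rewrite -scaler_nat scalerA mulVf ?scale1r ?pnatr_eq0 //.
  have /hwtX : hwt Ef 2 by exact: h_Ef.
  move=> /(_ r); rewrite /hwt rmorphXn => hE.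
  (* [Ef ^+ r] has weight 2 r, so bringing [h] to its left turns [h + r] into [h - r]. *)
  have -> : h * (mu Ef ^+ r * w) - mu Ef ^+ r * w *+ r = mu Ef ^+ r * (h + r%:R) * w; last by [].
  rewrite mulrA hE -[_ *+ r]mulr_natl mulrA -mulrBl; congr (_ * _).
  by rewrite mulr_natl mul2n -addnn !mulrDr !mulr_natr mulrnDr addrA addrK.
- move=> i j iB jB.
  have -> : s i j * (mu Ef ^+ r * w) = mu Ef ^+ r * (s i j * w).
    elim: r {hr minr nNw} => [|r IH]; first by rewrite !expr0 !mul1r.
    by rewrite !exprS -!mulrA [s i j * _]mulrA s_Ef // -mulrA IH.
  by rewrite Vs.
- move=> i iB; have [p hp] := VX i; exists p.
  rewrite mulrA -!rmorphXn -rmorphM mulrC rmorphM !rmorphXn -mulrA.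
  have {hp} := hp _ iB Vw; move: (X i ^+ p * w) => T NT.
  elim: r {hr minr nNw} => [|r IH]; first by rewrite expr0 mul1r.
  by rewrite exprS -mulrA; exact: N_Ef.
Qed.

(** Nilpotency of each [X i] bounds every exponent of a monomial that does not send [v] into [N], so
    the degrees of such monomials have a maximum. *)
Lemma top_degree v : ~ N v -> (forall i, i \in B -> exists p, N (X i ^+ p * v)) ->
  exists d, (exists2 a : 'I_n -> nat, \sum_(i in B) a i = d & ~ N (mu (mon a) * v)) /\
    forall a : 'I_n -> nat, \sum_(i in B) a i = d.+1 -> N (mu (mon a) * v).
Proof.
move=> nNv nil.
have /choice[p hp] : forall i, exists p, i \in B -> N (X i ^+ p * v).
  by move=> i; case: (boolP (i \in B)) => [/nil[p]|_]; [exists p|exists 0%N].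
pose D d := `[< exists2 a : 'I_n -> nat, \sum_(i in B) a i = d & ~ N (mu (mon a) * v) >].
have exD : exists d, D d.
  exists 0%N; apply/asboolP; exists (fun=> 0%N); first by rewrite big1.
  by rewrite /mon big1 // rmorph1 mul1r.
have ubD d : D d -> (d <= \sum_(i in B) p i)%N.
  move=> /asboolP[a <- nNa]; apply: leq_sum => i iB.
  rewrite leqNgt; apply/negP => /ltnW pa; apply: nNa.
  have -> : mon a = mon (fun l => if l == i then a l - p l else a l)%N * xi i ^+ p i.
    rewrite /mon (bigD1 i) //= [in RHS](bigD1 i) //= eqxx mulrAC -exprD subnK //.
    by congr (_ * _); apply: eq_bigr => l /andP[_ /negPf ->].
  by rewrite rmorphM -mulrA; apply: N_mon; rewrite rmorphXn; exact: hp.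
case: (ex_maxnP exD ubD) => d /asboolP hd maxd; exists d; split=> // a ad.
apply: contrapT => nNa; suff : (d.+1 <= d)%N by rewrite ltnn.
by apply: maxd; apply/asboolP; exists a.
Qed.

(** Since the reflections fix [v], they act on the vectors [Q a] by permuting exponents. Comparing
    the two expressions of [h] in top degree gives one linear relation modulo [N] for each monomial,
    and positivity makes this linear system invertible, so all the [Q a] of top degree lie in
    [N]. *)
Lemma block_vanishing T : V T -> N T.
Proof.
move: T; apply: contrapT => /block_eigenvector[r [v [nNv hv sv nil]]].
have [d [[a0 a0d nNa0] top]] := top_degree nNv nil.
have [c1 c0] := andP c_bounds.
have c_neq0 : c != 0 by rewrite lt_eqF.
(* The solution of [2 (r + d) = - (k - 1) + c S] for the sum S of the reflections is [S = - lam]. *)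
pose lam : K := - c^-1 * (k - 1 + (2 * (r + d))%:R).
pose Q a := mu (mon a) * v.
have rel a : \sum_(i in B) a i = d ->
  N (\sum_(i in B) \sum_(j in B | j != i) Q (fun l => a (tperm i j l)) + lam *: Q a).
  move=> ad.
  have h1 : N (h * Q a - Q a *+ (r + d)).
    have -> : h * Q a - Q a *+ (r + d) = mu (mon a) * (h * v - v *+ r).
      rewrite /Q mulrA hwt_mon ad -mulrA mulrDl mulr_natl mulrDr mulrBr !mulrnAr.
      by rewrite mulrnDr opprD addrACA subrr addr0.
    exact: N_mon.
  have h2 : N (\sum_(i in B) Y i * X i * Q a).
    apply: (N_sum _ hv) => i iB; rewrite -mulrA; apply: NY => //.
    rewrite /Q mulrA -rmorphM.
    have -> : xi i * mon a = mon (fun l => (l == i) + a l)%N.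
      rewrite /mon (bigD1 i) //= [in RHS](bigD1 i) //= eqxx add1n exprS mulrA.
      by congr (_ * _); apply: eq_bigr => l /andP[_ /negPf ->].
    apply: top; rewrite big_split /= ad (bigD1 i) //= eqxx big1 ?addn0 // => l.
    by move=> /andP[_ /negPf ->].
  have -> : \sum_(i in B) \sum_(j in B | j != i) Q (fun l => a (tperm i j l)) =
      (\sum_(i in B) \sum_(j in B | j != i) s i j) * Q a.
    rewrite mulr_suml; apply: eq_bigr => i iB; rewrite mulr_suml; apply: eq_bigr => j /andP[jB _].
    by rewrite /Q mulrA s_mon // -mulrA sv.
  set S := \sum_(i in B) _.
  have -> : S * Q a + lam *: Q a =
    c^-1 *: ((h * Q a - Q a *+ (r + d)) *+ 2 - (\sum_(i in B) Y i * X i * Q a) *+ 2).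
    have aux (z p q q' : E) : z - p + q - q' - z = q - (p + q').
      by rewrite [LHS](AC 5 ((1*5)*(3*(2*4))))/= subrr add0r opprD.
    have hQ : h * Q a *+ 2 = (\sum_(i in B) Y i * X i) *+ 2 * Q a - (k - 1) *: Q a + c *: (S * Q a).
      by rewrite -mulrnAl h_expand; move: (_ *+ 2) => Z2; rewrite !mulrDl mulNr mulr_algl -scalerAl.
    rewrite -mulr_suml mulrnBl hQ mulrnAl aux -mulrnA -[_ *+ (_ * 2)]scaler_nat -scalerDl.
    rewrite scalerBr !scalerA mulVf // scale1r -scaleNr -mulNr; congr (_ + _ *: _).
    by rewrite /lam mulnC.
  apply: NZ; rewrite !mulr2n; exact: (N_B (ND h1 h1) (ND h2 h2)).
pose t := lam - (2 * d)%:R.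
have t0 : 0 < t.
  have e1 : 1 < - c^-1 by rewrite -invrN invf_gt1 ?oppr_gt0 // ltrNl.
  (* Both bounds on [c] enter here: [- c^-1] exceeds 1, which makes the second summand nonnegative,
     and [k > 1] makes the first one positive. *)
  have -> : t = - c^-1 * (k - 1 + (2 * r)%:R) + (- c^-1 - 1) * (2 * d)%:R.
    by rewrite /t /lam mulnDr natrD; ring.
  apply: ltr_wpDr; first by rewrite mulr_ge0 // subr_ge0 ltW.
  apply: mulr_gt0; first exact: lt_trans ltr01 e1.
  by rewrite ltr_wpDr ?ler0n // subr_gt0 ltr1n.
(* In degree d the exponents on [B] are at most d, so d + 1 letters suffice. An exponent that is out
   of range can occur only outside [B], where [mon] ignores it, and [inord] makes it 0. *)
pose W := {ffun 'I_n -> 'I_d.+1}.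
pose w0 : W := [ffun i => inord (a0 i)].
have w0E i : i \in B -> w0 i = a0 i :> nat.
  by move=> iB; rewrite ffunE inordK // ltnS -a0d (bigD1 i) //= leq_addr.
have [g hg] := swap_operator_surj B w0 t0.
apply: nNa0.
pose Qw (a : W) := Q (fun l => a l).
have -> : mu (mon a0) * v = Qw w0.
  by rewrite /Qw /Q /mon; congr (mu _ * _); apply: eq_bigr => i iB; rewrite w0E.
have w0d : weight B w0 = d by rewrite -[RHS]a0d; apply: eq_bigr => i iB; rewrite w0E.
(* Each swap is an involution preserving the weight, so it can be moved from [Qw] to the
   coefficients [g]; by the choice of [g] only the word [w0] is left. *)
have -> : Qw w0 = \sum_(a : W | weight B a == d) g a *:
  (\sum_(i in B) \sum_(j in B | j != i) Qw (swap i j a) + lam *: Qw a).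
  transitivity (\sum_(a : W | weight B a == d) (a == w0)%:R *: Qw a).
    rewrite (bigD1 w0) ?w0d //= eqxx scale1r big1 ?addr0 // => a /andP[_ /negPf ->].
    by rewrite scale0r.
  under [RHS]eq_bigr do rewrite scalerDr scaler_sumr.
  rewrite big_split exchange_big /=.
  have -> : \sum_(i in B) \sum_(a : W | weight B a == d)
      g a *: \sum_(j in B | j != i) Qw (swap i j a) =
    \sum_(a : W | weight B a == d)
      (\sum_(i in B) \sum_(j in B | j != i) g (swap i j a)) *: Qw a.
    under [RHS]eq_bigr do rewrite scaler_suml.
    rewrite [RHS]exchange_big; apply: eq_bigr => i iB /=.
    under [LHS]eq_bigr do rewrite scaler_sumr; under [RHS]eq_bigr do rewrite scaler_suml.
    rewrite exchange_big [RHS]exchange_big; apply: eq_bigr => j /andP[jB _] /=.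
    rewrite (reindex_inj (inv_inj (swapK i j))); apply: eq_big => a.
      by rewrite weight_swap.
    by rewrite swapK.
  rewrite -big_split; apply: eq_bigr => a /eqP ad /=.
  rewrite -hg scalerA -scalerDl ad; congr (_ *: _); congr (_ + _).
  by rewrite mulrC /t -muln2 mulnC addrC subrK.
apply: (N_sum _ hv) => a /eqP ad; apply: NZ.
have := rel (fun l => a l) ad; congr (N (_ + _)).
apply: eq_bigr => i _; apply: eq_bigr => j _; congr (mu _ * _).
by apply: eq_bigr => l _; rewrite ffunE.
Qed.
End BlockRepresentation.

(** * The Dunkl algebra *)

Section DunklAlgebra.
Variables (K : numFieldType) (m : nat) (F : refl_field K m) (c : K).
Local Notation n := m.+1.
Implicit Types (i j k l : 'I_n) (w : 'S_n) (f g u v : F).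
Local Notation cst := (rf_cst F).
Local Notation x := (@rf_x K m F).
Local Notation act := (@rf_act K m F).
Local Notation der := (@rf_der K m F).
Local Notation E := (endo cst).
Local Notation mu := (mulop cst).
Local Notation pol := (@pol K m F).
Local Notation sg := (sg F).
Local Notation D := (dunkl F (fun _ _ : 'I_n => c)).
Implicit Types S T : E.

(** This turns out to be the image of the Cherednik algebra in the endomorphisms of F. *)
Inductive dunkl_alg : E -> Prop :=
| Dunkl_x i : dunkl_alg (mu (x i))
| Dunkl_sg w : dunkl_alg (sg w)
| Dunkl_D i : dunkl_alg (D i)
| Dunkl_add S T : dunkl_alg S -> dunkl_alg T -> dunkl_alg (S + T)
| Dunkl_mul S T : dunkl_alg S -> dunkl_alg T -> dunkl_alg (S * T)
| Dunkl_scale a T : dunkl_alg T -> dunkl_alg (a *: T).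
Local Notation H := dunkl_alg.

Lemma dunkl_alg1 : H 1. Proof. by rewrite -(sg1 F); exact: Dunkl_sg. Qed.
Lemma dunkl_alg0 : H 0. Proof. by rewrite -(scale0r 1); apply/Dunkl_scale/dunkl_alg1. Qed.
Lemma dunkl_algB S T : H S -> H T -> H (S - T).
Proof. by move=> hS hT; apply: Dunkl_add => //; rewrite -scaleN1r; exact: Dunkl_scale. Qed.
Lemma dunkl_alg_sum I (r : seq I) (P : pred I) (G : I -> E) :
  (forall t, P t -> H (G t)) -> H (\sum_(t <- r | P t) G t).
Proof. by move=> Hf; apply: (big_ind H) => //; [exact: dunkl_alg0|exact: Dunkl_add]. Qed.
Lemma dunkl_alg_pol f : f \in pol -> H (mu f).
Proof.
elim/pol_ind => [a|i|f1 f2|f1 f2]; rewrite ?mulop_cst ?rmorphD ?rmorphM.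
- exact/Dunkl_scale/dunkl_alg1.
- exact: Dunkl_x.
- exact: Dunkl_add.
- exact: Dunkl_mul.
Qed.

Definition symz : E := (n`!)%:R^-1 *: \sum_w sg w.
Local Notation e := symz.

Lemma sg_symz w : sg w * e = e.
Proof.
rewrite /symz -scalerAr mulr_sumr [in RHS](reindex_inj (mulgI w)) /=; congr (_ *: _).
by apply: eq_bigr => v _; rewrite sgM.
Qed.
Lemma symz_inv T : (forall w, sg w * T = T) -> e * T = T.
Proof.
move=> inv; rewrite -scalerAl mulr_suml (eq_bigr (fun=> T)) => [|w _]; last exact: inv.
rewrite sumr_const card_Sn -scaler_nat scalerA mulVf ?scale1r // pnatr_eq0 -lt0n.
exact: fact_gt0.
Qed.
Lemma symz_idem : e * e = e.
Proof. by apply: symz_inv => w; exact: sg_symz. Qed.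
Lemma dunkl_alg_symz : H e.
Proof. by apply/Dunkl_scale/dunkl_alg_sum => w _; exact: Dunkl_sg. Qed.
Lemma symz1 : e 1 = 1.
Proof.
rewrite scaleEndoE sumEndoE (eq_bigr (fun=> 1)) => [|w _ /=]; last by rewrite rmorph1.
rewrite sumr_const card_Sn fmorphV rmorph_nat mulVf //.
by rewrite -(rmorph_nat cst) fmorph_eq0 pnatr_eq0 -lt0n fact_gt0.
Qed.
Lemma mu_symz_inj f : mu f * e = 0 -> f = 0.
Proof. by move=> /(congr1 (fun T : E => T 1)); rewrite mulEndoE symz1 mulopE mulr1. Qed.

Definition invpol f := f \in pol /\ forall w, act w f = f.

Lemma sg_invpol w f : invpol f -> sg w * mu f = mu f * sg w.
Proof. by move=> [_ inv]; rewrite sg_mu inv. Qed.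
Lemma symz_invpol f : invpol f -> e * mu f = mu f * e.
Proof.
move=> fI; rewrite -scalerAl -scalerAr mulr_suml mulr_sumr; congr (_ *: _).
by apply: eq_bigr => w _; exact: sg_invpol.
Qed.

(* The order of a differential operator with coefficients in F[S_n], tested on invariant
   polynomials only, so that permutations have order 0. *)
Fixpoint fil (r : nat) T : Prop :=
  if r is r'.+1 then forall f, invpol f -> fil r' (T * mu f - mu f * T) else T = 0.

Lemma fil0 r : fil r 0.
Proof. by elim: r => //= r IH f _; rewrite mul0r mulr0 subrr. Qed.
Lemma filD r S T : fil r S -> fil r T -> fil r (S + T).
Proof.
elim: r S T => [|r IH] S T /=; first by move=> -> ->; rewrite addr0.
by move=> hS hT f hf; rewrite mulrDl mulrDr opprD addrACA; apply: IH; [exact: hS|exact: hT].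
Qed.
Lemma filZ r a T : fil r T -> fil r (a *: T).
Proof.
elim: r T => [|r IH] T /=; first by move=> ->; rewrite scaler0.
by move=> hT f hf; rewrite -scalerAl -scalerAr -scalerBr; apply/IH/hT.
Qed.
Lemma filS r T : fil r T -> fil r.+1 T.
Proof.
elim: r T => [|r IH] T; first by move=> -> f _; rewrite mul0r mulr0 subrr.
by move=> hT f hf; apply/IH/hT.
Qed.
Lemma fil_leq r s T : (r <= s)%N -> fil r T -> fil s T.
Proof. by move=> /subnK <- hT; elim: (s - r)%N => //= k IH; exact: filS. Qed.
Lemma fil_sum r I (s : seq I) (P : pred I) (G : I -> E) :
  (forall t, P t -> fil r (G t)) -> fil r (\sum_(t <- s | P t) G t).
Proof. by move=> Hf; apply: (big_ind (fil r)) => //; [exact: fil0|exact: filD]. Qed.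
(** [fil r.+1] means order at most r, so orders add. The bracket of a product with [f] is [S [T, f]
    + [S, f] T], and each summand lowers one of the two orders. *)
Lemma filM r s S T : fil r.+1 S -> fil s.+1 T -> fil (r + s).+1 (S * T).
Proof.
move: {2}(r + s)%N (erefl (r + s)%N) => t; elim: t r s S T => [|t IH] r s S T rst hS hT f hf;
    change (fil (r + s)%N (S * T * mu f - mu f * (S * T))).
  move: hS hT rst; case: r s => [|//] [|//] hS hT _; rewrite addn0 /=.
  have /eqP := hS _ hf; rewrite subr_eq0 => /eqP hSf.
  have /eqP := hT _ hf; rewrite subr_eq0 => /eqP hTf.
  by rewrite -mulrA hTf !mulrA hSf subrr.
have -> : S * T * mu f - mu f * (S * T) = S * (T * mu f - mu f * T) + (S * mu f - mu f * S) * T.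
  by rewrite mulrBr mulrBl !mulrA addrA subrK.
apply: filD.
  case: s rst hT => [|s] rst hT; first by rewrite (hT _ hf) mulr0; exact: fil0.
  by rewrite addnS; apply: IH => //; [lia|exact: hT].
case: r rst hS => [|r] rst hS; first by rewrite (hS _ hf) mul0r; exact: fil0.
by rewrite addSn; apply: IH => //; [lia|exact: hS].
Qed.
Lemma fil_mu f : fil 1 (mu f).
Proof. by move=> g _ /=; rewrite mulopC subrr. Qed.
Lemma fil_sg w : fil 1 (sg w).
Proof. by move=> g hg /=; rewrite sg_invpol // subrr. Qed.
Lemma D_invpol i f : invpol f -> D i * mu f - mu f * D i = mu (der i f).
Proof.
move=> [_ inv]; rewrite dunkl_mu_inv => [|j _ _]; last exact: inv.
by rewrite addrAC subrr add0r.
Qed.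
Lemma fil_D i : fil 2 (D i).
Proof. by move=> f hf; rewrite D_invpol //; exact: fil_mu. Qed.
Lemma fil_dunkl_alg T : H T -> exists r, fil r.+1 T.
Proof.
elim=> [i|w|i|S S' _ [r hr] _ [s hs]|S S' _ [r hr] _ [s hs]|a S _ [r hr]].
- by exists 0%N; exact: fil_mu.
- by exists 0%N; exact: fil_sg.
- by exists 1%N; exact: fil_D.
- by exists (maxn r s); apply: filD; [apply: fil_leq hr|apply: fil_leq hs]; lia.
- by exists (r + s)%N; exact: filM.
- by exists r; exact: filZ.
Qed.

(** Divided differences obey a twisted product rule, and on coordinates they are 0, 1 or -1. *)
Lemma pol_divdiff f i j : f \in pol -> i != j ->
  (f - act (tperm i j) f) / xroot F i j \in pol.
Proof.
move=> fP ij.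
suff : f \in pol /\ (f - act (tperm i j) f) / xroot F i j \in pol by case.
elim/pol_ind: fP => [a|l|f1 f2 [h1 d1] [h2 d2]|f1 f2 [h1 d1] [h2 d2]].
- by rewrite rf_act_cst subrr mul0r pol_cst rpred0.
- rewrite pol_x rf_act_x tpermV; split=> //; case: tpermP => [->|->|_ _].
  + by rewrite divff ?rpred1 // xroot_neq0.
  + by rewrite -/(xroot F j i) -xrootN mulNr divff ?rpredN ?rpred1 // xroot_neq0.
  + by rewrite subrr mul0r rpred0.
- by rewrite rmorphD opprD addrACA mulrDl !rpredD.
- split; first exact: rpredM.
  have -> : (f1 * f2 - act (tperm i j) (f1 * f2)) / xroot F i j =
      f1 * ((f2 - act (tperm i j) f2) / xroot F i j)
      + (f1 - act (tperm i j) f1) / xroot F i j * act (tperm i j) f2.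
    by rewrite rmorphM /=; ring.
  by rewrite rpredD // rpredM // pol_act.
Qed.

Lemma dunkl_alg_stable T f : H T -> f \in pol -> T f \in pol.
Proof.
move=> hT; elim: hT f => [i|w|i|S S' _ hS _ hS'|S S' _ hS _ hS'|a S _ hS] f fP.
- by rewrite mulopE rpredM ?pol_x.
- exact: pol_act.
- rewrite dunklE addEndoE oppEndoE sumEndoE rpredB //; first exact: pol_der.
  apply: rpred_sum => j ji; rewrite scaleEndoE rpredM ?pol_cst //.
  by rewrite mulEndoE mulopE mulrC pol_divdiff // eq_sym.
- by rewrite addEndoE rpredD ?hS ?hS'.
- by rewrite mulEndoE hS // hS'.
- by rewrite scaleEndoE rpredM ?pol_cst ?hS.
Qed.

(** Taking the product of all conjugates of a denominator as the new denominator makes it invariant;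
    the numerator is then invariant because [u] is. *)
Lemma inv_frac u : (forall w, act w u = u) ->
  exists f g, [/\ invpol f, invpol g, g != 0 & u = f / g].
Proof.
move=> inv; have [f [g [fP gP g0 uE]]] := pol_frac u.
pose g' := \prod_w act w g.
have g'inv : invpol g'.
  split=> [|w]; first by apply: rpred_prod => w _; exact: pol_act.
  rewrite rmorph_prod [RHS](reindex_inj (mulgI w)) /=.
  by apply: eq_bigr => v _; rewrite rf_actM.
have g'0 : g' != 0 by apply/prodf_neq0 => w _; rewrite fmorph_eq0.
exists (u * g'), g'; split=> //; last by rewrite mulfK.
split=> [|w]; last by rewrite rmorphM inv (proj2 g'inv).
rewrite uE /g' (bigD1 1%g) //= rf_act1 mulrA divfK // rpredM //.
by apply: rpred_prod => w _; exact: pol_act.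
Qed.

(** * Polynomials in a nonzero ideal of the corner *)

Section Ideal.
Variable I : E -> Prop.
Hypothesis I_alg : forall T, I T -> H T.
Hypothesis I_corner : forall T, I T -> e * T * e = T.
Hypothesis I_add : forall S T, I S -> I T -> I (S + T).
Hypothesis I_l : forall S T, H S -> I T -> I (e * S * e * T).
Hypothesis I_r : forall S T, H S -> I T -> I (T * (e * S * e)).

Lemma I_e T : I T -> e * T = T /\ T * e = T.
Proof.
by move=> /I_corner <-; rewrite !mulrA symz_idem; split=> //; rewrite -mulrA symz_idem.
Qed.

(** Since [e] commutes with [f] and [T = e T e], the bracket equals [T (e f e) - (e f e) T]. *)
Lemma I_comm T f : invpol f -> I T -> I (T * mu f - mu f * T).
Proof.
move=> fI IT; have [eT Te] := I_e IT.
have Hf : H (mu f) by apply/dunkl_alg_pol/(proj1 fI).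
have emu : e * mu f * e = mu f * e by rewrite symz_invpol // -mulrA symz_idem.
have -> : T * mu f - mu f * T = T * (e * mu f * e) + e * mu (- f) * e * T.
  rewrite rmorphN mulrN !mulNr emu -[mu f * e * T]mulrA eT; congr (_ - _).
  by rewrite -symz_invpol // mulrA Te.
apply: I_add; [exact: I_r|apply: I_l => //].
by apply: dunkl_alg_pol; rewrite rpredN (proj1 fI).
Qed.

Lemma commuting_element T : I T -> T <> 0 ->
  exists2 S, I S & S <> 0 /\ forall f, invpol f -> S * mu f = mu f * S.
Proof.
move=> IT T0; have [r] := fil_dunkl_alg (I_alg IT); elim: r T IT T0 => [|r IH] T IT T0 hT.
  exists T => //; split=> // f hf; apply/eqP; rewrite -subr_eq0; apply/eqP; exact: hT.
have [comm|/existsNP[f /not_implyP[hf nc]]] :=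
  pselect (forall f, invpol f -> T * mu f = mu f * T); first by exists T.
apply: (IH (T * mu f - mu f * T)); [exact: I_comm| |exact: hT].
by move/eqP; rewrite subr_eq0 => /eqP.
Qed.

(** An element [S = S e] commuting with invariant polynomials is [mu (S 1) * e]: every [e u] is a
    quotient of invariant polynomials, over which [S] is linear. *)
Lemma pol_in_ideal T : I T -> T <> 0 ->
  exists f, [/\ f \in pol, f != 0 & I (mu f * e)].
Proof.
move=> IT T0; have [S IS [S0 comm]] := commuting_element IT T0.
have [eS Se] := I_e IS.
have SE : S = mu (S 1) * e.
  apply: endoP => u; rewrite mulEndoE mulopE -{1}Se mulEndoE.
  have : forall w, act w (e u) = e u.
    by move=> w; rewrite -[in RHS](sg_symz w).
  move=> /inv_frac[f [g [fI gI g0 ->]]].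
  have Sf h v : invpol h -> S (h * v) = h * S v.
    by move=> hI; have := congr1 (fun T : E => T v) (comm _ hI).
  apply: (mulfI g0); rewrite -Sf // mulrC divfK // -[f in LHS]mulr1 Sf //.
  by rewrite [RHS]mulrCA [g * _]mulrC divfK // mulrC.
exists (S 1); split; last by rewrite -SE.
  by apply: dunkl_alg_stable (I_alg IS) _; exact: rpred1.
by apply: contra_notN S0 => /eqP S1; rewrite SE S1 rmorph0 mul0r.
Qed.

End Ideal.
End DunklAlgebra.

(** * Ideals of the spherical subalgebra *)

Lemma mpoly_gen_ind (R : comNzRingType) (m : nat) (P : {mpoly R[m]} -> Prop) :
  (forall a, P a%:MP) -> (forall i, P 'X_i) ->
  (forall p q, P p -> P q -> P (p + q)) -> (forall p q, P p -> P q -> P (p * q)) ->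
  forall p, P p.
Proof.
move=> PC PX PD PM; have P1 : P 1 by have := PC 1; rewrite mpolyC1.
elim/mpolyind => [|a q p _ _ IH]; first by have := PC 0; rewrite mpolyC0.
apply: (PD) => //; rewrite -mul_mpolyC mpolyXE_id; apply: (PM) => //.
apply: (big_ind P) => [//|u v|i _]; first exact: PM.
by elim: (q i) => [|r IHr]; rewrite ?expr0 // exprS; apply: (PM).
Qed.

(** In characteristic 0 any variable occurring in the leading monomial will do. *)
Lemma mderiv_neq0 (K : numFieldType) (m : nat) (p : {mpoly K[m]}) : (1 < msize p)%N ->
  exists i, p^`M(i) != 0 /\ (msize p^`M(i) < msize p)%N.
Proof.
move=> p1.
have p0 : p != 0 by apply: contraTneq p1 => ->; rewrite msize0.
have d0 : mdeg (mlead p) != 0%N by rewrite -lt0n -ltnS mlead_deg.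
have [i mi] : exists i, mlead p i != 0%N.
  apply/existsP; apply: contraNT d0; rewrite negb_exists => /forallP h.
  by rewrite mdegE big1 // => i _; apply/eqP; have := h i; rewrite negbK.
exists i; split.
  apply/eqP => /mpolyP/(_ (mlead p - U_(i))%MM).
  rewrite mcoeff_mderiv mcoeff0 submK; last by rewrite lep1mP.
  by move/eqP; rewrite mulrn_eq0 /= mleadc_eq0 (negPf p0).
rewrite [X in (X < _)%N]msizeE big_seq.
apply: (big_ind (fun a => a < msize p)%N) => [|a b ap bp|m' m'p]; [lia|lia|].
have : (m' + U_(i))%MM \in msupp p.
  move: m'p; rewrite !mcoeff_msupp mcoeff_mderiv; apply: contraNneq => ->.
  by rewrite mul0rn.
move=> /msize_mdeg_lt; rewrite mdegD mdeg1; lia.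
Qed.

Section Simplicity.
Variables (K : numClosedFieldType) (m : nat) (F : refl_field K m) (c : K).
Local Notation n := m.+1.
Implicit Types (i j k l : 'I_n) (w : 'S_n) (f g u v : F).
Local Notation cst := (rf_cst F).
Local Notation x := (@rf_x K m F).
Local Notation act := (@rf_act K m F).
Local Notation der := (@rf_der K m F).
Local Notation E := (endo cst).
Local Notation mu := (mulop cst).
Local Notation pol := (@pol K m F).
Local Notation sg := (sg F).
Local Notation D := (dunkl F (fun _ _ : 'I_n => c)).
Local Notation H := (dunkl_alg (F := F) c).
Local Notation e := (symz F).
Implicit Types S T : E.

(** The constants [n^-1] cancel in the difference, which leaves the partial derivatives in the free
    coordinates. *)
Lemma der_ev (i : 'I_m) p :
  der (lift ord_max i) (ev F p) - der ord_max (ev F p) = ev F p^`M(i).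
Proof.
elim/mpoly_gen_ind: p => [a|j|p q IHp IHq|p q IHp IHq].
- by rewrite evC mderivC rmorph0 !rf_der_cst subrr.
- rewrite evX mderivX mnm1E !rf_der_x (inj_eq lift_inj) (negPf (neq_lift _ _)) sub0r opprK.
  rewrite subrK eq_sym; case: eqP => [->|_]; last by rewrite !mulr0n scale0r rmorph0.
  by rewrite !mulr1n scale1r -[Z in (Z - _)%MM]add0m addmK mpolyX0 rmorph1.
- by rewrite mderivD !rmorphD !derD opprD addrACA IHp IHq.
- by rewrite mderivM rmorphD !rmorphM /= -IHp -IHq !rf_derM; ring.
Qed.

(** A nonconstant polynomial has a nonzero partial derivative of smaller size, so differentiation
    ends at a nonzero constant. *)
Lemma pol_der_ind (P : F -> Prop) :
  (forall f i, P f -> P (der i f)) -> (forall f g, P f -> P g -> P (f - g)) ->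
  (forall f, P f -> f \in pol) ->
  forall f, P f -> f != 0 -> exists2 a, a != 0 & P (cst a).
Proof.
move=> Pder PB Ppol f Pf f0; have [p fE] := polP _ (Ppol _ Pf).
elim: (msize p).+1 {-2}p (ltnSn (msize p)) f Pf f0 fE => // d IH q qd g Pg g0 gE.
have [/msize1_polyC qE|q1] := leqP (msize q) 1.
  exists q@_0; last by rewrite -evC -qE -gE.
  by apply: contraNneq g0 => q0; rewrite gE qE q0 rmorph0.
have [i [d0 dlt]] := mderiv_neq0 q1.
apply: (IH q^`M(i) _ (ev F q^`M(i))) => //; last by rewrite ev_eq0.
  by apply: leq_trans dlt _.
by rewrite -der_ev -gE; apply: (PB); exact: (Pder).
Qed.

Variable I : E -> Prop.
Hypothesis c_bounds : -1 < c < 0.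
Hypothesis I_alg : forall T, I T -> H T.
Hypothesis I_corner : forall T, I T -> e * T * e = T.
Hypothesis I_add : forall S T, I S -> I T -> I (S + T).
Hypothesis I_l : forall S T, H S -> I T -> I (e * S * e * T).
Hypothesis I_r : forall S T, H S -> I T -> I (T * (e * S * e)).

Definition J T := [/\ H T, T * e = T & forall S, H S -> I (e * S * T)].

Lemma J_add S T : J S -> J T -> J (S + T).
Proof.
move=> [hS eS IS] [hT eT IT]; split; first exact: Dunkl_add.
  by rewrite mulrDl eS eT.
by move=> U hU; rewrite mulrDr; apply: I_add; auto.
Qed.
Lemma J_l S T : H S -> J T -> J (S * T).
Proof.
move=> hS [hT eT IT]; split; [exact: Dunkl_mul|by rewrite -mulrA eT|].
by move=> U hU; rewrite mulrA -[e * U * S]mulrA; apply/IT/Dunkl_mul.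
Qed.
Lemma J_scale a T : J T -> J (a *: T).
Proof. by rewrite -mulr_algl; apply/J_l/Dunkl_scale/dunkl_alg1. Qed.
(** From [T = T e] follows [e U (T S e) = (e U T) (e S e)], and [I] is stable on the right under the
    corner. *)
Lemma J_r S T : H S -> J T -> J (T * S * e).
Proof.
move=> hS [hT eT IT]; split; last first.
- move=> U hU; have -> : e * U * (T * S * e) = e * U * T * (e * S * e); last exact/I_r/IT.
  by rewrite -[in RHS]mulrA -{1}eT !mulrA.
- by rewrite -mulrA symz_idem.
- by apply: Dunkl_mul; [exact: Dunkl_mul|exact: dunkl_alg_symz].
Qed.
Lemma J_mu f T : f \in pol -> J T -> J (mu f * T).
Proof. by move=> fP; apply/J_l/dunkl_alg_pol. Qed.

Lemma J_of_I T : I T -> J T.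
Proof.
move=> IT; have [eT Te] := I_e I_corner IT; split=> // [|S hS]; first exact: I_alg.
by rewrite -eT mulrA; exact: I_l.
Qed.

Hypothesis I_neq0 : exists2 T, I T & T <> 0.
Hypothesis nIe : ~ I e.

Definition ann f := f \in pol /\ J (mu f * e).

Lemma ann_neq0 : exists2 f, ann f & f != 0.
Proof.
have [T IT T0] := I_neq0.
have [f [fP f0 If]] := pol_in_ideal I_alg I_corner I_add I_l I_r IT T0.
by exists f => //; split=> //; exact: J_of_I.
Qed.
Lemma ann1 : ~ ann 1.
Proof.
move=> [_ [_ _ /(_ 1 (dunkl_alg1 _ _))]]; rewrite rmorph1 mulr1 mul1r symz_idem; exact: nIe.
Qed.
Lemma annM f g : g \in pol -> ann f -> ann (g * f).
Proof.
by move=> gP [fP Jf]; split; [exact: rpredM|rewrite rmorphM -mulrA; exact: J_mu].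
Qed.
Lemma annD f g : ann f -> ann g -> ann (f + g).
Proof.
move=> [fP Jf] [gP Jg]; split; first exact: rpredD.
by rewrite rmorphD mulrDl; exact: J_add.
Qed.

(** * Localization at a product of roots *)

Definition disc (P : {set 'I_n * 'I_n}) : F := \prod_(ij in P) xroot F ij.1 ij.2.
(* [lann] and [lrad] below are the localization of [ann] at a product of roots [delta] and
   the radical of this localization; maximality of the set of factors of [delta] makes
   every other root an element of [lrad]. *)
Definition nonvanishing : pred {set 'I_n * 'I_n} :=
  [pred P | `[< forall r, ~ ann (disc P ^+ r) >]].

Lemma disc_pol P : disc P \in pol.
Proof. by apply: rpred_prod => ij _; exact: pol_xroot. Qed.

Lemma nonvanishing0 : nonvanishing set0.
Proof.
by apply/asboolP => r; rewrite /disc big_set0 expr1n; exact: ann1.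
Qed.

Variable Pi : {set 'I_n * 'I_n}.
Hypothesis maxPi : maxset nonvanishing Pi.
Local Notation delta := (disc Pi).

Definition lann f := f \in pol /\ exists r, ann (delta ^+ r * f).

Lemma lannM f g : g \in pol -> lann f -> lann (g * f).
Proof.
move=> gP [fP [r hr]]; split; first exact: rpredM.
by exists r; rewrite mulrCA; exact: annM.
Qed.
Lemma lannD f g : lann f -> lann g -> lann (f + g).
Proof.
move=> [fP [r hr]] [gP [s hs]]; split; first exact: rpredD.
exists (r + s)%N; rewrite exprD mulrDr -[in X in X + _]mulrA -[in X in _ + X]mulrA.
by rewrite mulrCA; apply: annD; apply: annM => //; apply: rpredX; exact: disc_pol.
Qed.
Lemma lann0 : lann 0.
Proof.
split; first exact: rpred0; exists 0%N; rewrite mulr0; have [f fa _] := ann_neq0.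
by rewrite -(mul0r f); apply: annM => //; exact: rpred0.
Qed.
Lemma lann_ann f : ann f -> lann f.
Proof. by move=> fa; split; [exact: proj1 fa|exists 0%N; rewrite expr0 mul1r]. Qed.
Lemma lann1 : ~ lann 1.
Proof.
move=> [_ [r]]; rewrite mulr1; have := maxsetp maxPi => /asboolP; exact.
Qed.

Definition lrad f := f \in pol /\ exists r, lann (f ^+ r).

Lemma lradM f g : g \in pol -> lrad f -> lrad (g * f).
Proof.
move=> gP [fP [r hr]]; split; first exact: rpredM.
by exists r; rewrite exprMn; apply: lannM => //; exact: rpredX.
Qed.
Lemma lradD f g : lrad f -> lrad g -> lrad (f + g).
Proof.
move=> [fP [r hr]] [gP [s hs]]; split; first exact: rpredD.
exists (r + s)%N; rewrite exprDn; apply: (big_ind lann) => [||t _]; first exact: lann0.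
  exact: lannD.
rewrite -mulr_natl -(rmorph_nat cst); apply: lannM; first exact: pol_cst.
have [st|ts] := leqP s t.
  by rewrite -{2}(subnK st) exprD mulrA; apply: lannM => //; rewrite rpredM ?rpredX.
have rt : (r <= r + s - t)%N by lia.
by rewrite -{1}(subnK rt) exprD mulrAC; apply: lannM => //; rewrite rpredM ?rpredX.
Qed.
Lemma lrad0 : lrad 0.
Proof. by split; [exact: rpred0|exists 1%N; rewrite expr1; exact: lann0]. Qed.
Lemma lrad_sum L (s : seq L) (P : pred L) (G : L -> F) :
  (forall t, P t -> lrad (G t)) -> lrad (\sum_(t <- s | P t) G t).
Proof. by move=> h; apply: (big_ind lrad) => //; [exact: lrad0|exact: lradD]. Qed.
Lemma lradN f : lrad f -> lrad (- f).
Proof. by move=> hf; rewrite -mulN1r; apply: lradM => //; rewrite rpredN rpred1. Qed.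

(** If the pair is not in [Pi], adding it puts a power of the larger product into [ann], by
    maximality. If it is in [Pi], the root divides [delta], and a power of [delta] would lie in
    [ann]. *)
Lemma PiP i j : reflect (lrad (xroot F i j)) ((i, j) \notin Pi).
Proof.
apply: (iffP idP) => [ijPi|[_ [r [_ [s hs]]]]].
  have [_ maxi] := maxsetP maxPi.
  have : ~ forall r, ~ ann (disc ((i, j) |: Pi) ^+ r).
    move=> /asboolP/maxi /(_ (subsetUr _ _)) PiE; move: ijPi.
    by rewrite -PiE setU11.
  move=> /existsNP[r /contrapT]; rewrite /disc big_setU1 //= exprMn => hr.
  split; first exact: pol_xroot; exists r; split; first by rewrite rpredX ?pol_xroot.
  by exists r; rewrite mulrC.
apply/negP => ijPi; have /asboolP/(_ (s + r)%N) := maxsetp maxPi; apply.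
have dE : delta = xroot F i j * \prod_(ij in Pi | ij != (i, j)) xroot F ij.1 ij.2.
  by rewrite /disc (bigD1 (i, j)).
move: hs; rewrite dE; set Q := \prod_(ij in Pi | _) _ => hs.
have -> : (xroot F i j * Q) ^+ (s + r) = Q ^+ r * ((xroot F i j * Q) ^+ s * xroot F i j ^+ r).
  by rewrite exprD !exprMn; ring.
by apply: annM => //; apply: rpredX; apply: rpred_prod => ? _; exact: pol_xroot.
Qed.

Definition rel i j := (i, j) \notin Pi.

Lemma rel_refl i : rel i i.
Proof. by apply/PiP; rewrite /xroot subrr; exact: lrad0. Qed.
Lemma rel_sym i j : rel i j = rel j i.
Proof. by apply/PiP/PiP => /lradN; rewrite xrootN. Qed.
Lemma rel_trans i j k : rel i j -> rel j k -> rel i k.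
Proof.
move=> /PiP hij /PiP hjk; apply/PiP; have := lradD hij hjk.
by rewrite /xroot addrA subrK.
Qed.

(** The parabolic subgroup: each block is preserved, not merely the partition into blocks. *)
Definition stab w := forall i, rel (w i) i.

Lemma stab_rel w i j : stab w -> rel (w i) (w j) = rel i j.
Proof.
move=> h; apply/idP/idP => r.
  by apply: rel_trans (rel_trans r (h j)); rewrite rel_sym; exact: h.
by apply: rel_trans (h i) (rel_trans r _); rewrite rel_sym; exact: h.
Qed.
Lemma stab_Pi w i j : stab w -> ((w i, w j) \in Pi) = ((i, j) \in Pi).
Proof. by move=> h; apply: negb_inj; exact: stab_rel. Qed.
Lemma stab_tperm i j : rel i j -> stab (tperm i j).
Proof. by move=> r k; case: tpermP => [->|->|_ _]; rewrite ?rel_refl // rel_sym. Qed.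

(** [Pi] consists of all ordered pairs of indices from different blocks, so [w] permutes the factors
    and no sign appears. *)
Lemma act_delta w : stab w -> act w delta = delta.
Proof.
move=> h; rewrite /disc rmorph_prod /=.
rewrite [LHS](reindex_inj (h := fun ij => (w ij.1, w ij.2))) /=; last first.
  by move=> [a b] [a' b'] /= [/perm_inj -> /perm_inj ->].
by apply: eq_big => [[a b]|[a b] _] /=; rewrite ?stab_Pi // act_xroot !permK.
Qed.

Definition ccrel i j : K := if rel i j then c else 0.
Local Notation D' := (dunkl F ccrel).

Lemma ccrel_stab w i j : stab w -> ccrel (w i) (w j) = ccrel i j.
Proof. by move=> h; rewrite /ccrel stab_rel. Qed.

(** [D' i] and [D i] differ by the reflections between different blocks, whose denominators are
    factors of [delta]. *)
Lemma delta_D' i : H (mu delta * D' i).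
Proof.
have -> : D' i = D i + \sum_(j | (j != i) && ~~ rel i j)
    c *: (mu (xroot F i j)^-1 * (1 - sg (tperm i j))).
  rewrite !dunklE [X in _ = _ - X + _](bigID (rel i)) /= opprD addrA subrK; congr (_ - _).
  rewrite (bigID (rel i)) /= [X in _ + X]big1 ?addr0 => [|j /andP[_ /negPf ijn]].
    by apply: eq_bigr => j /andP[_ ij]; rewrite /ccrel ij.
  by rewrite /ccrel ijn scale0r.
rewrite mulrDr; apply: Dunkl_add.
  by apply: Dunkl_mul; [exact/dunkl_alg_pol/disc_pol|exact: Dunkl_D].
rewrite mulr_sumr; apply: dunkl_alg_sum => j /andP[ji]; rewrite negbK => ijPi.
rewrite -scalerAr mulrA -rmorphM; apply/Dunkl_scale/Dunkl_mul; last first.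
  by apply: dunkl_algB; [exact: dunkl_alg1|exact: Dunkl_sg].
apply: dunkl_alg_pol; rewrite /disc (bigD1 (i, j)) //= mulrAC divff ?mul1r.
  by apply: rpred_prod => ? _; exact: pol_xroot.
by rewrite xroot_neq0 // eq_sym.
Qed.

(* [loc G] is the localization at delta of a left ideal G of the Dunkl algebra. *)
Definition loc (G : E -> Prop) T := exists r, G (mu delta ^+ r * T).
Definition left_ideal (G : E -> Prop) :=
  (forall S T, G S -> G T -> G (S + T)) /\ forall S T, H S -> G T -> G (S * T).

Section Loc.
Variable G : E -> Prop.
Hypothesis hG : left_ideal G.

Lemma G_mu f T : f \in pol -> G T -> G (mu f * T).
Proof. by move=> fP; apply/(proj2 hG)/dunkl_alg_pol. Qed.
Lemma delta_polX r : delta ^+ r \in pol.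
Proof. exact/rpredX/disc_pol. Qed.
Lemma loc_G T : G T -> loc G T.
Proof. by exists 0%N; rewrite mul1r. Qed.
Lemma loc_add S T : loc G S -> loc G T -> loc G (S + T).
Proof.
move=> [r hr] [s hs]; exists (r + s)%N; rewrite mulrDr; apply: (proj1 hG).
  by rewrite addnC exprD -mulrA -rmorphXn; apply: G_mu => //; exact: delta_polX.
by rewrite exprD -mulrA -rmorphXn; apply: G_mu => //; exact: delta_polX.
Qed.
Lemma loc_mu f T : f \in pol -> loc G T -> loc G (mu f * T).
Proof.
move=> fP [r hr]; exists r.
by rewrite mulrA -rmorphXn mulopC -mulrA rmorphXn; exact: G_mu.
Qed.
Lemma loc_scale a T : loc G T -> loc G (a *: T).
Proof. by move=> hT; rewrite -mulr_algl -mulop_cst; apply: loc_mu => //; exact: pol_cst. Qed.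
Lemma loc_sub S T : loc G S -> loc G T -> loc G (S - T).
Proof. by move=> hS hT; rewrite -scaleN1r; apply: loc_add => //; exact: loc_scale. Qed.
Lemma D'_delta i r :
  D' i * mu (delta ^+ r) = mu (delta ^+ r) * D' i + mu (der i (delta ^+ r)).
Proof.
apply: dunkl_mu_inv => j ji; rewrite /ccrel; case: ifP => [ij _|_]; last by rewrite eqxx.
by rewrite (rmorphXn (act _)) /= act_delta //; exact: stab_tperm.
Qed.
(** The reflections kept in [D'] fix [delta], so [D'] passes powers of [delta] at the cost of a
    derivative. *)
Lemma loc_D' i T : loc G T -> loc G (D' i * T).
Proof.
(* One factor [delta] brings [delta * D' i] into the Dunkl algebra, r factors are moved inside next
   to [T], and the other r accompany [T] in the derivative term. *)
move=> [r hr]; exists (r + r.+1)%N.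
have -> : mu delta ^+ (r + r.+1) * (D' i * T) =
    mu (delta ^+ r) * (mu delta * D' i * (mu delta ^+ r * T)) -
    mu (delta * der i (delta ^+ r)) * (mu delta ^+ r * T).
  rewrite -[mu delta * D' i * _]mulrA [D' i * (_ * _)]mulrA -!rmorphXn D'_delta.
  move: (D' i) (der i _) => S d.
  rewrite mulrDl !mulrDr -addrA [X in _ + X](_ : _ = 0) ?addr0.
    by rewrite exprD exprS !rmorphM !mulrA.
  apply/eqP; rewrite subr_eq0; apply/eqP; rewrite !mulrA -!rmorphM; congr (mu _ * _); ring.
rewrite -scaleN1r; apply: (proj1 hG).
  by apply: G_mu; [exact: delta_polX|apply: (proj2 hG) => //; exact: delta_D'].
rewrite -mulr_algl -mulop_cst; apply: G_mu; first exact: pol_cst.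
by apply: G_mu => //; rewrite rpredM ?disc_pol // pol_der ?delta_polX.
Qed.
End Loc.

Lemma left_ideal_J : left_ideal J.
Proof. by split=> *; [exact: J_add|exact: J_l]. Qed.

Definition unit_alg T := H T /\ T * e = T.
Lemma left_ideal_unit : left_ideal unit_alg.
Proof.
split=> S T => [[hS eS] [hT eT]|hS [hT eT]].
  by split; [exact: Dunkl_add|rewrite mulrDl eS eT].
by split; [exact: Dunkl_mul|rewrite -mulrA eT].
Qed.

(** The vectors on which elements of [lann] are shown to act by zero modulo [loc J]. Invariance
    under [stab], unlike full invariance, fits the sum of squares of the [D' i] over one block. *)
Definition linv T := loc unit_alg T /\ forall w, stab w -> sg w * T = T.

(* Left multiplication by x_j minus right multiplication by x_i scales the component at u
   of an orbit sum by x_j - x_(u^-1 i); over all pairs of [Pi] this kills every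
   permutation that does not preserve the blocks. *)
Lemma ann_orbit f (s : seq ('I_n * 'I_n)) T : ann f -> H T ->
  J (\sum_(u : 'S_n) mu (f * \prod_(ij <- s) (x ij.2 - x (u^-1%g ij.1))) * sg u * T * e).
Proof.
move=> [fP Jf]; elim: s T => [|[i j] s IH] T hT.
  have -> : \sum_(u : 'S_n) mu (f * \prod_(ij <- [::]) (x ij.2 - x (u^-1%g ij.1))) * sg u * T * e
     = n`!%:R *: (mu f * e * T * e).
    have fe : n`!%:R *: (mu f * e) = \sum_(u : 'S_n) mu f * sg u.
      rewrite -mulr_sumr /symz -scalerAr scalerA mulfV ?scale1r //.
      by rewrite pnatr_eq0 -lt0n fact_gt0.
    rewrite 2!scalerAl fe !mulr_suml; apply: eq_bigr => u _.
    by rewrite big_nil mulr1.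
  by apply/J_scale/J_r.
have -> : \sum_(u : 'S_n) mu (f * \prod_(ij <- (i, j) :: s) (x ij.2 - x (u^-1%g ij.1))) * sg u * T * e
  = mu (x j) * (\sum_(u : 'S_n) mu (f * \prod_(ij <- s) (x ij.2 - x (u^-1%g ij.1))) * sg u * T * e)
  - \sum_(u : 'S_n) mu (f * \prod_(ij <- s) (x ij.2 - x (u^-1%g ij.1))) * sg u * (mu (x i) * T) * e.
  rewrite mulr_sumr -sumrB; apply: eq_bigr => u _; rewrite big_cons /=.
  set P := \prod_(ij <- s) _.
  rewrite -[_ * sg u * (mu (x i) * T)]mulrA [sg u * (_ * _)]mulrA sg_mu rf_act_x.
  rewrite !mulrA -!rmorphM -!mulrBl -rmorphB; congr (mu _ * _ * _ * _); ring.
rewrite -scaleN1r; apply: J_add; first by apply: J_mu => //; [exact: pol_x|exact: IH].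
by apply: J_scale; apply: IH; apply: Dunkl_mul => //; exact: Dunkl_x.
Qed.

(** If [u] does not preserve the blocks, some pair [(i, u^-1 i)] is in [Pi] and gives a zero factor.
    Otherwise [(i, j) = (u b, a)] turns the product into the one defining [delta]. *)
Lemma prod_Pi (u : 'S_n) : \prod_(ij <- enum Pi) (x ij.2 - x (u^-1%g ij.1)) =
  if `[< stab u >] then delta else 0.
Proof.
rewrite big_enum /=; case: asboolP => [hu|hu].
  rewrite /disc [LHS](reindex_inj (h := fun ij : 'I_n * 'I_n => (u ij.2, ij.1))) /=; last first.
    by move=> [a b] [a' b'] /= [/perm_inj -> ->].
  apply: eq_big => [[a b]|[a b] _] /=; last by rewrite permK.
  apply: negb_inj; change (rel (u b) a = rel a b); rewrite rel_sym.
  apply/idP/idP => h; last exact: rel_trans h (etrans (rel_sym _ _) (hu b)).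
  exact: rel_trans h (hu b).
have [i hi] : exists i, ~~ rel i (u^-1%g i).
  apply: contrapT => /forallNP h; apply: hu => i; have := h (u i); rewrite permK.
  by move/negP; rewrite negbK.
rewrite (bigD1 (i, u^-1%g i)) /=; last by rewrite negbK in hi.
by rewrite subrr mul0r.
Qed.

(** In [ann_orbit], applied with all pairs of [Pi], only the permutations in [stab] survive. They
    fix the vector, so the sum is a positive multiple of a single term. *)
Lemma linv_ann f T : lann f -> linv T -> loc J (mu f * T).
Proof.
move=> [fP [k hk]] [[r [hT eT]] invT].
suff hJ : J (mu (delta ^+ k * f * delta) * (mu delta ^+ r * T)).
  exists (k + r.+1)%N; move: hJ; congr J.
  rewrite -!rmorphXn !mulrA -!rmorphM; congr (mu _ * _); rewrite exprD exprS; ring.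
set S := mu delta ^+ r * T; have := ann_orbit (enum Pi) hk hT; rewrite -/S in eT *.
have invS w : stab w -> sg w * S = S.
  by move=> hw; rewrite /S mulrA -rmorphXn sg_mu (rmorphXn (act w)) /= act_delta // -mulrA invT.
clearbody S; pose N := #|[pred u : 'S_n | `[< stab u >]]|.
have -> : \sum_(u : 'S_n) mu (delta ^+ k * f * \prod_(ij <- enum Pi) (x ij.2 - x (u^-1%g ij.1)))
   * sg u * S * e = N%:R *: (mu (delta ^+ k * f * delta) * S).
  rewrite (bigID (fun u : 'S_n => `[< stab u >])) /= [X in _ + X]big1 ?addr0 => [|u /negPf hu].
    rewrite scaler_nat -sumr_const; apply: eq_bigr => u hu.
    rewrite prod_Pi hu -!mulrA eT invS //; exact/asboolP.
  by rewrite prod_Pi hu mulr0 rmorph0 !mul0r.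
move/(J_scale N%:R^-1); rewrite scalerA mulVf ?scale1r // pnatr_eq0 -lt0n.
apply/card_gt0P; exists 1%g; rewrite inE; apply/asboolP => i.
by rewrite perm1 rel_refl.
Qed.

Lemma linv_e : linv e.
Proof.
split=> [|w _]; last exact: sg_symz.
by apply: loc_G; split; [exact: dunkl_alg_symz|exact: symz_idem].
Qed.
Lemma not_loc_e : ~ loc J e.
Proof.
move=> [r Jr]; apply: lann1; split; first exact: rpred1.
by exists r; rewrite mulr1; split; [exact/rpredX/disc_pol|rewrite rmorphXn].
Qed.

Lemma lann_loc f : f \in pol -> loc J (mu f * e) -> lann f.
Proof.
move=> fP [r Jr]; split=> //; exists r; split.
  by rewrite rpredM ?rpredX ?disc_pol.
by rewrite rmorphM rmorphXn -mulrA.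
Qed.

(** For trivial blocks [D'] satisfies the Leibniz rule, so [der i f * e] is
    [D' i * f * e - f * D' i * e]. The second term is covered by [linv_ann], since [stab] is
    trivial. *)
Lemma lann_der f i : (forall i j, rel i j -> i = j) -> lann f -> lann (der i f).
Proof.
move=> free fa; have fP := proj1 fa.
apply: lann_loc; first exact: pol_der.
have DfE : D' i * mu f = mu f * D' i + mu (der i f).
  apply: dunkl_mu_inv => j ji; rewrite /ccrel; case: ifP => [/free ij|_]; last by rewrite eqxx.
  by rewrite ij eqxx in ji.
have -> : mu (der i f) * e = D' i * (mu f * e) - mu f * (D' i * e).
  by rewrite mulrA DfE mulrDl -mulrA addrAC subrr add0r.
apply: (loc_sub left_ideal_J).
  by apply: (loc_D' left_ideal_J); apply: linv_ann linv_e.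
apply: linv_ann => //; split=> [|w hw].
  by apply: (loc_D' left_ideal_unit); exact: (proj1 linv_e).
have -> : w = 1%g by apply/permP => k; rewrite perm1; exact/free/hw.
by rewrite sg1 mul1r.
Qed.

Lemma not_free : ~ forall i j, rel i j -> i = j.
Proof.
move=> free; have [f fa f0] := ann_neq0.
have [|g h hg hh|g [] //|||a a0 ha] := @pol_der_ind lann _ _ _ f.
- by move=> g i; exact: lann_der.
- by apply: lannD => //; rewrite -mulN1r; apply: lannM => //; rewrite rpredN rpred1.
- exact: lann_ann.
- exact: f0.
apply: lann1; rewrite -[1](mulVf (x := cst a)) ?fmorph_eq0 // -fmorphV.
by apply: lannM => //; exact: pol_cst.
Qed.

(** * A block with at least two elements *)

Section Block.
Variables i0 j0 : 'I_n.
Hypothesis ij0 : rel i0 j0.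
Hypothesis neq_ij0 : i0 != j0.
Let B : {set 'I_n} := [set j | rel i0 j].
Local Notation kk := (#|B|%:R : K).
Let avg : F := cst kk^-1 * \sum_(j in B) x j.
Let xi i : F := x i - avg.
Local Notation s i j := (sg (tperm i j)).

Lemma cardB_gt1 : (1 < #|B|)%N.
Proof.
rewrite (cardD1 i0) inE rel_refl ltnS (cardD1 j0) !inE ij0 eq_sym neq_ij0.
by [].
Qed.
Lemma kk_neq0 : kk != 0.
Proof. by rewrite pnatr_eq0 -lt0n ltnW // cardB_gt1. Qed.
Lemma relB i j : i \in B -> rel i j = (j \in B).
Proof.
rewrite !inE => hi; apply/idP/idP => h; first exact: rel_trans hi h.
by apply: rel_trans h; rewrite rel_sym.
Qed.
Lemma stab_B w i : stab w -> (w i \in B) = (i \in B).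
Proof.
move=> hw; rewrite !inE; apply/idP/idP => h; first exact: rel_trans h (hw i).
by apply: rel_trans h _; rewrite rel_sym.
Qed.
Lemma act_xi w i : stab w -> act w (xi i) = xi (w^-1%g i).
Proof.
move=> hw; rewrite /xi rmorphB rf_act_x; congr (_ - _).
rewrite /avg rmorphM rf_act_cst rmorph_sum; congr (_ * _).
rewrite [LHS](reindex_inj (@perm_inj _ w)) /=.
apply: eq_big => [j|j _]; first exact: stab_B.
by rewrite rf_act_x permK.
Qed.
Lemma stab_B_tperm i j : i \in B -> j \in B -> stab (tperm i j).
Proof. by move=> iB jB; apply: stab_tperm; rewrite relB. Qed.
Lemma sum_xi : \sum_(i in B) xi i = 0.
Proof.
rewrite sumrB sumr_const -[avg *+ _]mulr_natl /avg mulrA -(rmorph_nat cst) -rmorphM mulfV ?kk_neq0 //.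
by rewrite rmorph1 mul1r subrr.
Qed.
Lemma pol_xi i : xi i \in pol.
Proof. by rewrite rpredB ?pol_x // rpredM ?pol_cst // rpred_sum // => j _; exact: pol_x. Qed.

Lemma lrad_xi i : i \in B -> lrad (xi i).
Proof.
move=> iB; have -> : xi i = cst kk^-1 * \sum_(j in B) xroot F i j.
  rewrite sumrB sumr_const -[x i *+ _]mulr_natl mulrBr mulrA -(rmorph_nat cst) -rmorphM.
  by rewrite mulVf ?kk_neq0 // rmorph1 mul1r.
apply: lradM; first exact: pol_cst.
by apply: lrad_sum => j jB; apply/PiP; rewrite -/(rel i j) relB.
Qed.

(** Inside the block the [n^-1] of [der i] cancels against that of the mean, and [k^-1] takes its
    place. *)
Lemma der_xi i j : i \in B -> der i (xi j) = cst ((i == j)%:R - kk^-1).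
Proof.
move=> iB; have dsum (P : pred 'I_n) : der i (\sum_(l | P l) x l) = \sum_(l | P l) der i (x l).
  by elim/big_rec2: _ => [|l u v _ <-]; rewrite ?der0 // derD.
rewrite /xi rf_derB /avg rf_derM rf_der_cst mul0r add0r dsum.
under eq_bigr do rewrite rf_der_x.
rewrite sumrB sumr_const (bigD1 i) //= eqxx big1 => [|l /andP[_ /negPf li]]; last first.
  by rewrite eq_sym li.
rewrite addr0 rf_der_x -[_^-1 *+ _]mulr_natl mulrBr mulrA.
have -> : cst kk^-1 * #|B|%:R = 1.
  by rewrite -(rmorph_nat cst) -rmorphM mulVf ?kk_neq0 // rmorph1.
by rewrite mulr1 mul1r opprB addrA subrK rmorphB rmorph_nat.
Qed.

Lemma block_relation i j : i \in B -> j \in B ->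
  D' i * mu (xi j) = mu (xi j) * D' i + block_comm B c (fun i j => s i j) i j.
Proof.
move=> iB jB; rewrite dunkl_mu -addrA; congr (_ + _).
rewrite der_xi // mulop_cst.
have -> : \sum_(k | k != i) ccrel i k *: (mu ((xi j - act (tperm i k) (xi j)) / xroot F i k) * s i k)
  = \sum_(k in B | k != i) c *: (mu ((xi j - xi (tperm i k j)) / xroot F i k) * s i k).
  rewrite (bigID (mem B)) /= [X in _ + X]big1 ?addr0 => [|k /andP[_ kB]]; last first.
    by rewrite /ccrel relB // (negPf kB) scale0r.
  apply: eq_big => [k|k /andP[_ kB]]; first by rewrite andbC.
  by rewrite /ccrel relB // kB act_xi ?tpermV //; exact: stab_B_tperm.
rewrite /block_comm; case: eqVneq => [<-|ij].
  rewrite scaler_sumr; congr (_ - _); apply: eq_bigr => k /andP[kB ki]; congr (_ *: _).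
  rewrite tpermL /xi opprB addrA subrK -/(xroot F i k) divff ?xroot_neq0 1?eq_sym //.
  by rewrite rmorph1 mul1r.
rewrite (bigD1 j) /=; last by rewrite jB eq_sym.
rewrite big1 ?addr0 => [|k /andP[/andP[kB ki] kj]].
  rewrite tpermR /xi opprB addrA subrK -/(xroot F j i) -xrootN mulNr divff ?xroot_neq0 //.
  by rewrite rmorphN rmorph1 mulN1r scalerN opprK sub0r.
by rewrite tpermD // subrr mul0r rmorph0 mul0r scaler0.
Qed.

Lemma loc_e_block : loc J e.
Proof.
apply: (@block_vanishing K _ _ mu n B c xi (fun i => D' i) (fun i j => s i j)
  cardB_gt1 c_bounds block_relation _ _ sum_xi (loc J) linv _ _ _ _ _ _ _ _ e linv_e).
- by move=> i j; rewrite tpermC.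
- by move=> i j l iB jB; rewrite sg_mu act_xi ?tpermV //; exact: stab_B_tperm.
- exact: (loc_add left_ideal_J).
- exact: (loc_scale left_ideal_J).
- by move=> i T _; apply: (loc_mu left_ideal_J); exact: pol_xi.
- by move=> i T _; exact: (loc_D' left_ideal_J).
- move=> T [hT invT]; split=> [|w hw].
    rewrite mulr_suml; apply: (big_ind (loc unit_alg)) => [||i _].
    + by rewrite -(scale0r T); apply: (loc_scale left_ideal_unit).
    + exact: (loc_add left_ideal_unit).
    + by rewrite expr2 -mulrA; do 2!apply: (loc_D' left_ideal_unit).
  (* Permutations in [stab] permute the [D' i] with i in [B], so the sum of squares commutes with
     them. *)
  rewrite mulrA; have -> : sg w * (\sum_(i in B) D' i ^+ 2) = (\sum_(i in B) D' i ^+ 2) * sg w.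
    rewrite mulr_sumr mulr_suml [LHS](reindex_inj (@perm_inj _ w)) /=.
    apply: eq_big => [i|i _]; first exact: stab_B.
    have sD j : sg w * D' j = D' (w^-1%g j) * sg w.
      by apply: sg_dunkl => a b; exact: ccrel_stab.
    by rewrite !expr2 mulrA sD -mulrA sD permK mulrA.
  by rewrite -mulrA invT.
- by move=> i j T iB jB [_]; apply; exact: stab_B_tperm.
- have [_ [r hr]] : lrad (\sum_(i in B) xi i ^+ 2).
    by apply: lrad_sum => i iB; rewrite expr2; apply: lradM; [exact: pol_xi|exact: lrad_xi].
  by exists r => T hT; rewrite -rmorphXn; exact: linv_ann.
- move=> i; have [iB|iB] := boolP (i \in B); last by exists 0%N.
  have [_ [r hr]] := lrad_xi iB.
  by exists r => T _ hT; rewrite -rmorphXn; exact: linv_ann.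
Qed.
End Block.

Lemma maximal_vanishing_false : False.
Proof.
apply: not_free => i j ij; apply: contrapT => /eqP nij.
exact: not_loc_e (loc_e_block ij nij).
Qed.
End Simplicity.

Lemma corner_ideal_unit (K : numClosedFieldType) (m : nat) (F : refl_field K m) (c : K)
    (I : endo (rf_cst F) -> Prop) :
  -1 < c < 0 -> (forall T, I T -> dunkl_alg c T) ->
  (forall T, I T -> symz F * T * symz F = T) ->
  (forall S T, I S -> I T -> I (S + T)) ->
  (forall S T, dunkl_alg c S -> I T -> I (symz F * S * symz F * T)) ->
  (forall S T, dunkl_alg c S -> I T -> I (T * (symz F * S * symz F))) ->
  (exists2 T, I T & T <> 0) -> I (symz F).
Proof.
move=> cb Ialg Icorner Iadd Il Ir Ineq0; apply: contrapT => nIe.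
have [Pi maxPi _] := maxset_exists (nonvanishing0 c nIe).
exact: (maximal_vanishing_false cb Ialg Icorner Iadd Il Ir Ineq0 maxPi).
Qed.

(** * Construction of the rational functions *)

Lemma quotient_rule_sub (L : fieldType) (a b c d a' b' c' d' : L) : b != 0 -> d != 0 ->
  ((a' * d + a * d' - (c' * b + c * b')) * (b * d) - (a * d - c * b) * (b' * d + b * d'))
    / (b * d) ^+ 2 =
  (a' * b - a * b') / b ^+ 2 - (c' * d - c * d') / d ^+ 2.
Proof. by move=> b0 d0; field; rewrite b0 d0. Qed.
Lemma quotient_rule_mul (L : fieldType) (a b c d a' b' c' d' : L) : b != 0 -> d != 0 ->
  ((a' * c + a * c') * (b * d) - (a * c) * (b' * d + b * d')) / (b * d) ^+ 2 =
  (a' * b - a * b') / b ^+ 2 * (c / d) + a / b * ((c' * d - c * d') / d ^+ 2).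
Proof. by move=> b0 d0; field; rewrite b0 d0. Qed.

Section FractionExtension.
Local Open Scope quotient_scope.
Variable R : idomainType.
Local Notation Fr := {fraction R}.
Local Notation tf := (@FracField.tofrac R).

Lemma frac_tofrac (u : Fr) : exists p q, q != 0 /\ u = tf p / tf q.
Proof.
elim/quotW: u => -[[p q] /= q0]; exists p, q; split=> //.
have tq : tf q != 0 by rewrite tofrac_eq0.
apply: (mulIf tq); rewrite divfK //; unlock FracField.tofrac.
rewrite -[LHS]FracField.pi_mul; apply/eqmodP; rewrite /= FracField.equivfE.
by rewrite /FracField.mulf /= !numden_Ratio ?oner_eq0 ?mulr1 // mulrC.
Qed.

(** A chosen representative; [frac_map_div] and [frac_der_div] show that the results do not depend
    on the choice. *)
Definition fnum (u : Fr) : R := projT1 (cid (frac_tofrac u)).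
Definition fden (u : Fr) : R := projT1 (cid (projT2 (cid (frac_tofrac u)))).
Lemma fden_neq0 u : fden u != 0.
Proof. exact: (proj1 (projT2 (cid (projT2 (cid (frac_tofrac u)))))). Qed.
Lemma fnum_fden u : u = tf (fnum u) / tf (fden u).
Proof. exact: (proj2 (projT2 (cid (projT2 (cid (frac_tofrac u)))))). Qed.

Lemma tf_neq0 q : q != 0 -> tf q != 0. Proof. by rewrite tofrac_eq0. Qed.

Section Morphism.
Variables (L : fieldType) (h : {rmorphism R -> L}).
Hypothesis h_inj : injective h.
Definition frac_map (u : Fr) : L := h (fnum u) / h (fden u).

Lemma h_neq0 q : q != 0 -> h q != 0.
Proof. by apply: contra_neq => hq; apply: h_inj; rewrite hq rmorph0. Qed.
Lemma frac_map_div p q : q != 0 -> frac_map (tf p / tf q) = h p / h q.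
Proof.
move=> q0; set u := tf p / tf q; have uE := fnum_fden u.
have /eqP : tf p / tf q = tf (fnum u) / tf (fden u) by [].
rewrite eqr_div ?tf_neq0 ?fden_neq0 // -!rmorphM tofrac_eq => /eqP eqpq.
apply/eqP; rewrite /frac_map eqr_div ?h_neq0 ?fden_neq0 // -!rmorphM eqpq.
by [].
Qed.
Lemma frac_map_tofrac p : frac_map (tf p) = h p.
Proof. by rewrite -[tf p]divr1 -(rmorph1 tf) frac_map_div ?oner_eq0 // rmorph1 divr1. Qed.
Lemma frac_map_is_zmod_morphism : zmod_morphism frac_map.
Proof.
move=> u v; rewrite [u in LHS]fnum_fden [v in LHS]fnum_fden.
have [du dv] := (fden_neq0 u, fden_neq0 v).
rewrite -mulNr addf_div ?tf_neq0 // -rmorphN -!rmorphM -rmorphD frac_map_div ?mulf_neq0 //.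
rewrite rmorphD !rmorphM rmorphN -addf_div ?h_neq0 // mulNr.
by [].
Qed.
Lemma frac_map_is_monoid_morphism : monoid_morphism frac_map.
Proof.
split; first by rewrite -(rmorph1 tf) frac_map_tofrac rmorph1.
move=> u v; rewrite [u in LHS]fnum_fden [v in LHS]fnum_fden mulf_div -!rmorphM.
by rewrite frac_map_div ?mulf_neq0 ?fden_neq0 // !rmorphM -mulf_div.
Qed.
End Morphism.

Section Derivation.
Variable d : R -> R.
Hypothesis dB : forall p q, d (p - q) = d p - d q.
Hypothesis dM : forall p q, d (p * q) = d p * q + p * d q.
Definition frac_der (u : Fr) : Fr :=
  (tf (d (fnum u)) * tf (fden u) - tf (fnum u) * tf (d (fden u))) / tf (fden u) ^+ 2.

(** Differentiating [p * fden u = fnum u * q] compares the quotient rule for the two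
    representatives. *)
Lemma frac_der_div p q : q != 0 ->
  frac_der (tf p / tf q) = (tf (d p) * tf q - tf p * tf (d q)) / tf q ^+ 2.
Proof.
move=> q0; set u := tf p / tf q; have uE := fnum_fden u; have du := fden_neq0 u.
have eqpq : p * fden u = fnum u * q.
  have /eqP : tf p / tf q = tf (fnum u) / tf (fden u) by [].
  by rewrite eqr_div ?tf_neq0 // -!rmorphM tofrac_eq => /eqP.
rewrite /frac_der; move: (fnum u) (fden u) du eqpq => a b b0 eqpq.
have e1 : tf p * tf b = tf a * tf q by rewrite -!rmorphM eqpq.
have e2 : tf (d p) * tf b = tf (d a) * tf q + tf a * tf (d q) - tf p * tf (d b).
  by apply/eqP; rewrite -subr_eq opprK -!rmorphM -!rmorphD -!dM eqpq.
have [B0 Q0] := (tf_neq0 b0, tf_neq0 q0).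
apply/eqP; rewrite eqr_div ?expf_neq0 //; apply/eqP.
have -> : (tf (d p) * tf q - tf p * tf (d q)) * tf b ^+ 2 =
    tf q * tf b * (tf (d p) * tf b) - tf p * tf b * (tf b * tf (d q)) by ring.
rewrite e2 e1.
have -> : tf q * tf b * (tf (d a) * tf q + tf a * tf (d q) - tf p * tf (d b)) =
    tf q * tf b * (tf (d a) * tf q + tf a * tf (d q)) - tf q * (tf p * tf b) * tf (d b) by ring.
rewrite e1; ring.
Qed.
Lemma frac_rule_sub (a b c e a' b' c' e' : R) : b != 0 -> e != 0 ->
  (tf (a' * e + a * e' - (c' * b + c * b')) * tf (b * e)
     - tf (a * e - c * b) * tf (b' * e + b * e')) / tf (b * e) ^+ 2 =
  (tf a' * tf b - tf a * tf b') / tf b ^+ 2 - (tf c' * tf e - tf c * tf e') / tf e ^+ 2.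
Proof.
move=> b0 e0; rewrite -(quotient_rule_sub _ _ _ _ _ _ (tf_neq0 b0) (tf_neq0 e0)).
by rewrite !(rmorphB tf, rmorphD tf, rmorphM tf).
Qed.
Lemma frac_rule_mul (a b c e a' b' c' e' : R) : b != 0 -> e != 0 ->
  (tf (a' * c + a * c') * tf (b * e) - tf (a * c) * tf (b' * e + b * e')) / tf (b * e) ^+ 2 =
  (tf a' * tf b - tf a * tf b') / tf b ^+ 2 * (tf c / tf e)
    + tf a / tf b * ((tf c' * tf e - tf c * tf e') / tf e ^+ 2).
Proof.
move=> b0 e0; rewrite -(quotient_rule_mul _ _ _ _ _ _ (tf_neq0 b0) (tf_neq0 e0)).
by rewrite !(rmorphD tf, rmorphM tf).
Qed.
Lemma frac_derB u v : frac_der (u - v) = frac_der u - frac_der v.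
Proof.
rewrite [u in LHS]fnum_fden [v in LHS]fnum_fden.
have [du dv] := (fden_neq0 u, fden_neq0 v).
rewrite -mulNr addf_div ?tf_neq0 // mulNr -!rmorphM -rmorphB frac_der_div ?mulf_neq0 //.
rewrite dB !dM.
exact: frac_rule_sub.
Qed.
Lemma frac_derM u v : frac_der (u * v) = frac_der u * v + u * frac_der v.
Proof.
rewrite [u in LHS]fnum_fden [v in LHS]fnum_fden mulf_div -!rmorphM.
rewrite frac_der_div ?mulf_neq0 ?fden_neq0 //.
rewrite !dM (frac_rule_mul _ _ _ _ _ _ (fden_neq0 u) (fden_neq0 v)).
by rewrite -!fnum_fden.
Qed.
Lemma frac_der_tofrac p : frac_der (tf p) = tf (d p).
Proof.
have d1 : d 1 = 0.
  by have /eqP := dM 1 1; rewrite !mulr1 mul1r -subr_eq subrr eq_sym => /eqP.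
rewrite -[X in frac_der X]divr1 -(rmorph1 tf) frac_der_div ?oner_eq0 //.
by rewrite d1 rmorph0 rmorph1 mulr0 subr0 mulr1 expr1n divr1.
Qed.
End Derivation.
End FractionExtension.

Section RationalFunctions.
Variables (K : numFieldType) (m : nat).
Local Notation n := m.+1.
Local Notation P := {mpoly K[m]}.
Local Notation tf := (@FracField.tofrac P).

Definition coordp (i : 'I_n) : P :=
  if unlift ord_max i is Some j then 'X_j else - \sum_j 'X_j.

Lemma coordp_lift (j : 'I_m) : coordp (lift ord_max j) = 'X_j.
Proof. by rewrite /coordp liftK. Qed.
Lemma coordp_max : coordp ord_max = - \sum_j 'X_j.
Proof. by rewrite /coordp unlift_none. Qed.
Lemma sum_lift (V : zmodType) (G : 'I_n -> V) :
  \sum_i G i = \sum_(j < m) G (lift ord_max j) + G ord_max.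
Proof.
rewrite big_ord_recr /=; congr (_ + _); apply: eq_bigr => j _.
by congr G; apply: val_inj; exact: esym (lift_max j).
Qed.
Lemma sum_coordp : \sum_i coordp i = 0.
Proof.
rewrite sum_lift coordp_max (eq_bigr (fun j => 'X_j)) ?subrr // => j _.
exact: coordp_lift.
Qed.

Definition actp (w : 'S_n) : P -> P :=
  mmap (@mpolyC m K) (fun j : 'I_m => coordp (w^-1%g (lift ord_max j))).
HB.instance Definition _ w := GRing.RMorphism.on (actp w).

Lemma actp_coordp w i : actp w (coordp i) = coordp (w^-1%g i).
Proof.
have actX j : actp w 'X_j = coordp (w^-1%g (lift ord_max j)).
  by rewrite /actp mmapX mmap1U.
case: (unliftP ord_max i) => [j ->|->]; first by rewrite coordp_lift actX.
rewrite coordp_max rmorphN rmorph_sum /=; under eq_bigr do rewrite actX.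
apply/eqP; rewrite eq_sym -addr_eq0 addrC -(sum_lift (fun i => coordp (w^-1%g i))).
by apply/eqP; rewrite -[RHS]sum_coordp [RHS](reindex_inj (@perm_inj _ w^-1%g)).
Qed.

Lemma actpC w a : actp w a%:MP = a%:MP.
Proof. exact: mmapC. Qed.

Lemma actpK w : cancel (actp w) (actp w^-1%g).
Proof.
elim/mpoly_gen_ind => [a|j|p q IHp IHq|p q IHp IHq].
- by rewrite !actpC.
- by rewrite -coordp_lift !actp_coordp invgK permKV.
- by rewrite !rmorphD /= IHp IHq.
- by rewrite !rmorphM /= IHp IHq.
Qed.

(** The coefficients are the free coordinates of the projected i-th basis vector. *)
Definition derp (i : 'I_n) (p : P) : P :=
  \sum_(j < m) ((i == lift ord_max j)%:R - n%:R^-1) *: p^`M(j).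

Lemma derpB i p q : derp i (p - q) = derp i p - derp i q.
Proof. by rewrite -sumrB; apply: eq_bigr => j _; rewrite mderivB scalerBr. Qed.
Lemma derpM i p q : derp i (p * q) = derp i p * q + p * derp i q.
Proof.
rewrite mulr_suml mulr_sumr -big_split; apply: eq_bigr => j _ /=.
by rewrite mderivM scalerDr scalerAl scalerAr.
Qed.
Lemma derpC i a : derp i a%:MP = 0.
Proof. by apply: big1 => j _; rewrite mderivC scaler0. Qed.
Lemma derp_X i j : derp i 'X_j = ((i == lift ord_max j)%:R - n%:R^-1)%:MP.
Proof.
have dX l : 'X_j^`M(l) = ((l == j)%:R)%:MP_[m] :> P.
  rewrite mderivX mnm1E eq_sym; case: eqP => [->|_]; last by rewrite !mulr0n scale0r mpolyC0.
  by rewrite !mulr1n scale1r -[Z in (Z - _)%MM]add0m addmK mpolyX0 mpolyC1.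
rewrite /derp (bigD1 j) //= big1 ?addr0 => [|l /negPf lj]; rewrite dX.
  by rewrite eqxx mpolyC1 -mul_mpolyC mulr1.
by rewrite lj mpolyC0 scaler0.
Qed.
Lemma derp_coordp i l : derp i (coordp l) = ((i == l)%:R - n%:R^-1)%:MP.
Proof.
case: (unliftP ord_max l) => [j ->|->]; first by rewrite coordp_lift derp_X.
have derpN p : derp i (- p) = - derp i p.
  by rewrite -sumrN; apply: eq_bigr => j _; rewrite mderivN scalerN.
have derpD p q : derp i (p + q) = derp i p + derp i q.
  by rewrite -[q in LHS]opprK derpB derpN opprK.
have derp_sum (G : 'I_m -> P) : derp i (\sum_j G j) = \sum_j derp i (G j).
  elim/big_rec2: _ => [|j u v _ <-]; first by rewrite -(mpolyC0 m) derpC.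
  by rewrite derpD.
rewrite coordp_max derpN derp_sum; under eq_bigr do rewrite derp_X.
rewrite -rmorph_sum -rmorphN; congr (_%:MP); apply/eqP; rewrite eq_sym -addr_eq0 addrC.
rewrite -(sum_lift (fun l => (i == l)%:R - n%:R^-1)) sumrB sumr_const card_ord.
rewrite (bigD1 i) //= eqxx big1 => [|k /negPf ik]; last by rewrite eq_sym ik.
by rewrite addr0 -[X in _ - X]mulr_natl mulfV ?subrr // pnatr_eq0.
Qed.

Local Notation F := {fraction P}.

Lemma tf_inj : injective tf.
Proof. by move=> p q /eqP; rewrite tofrac_eq => /eqP. Qed.
Lemma tf_actp_inj w : injective (tf \o actp w).
Proof. by move=> p q /tf_inj /(can_inj (actpK w)). Qed.

Definition ratf_cst : {rmorphism K -> F} := tf \o @mpolyC m K.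
Definition ratf_act (w : 'S_n) : {rmorphism F -> F} :=
  HB.pack_for {rmorphism F -> F} (frac_map (tf \o actp w))
    (GRing.isZmodMorphism.Build _ _ _ (frac_map_is_zmod_morphism (@tf_actp_inj w)))
    (GRing.isMonoidMorphism.Build _ _ _ (frac_map_is_monoid_morphism (@tf_actp_inj w))).
Lemma ratf_actE w p : ratf_act w (tf p) = tf (actp w p).
Proof. exact: (frac_map_tofrac (@tf_actp_inj w)). Qed.

Lemma ratf_mmap p :
  mmap ratf_cst (fun j : 'I_m => tf (coordp (lift ord_max j))) p = tf p.
Proof.
elim/mpoly_gen_ind: p => [a|j|p q IHp IHq|p q IHp IHq].
- by rewrite mmapC.
- by rewrite mmapX mmap1U coordp_lift.
- by rewrite mmapD IHp IHq rmorphD.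
- by rewrite rmorphM /= IHp IHq rmorphM.
Qed.

Definition rational_refl_field : refl_field K m.
Proof.
apply: (@ReflField K m F ratf_cst (tf \o coordp) ratf_act (fun i => frac_der (derp i))).
- by rewrite -rmorph_sum sum_coordp rmorph0.
- by move=> w a /=; rewrite -[LHS]/(ratf_act w (tf _)) ratf_actE actpC.
- by move=> w i /=; rewrite -[LHS]/(ratf_act w (tf _)) ratf_actE actp_coordp.
- by move=> i; apply: frac_derB; [exact: derpB|exact: derpM].
- by move=> i; apply: frac_derM; exact: derpM.
- by move=> i a /=; rewrite frac_der_tofrac ?derpC ?rmorph0 //; exact: derpM.
- move=> i j /=; rewrite frac_der_tofrac ?derp_coordp; last exact: derpM.
  by rewrite -[LHS]/(ratf_cst _) rmorphB fmorphV !rmorph_nat.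
- by move=> p; rewrite ratf_mmap => /eqP; rewrite tofrac_eq0 => /eqP.
- move=> u; have [p [q [q0 ->]]] := frac_tofrac u; exists p, q; split=> //.
  by rewrite !ratf_mmap.
Qed.
End RationalFunctions.

(** * Independence of the PBW monomials *)

Section Words.
Variable m : nat.
Implicit Types (a b : 'X_{1..m}) (l : seq 'I_m).

Definition mnm_word a : seq 'I_m := flatten [seq nseq (a i) i | i <- enum 'I_m].
Lemma count_mnm_word a i : count_mem i (mnm_word a) = a i.
Proof.
rewrite /mnm_word count_flatten -map_comp sumnE big_map big_enum /= (bigD1 i) //=.
rewrite count_nseq /= eqxx mul1n big1 ?addn0 // => j /negPf ji.
by rewrite count_nseq /= ji.
Qed.
Definition word_mnm l : 'X_{1..m} := [multinom count_mem i l | i < m].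
Lemma perm_word_mnm l : perm_eq l (mnm_word (word_mnm l)).
Proof. by apply/allP => i _; rewrite /= count_mnm_word mnmE. Qed.
Lemma mnm_word_inj a b : perm_eq (mnm_word a) (mnm_word b) -> a = b.
Proof.
by move=> /seq.permP h; apply/mnmP => i; rewrite -!count_mnm_word; exact: h.
Qed.
Lemma mnm_word0 : mnm_word 0%MM = [::].
Proof.
have := perm_word_mnm [::]; rewrite perm_sym => /perm_nilP <-; congr mnm_word.
Qed.
End Words.

Section Independence.
Variables (K : numFieldType) (m : nat) (F : refl_field K m) (c : K).
Local Notation n := m.+1.
Implicit Types (i j l : 'I_n) (w : 'S_n) (f g u v : F).
Local Notation cst := (rf_cst F).
Local Notation x := (@rf_x K m F).
Local Notation act := (@rf_act K m F).
Local Notation der := (@rf_der K m F).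
Local Notation E := (endo cst).
Local Notation mu := (mulop cst).
Local Notation pol := (@pol K m F).
Local Notation sg := (sg F).
Local Notation D := (dunkl F (fun _ _ : 'I_n => c)).
Local Notation e := (symz F).
Implicit Types S T : E.

(** Its coefficients are, up to sign, the elementary symmetric polynomials in the coordinates. *)
Definition chi : {poly F} := \prod_l ('X - (x l)%:P).
Definition chi_coef (k : 'I_n.+1) : F := chi`_k.

Lemma chi_size : size chi = n.+1.
Proof. by rewrite size_prod_XsubC -[RHS]/(n.+1) /index_enum -enumT size_enum_ord. Qed.

Lemma pol_chi_coef k : invpol (chi_coef k).
Proof.
split.
  have : chi \is a polyOver pol.
    by apply: rpred_prod => l _; rewrite polyOverXsubC pol_x.
  by move/polyOverP; exact.
move=> w; rewrite /chi_coef -coef_map /= rmorph_prod (reindex_inj (@perm_inj _ w)) /=.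
by under eq_bigr do rewrite rmorphB /= map_polyX map_polyC /= rf_act_x permK.
Qed.

Lemma der_exp j u k : der j (u ^+ k.+1) = u ^+ k * der j u *+ k.+1.
Proof.
elim: k => [|k IH]; first by rewrite expr1 expr0 mul1r.
by rewrite exprS rf_derM IH mulrnAr mulrA -exprS [RHS]mulrS mulrC.
Qed.

Lemma der_sum j I (r : seq I) (P : pred I) (G : I -> F) :
  der j (\sum_(t <- r | P t) G t) = \sum_(t <- r | P t) der j (G t).
Proof. by elim/big_rec2: _ => [|t u v _ <-]; rewrite ?der0 // derD. Qed.

Lemma chi_root i : chi.[x i] = 0.
Proof. by rewrite horner_prod (bigD1 i) //= hornerXsubC subrr mul0r. Qed.

Lemma chi_deriv_neq0 i : chi^`().[x i] != 0.
Proof.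
rewrite /chi (bigD1 i) //= derivM derivXsubC mul1r hornerD hornerM hornerXsubC subrr mul0r.
rewrite addr0 horner_prod; apply/prodf_neq0 => j ji; rewrite hornerXsubC.
by rewrite xroot_neq0 // eq_sym.
Qed.

(** Implicit differentiation of [chi.[x i] = 0]. *)
Lemma der_chi i j :
  \sum_k der j (chi_coef k) * x i ^+ k = - (chi^`().[x i] * der j (x i)).
Proof.
have := congr1 (der j) (chi_root i).
rewrite der0 (horner_coef_wide _ (eq_leq chi_size)) der_sum.
under eq_bigr do rewrite rf_derM.
rewrite big_split /= => /eqP; rewrite addr_eq0 => /eqP ->; congr (- _).
rewrite big_ord_recl /= expr0 -(rmorph1 cst) rf_der_cst mulr0 add0r.
rewrite (@horner_coef_wide _ n); last by rewrite -ltnS (leq_trans (lt_size_deriv _)) ?chi_size // -size_poly_eq0 chi_size.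
rewrite mulr_suml; apply: eq_bigr => k _.
by rewrite coef_deriv der_exp; ring.
Qed.

(* Lagrange interpolation: by [der_chi] these coefficients invert the Jacobian matrix of
   the invariants [chi_coef]. *)
Definition theta_coef (i : 'I_m) (k : 'I_n.+1) : F :=
  x ord_max ^+ k / chi^`().[x ord_max] - x (lift ord_max i) ^+ k / chi^`().[x (lift ord_max i)].

(** The interpolation sum at [x l] is minus the derivative of [x l]; the difference with the last
    coordinate removes [n^-1]. *)
Lemma theta_coefP (i j : 'I_m) :
  \sum_k theta_coef i k * der (lift ord_max j) (chi_coef k) = (i == j)%:R.
Proof.
have aux l : \sum_(k < n.+1) x l ^+ k / chi^`().[x l] * der (lift ord_max j) (chi_coef k)
    = - der (lift ord_max j) (x l).
  transitivity ((\sum_k der (lift ord_max j) (chi_coef k) * x l ^+ k) / chi^`().[x l]).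
    by rewrite mulr_suml; apply: eq_bigr => k _; ring.
  by rewrite der_chi mulNr mulrC mulKf ?chi_deriv_neq0.
under eq_bigr do rewrite mulrBl.
rewrite sumrB !aux opprK !rf_der_x (inj_eq lift_inj) eq_sym (negPf (neq_lift _ _)) sub0r opprK.
by rewrite addrC subrK eq_sym.
Qed.

(** On words in the Dunkl operators this is differentiation in the i-th variable y, up to lower
    order. *)
Definition theta (i : 'I_m) T : E :=
  \sum_k mu (theta_coef i k) * (T * mu (chi_coef k) - mu (chi_coef k) * T).

Lemma fil_mul_mu r f T : fil r T -> fil r (mu f * T).
Proof.
elim: r T => [|r IH] T /=; first by move=> ->; rewrite mulr0.
move=> hT g hg; have -> : mu f * T * mu g - mu g * (mu f * T) = mu f * (T * mu g - mu g * T).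
  by rewrite mulrBr !mulrA [mu g * mu f]mulopC.
exact/IH/hT.
Qed.
Lemma theta_fil (i : 'I_m) r T : fil r.+1 T -> fil r (theta i T).
Proof. by move=> hT; apply: fil_sum => k _; apply/fil_mul_mu/hT/pol_chi_coef. Qed.
Lemma thetaD (i : 'I_m) S T : theta i (S + T) = theta i S + theta i T.
Proof.
rewrite -big_split; apply: eq_bigr => k _ /=.
by rewrite -mulrDr; congr (_ * _); rewrite mulrDl mulrDr opprD addrACA.
Qed.
Lemma theta_mu (i : 'I_m) f T : theta i (mu f * T) = mu f * theta i T.
Proof.
rewrite mulr_sumr; apply: eq_bigr => k _; rewrite !mulrA [mu f * mu _]mulopC -!mulrA.
congr (_ * _); rewrite mulrBr !mulrA [mu f * mu _]mulopC.
by [].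
Qed.
Lemma thetaZ (i : 'I_m) a T : theta i (a *: T) = a *: theta i T.
Proof. by rewrite -[a *: T]mulr_algl -[a *: theta i T]mulr_algl -mulop_cst theta_mu. Qed.

Local Notation Dl j := (D (lift ord_max j)).

(** The Leibniz rule up to lower order: the error comes from [[Dl j, theta_coef i k]], of order 0,
    multiplied by a bracket with [T], which has lower order than [T]. *)
Lemma theta_D (i j : 'I_m) r T : fil r.+1 T ->
  fil r (theta i (Dl j * T) - ((i == j)%:R *: T + Dl j * theta i T)).
Proof.
move=> hT.
have -> : theta i (Dl j * T) - ((i == j)%:R *: T + Dl j * theta i T) =
   - \sum_k (Dl j * mu (theta_coef i k) - mu (theta_coef i k) * Dl j)
       * (T * mu (chi_coef k) - mu (chi_coef k) * T).
  have -> : (i == j)%:R *: T = \sum_k mu (theta_coef i k * der (lift ord_max j) (chi_coef k)) * T.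
    rewrite -mulr_suml -rmorph_sum theta_coefP.
    by rewrite rmorph_nat scaler_nat mulr_natl.
  rewrite mulr_sumr -big_split -sumrB -sumrN; apply: eq_bigr => k _ /=.
  have -> : mu (theta_coef i k * der (lift ord_max j) (chi_coef k)) =
      mu (theta_coef i k) * (Dl j * mu (chi_coef k) - mu (chi_coef k) * Dl j).
    by rewrite D_invpol ?rmorphM //; exact: pol_chi_coef.
  move: (mu (theta_coef i k)) (mu (chi_coef k)) (Dl j) => g f S.
  by rewrite !(mulrBl, mulrBr) !mulrA [RHS]opprB opprD opprB addrA subrKA.
rewrite -scaleN1r; apply/filZ/fil_sum => k _.
have hf : fil 1 (Dl j * mu (theta_coef i k) - mu (theta_coef i k) * Dl j).
  rewrite dunkl_mu addrAC [mu _ * Dl j + _]addrC addrK.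
  apply: filD; first exact: fil_mu.
  rewrite -scaleN1r; apply/filZ/fil_sum => l _; apply/filZ/fil_mul_mu/fil_sg.
have := hT _ (pol_chi_coef k); case: r {hT} => [|r] hr; first by rewrite hr mulr0.
by rewrite -[r.+1]/((0 + r).+1); exact: filM.
Qed.

Arguments fil : simpl never.

Definition Dword (l : seq 'I_m) : E := foldr (fun (j : 'I_m) T => Dl j * T) e l.

Lemma fil_symz : fil 1 e.
Proof. by apply/filZ/fil_sum => w _; exact: fil_sg. Qed.
Lemma fil_Dword (s : seq 'I_m) : fil (size s).+1 (Dword s).
Proof.
elim: s => [|j s IH] /=; first exact: fil_symz.
by rewrite -[(size s).+2]/((1 + size s).+1); apply: filM => //; exact: fil_D.
Qed.

Lemma Dword_rem (j : 'I_m) s : j \in s -> Dl j * Dword (rem j s) = Dword s.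
Proof.
elim: s => //= a s IH; rewrite inE eq_sym; case: eqVneq => [->//|aj] /= js.
by rewrite mulrA dunkl_comm -mulrA IH.
Qed.

(** A word shortened by one letter lies in [fil (size s)], so [(size s).-1] says that the error has
    order one less. *)
Lemma theta_Dword (i : 'I_m) s :
  fil (size s).-1 (theta i (Dword s) - (count_mem i s)%:R *: Dword (rem i s)).
Proof.
elim: s => [|j s IH]; first by rewrite scale0r subr0; exact: theta_fil fil_symz.
pose Z := (i == j)%:R *: Dword s + Dl j * ((count_mem i s)%:R *: Dword (rem i s)).
have -> : (count_mem i (j :: s))%:R *: Dword (rem i (j :: s)) = Z.
  rewrite /Z /= natrD scalerDl eq_sym; case: eqVneq => [->|ij]; last first.
    by rewrite !mulr0n !scale0r !add0r -scalerAr.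
  congr (_ + _); have [js|/count_memPn ->] := boolP (j \in s).
    by rewrite -scalerAr Dword_rem.
  by rewrite !scale0r mulr0.
rewrite /Z opprD addrA.
have -> : theta i (Dword (j :: s)) - (i == j)%:R *: Dword s
     - Dl j * ((count_mem i s)%:R *: Dword (rem i s)) =
   theta i (Dl j * Dword s) - ((i == j)%:R *: Dword s + Dl j * theta i (Dword s))
   + Dl j * (theta i (Dword s) - (count_mem i s)%:R *: Dword (rem i s)).
  by rewrite mulrBr opprD !addrA subrK.
apply: filD; first exact/theta_D/fil_Dword.
rewrite [(size _).-1]/=.
move: IH; move: (size s) (theta i _ - _) => [|[|r]] T hT.
- by rewrite hT mulr0; exact: fil0.
- by rewrite hT mulr0; exact: fil0.
- by rewrite -[r.+2]/((1 + r).+1); apply: filM => //; exact: fil_D.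
Qed.

Definition thetas (js : seq 'I_m) T : E := foldl (fun T (i : 'I_m) => theta i T) T js.

Lemma thetasD js S T : thetas js (S + T) = thetas js S + thetas js T.
Proof. by elim: js S T => //= i js IH S T; rewrite thetaD IH. Qed.
Lemma thetas_mu js f T : thetas js (mu f * T) = mu f * thetas js T.
Proof. by elim: js T => //= i js IH T; rewrite theta_mu IH. Qed.
Lemma thetasZ js a T : thetas js (a *: T) = a *: thetas js T.
Proof. by elim: js T => //= i js IH T; rewrite thetaZ IH. Qed.
Lemma thetas0 js : thetas js 0 = 0.
Proof. by rewrite -[X in thetas js X](scale0r 0) thetasZ scale0r. Qed.
Lemma thetas_sum js I (r : seq I) (P : pred I) (G : I -> E) :
  thetas js (\sum_(t <- r | P t) G t) = \sum_(t <- r | P t) thetas js (G t).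
Proof. by elim/big_rec2: _ => [|t S T _ <-]; rewrite ?thetas0 // thetasD. Qed.
Lemma thetas_fil js T : fil (size js) T -> thetas js T = 0.
Proof. by elim: js T => //= i js IH T hT; apply/IH/theta_fil. Qed.
Lemma thetas_small js s : (size s < size js)%N -> thetas js (Dword s) = 0.
Proof. by move=> h; apply: thetas_fil; apply: fil_leq h (fil_Dword s). Qed.

(** As for iterated derivatives of a monomial, N is a product of multiplicities; it vanishes as soon
    as a letter is missing. *)
Lemma thetas_Dword js s : size js = size s ->
  exists N : nat, thetas js (Dword s) = N%:R *: e /\ (perm_eq js s = (N != 0)%N).
Proof.
elim: js s => [|i js IH] s /=.
  by move=> /esym/size0nil ->; exists 1%N; rewrite scale1r.
move=> jss; have -> : theta i (Dword s) =
    (theta i (Dword s) - (count_mem i s)%:R *: Dword (rem i s))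
    + (count_mem i s)%:R *: Dword (rem i s) by rewrite subrK.
rewrite thetasD thetas_fil; last by have := theta_Dword i s; rewrite -jss.
rewrite add0r thetasZ; have [si|si] := boolP (i \in s); last first.
  exists 0%N; rewrite (count_memPn si) !scale0r; split=> //=; apply/negP => /perm_mem/(_ i).
  by rewrite inE eqxx (negPf si).
have [|N [-> hN]] := IH (rem i s); first by rewrite size_rem // -jss.
exists (count_mem i s * N)%N; split; first by rewrite scalerA natrM.
have ci : (0 < count_mem i s)%N by rewrite -has_count has_pred1.
by rewrite muln_eq0 negb_or -lt0n ci /= -hN (permPr (perm_to_rem si)) perm_cons.
Qed.

Lemma ev_monomials_independent (s : seq 'X_{1..m}) (k : 'X_{1..m} -> K) : uniq s ->
  \sum_(a <- s) cst (k a) * ev F 'X_[a] = 0 -> forall a, a \in s -> k a = 0.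
Proof.
move=> us sum0 a sa.
have : ev F (\sum_(b <- s) k b *: 'X_[b]) = 0.
  rewrite rmorph_sum /= -[RHS]sum0; apply: eq_bigr => b _.
  by rewrite -mul_mpolyC rmorphM /= evC.
move/eqP; rewrite ev_eq0 => /eqP /mpolyP/(_ a).
rewrite mcoeff0 raddf_sum /= (bigD1_seq a) //= mcoeffZ mcoeffX eqxx mulr1 big1 ?addr0 //.
by move=> b ba; rewrite mcoeffZ mcoeffX (negPf ba) mulr0.
Qed.

(** Among the terms with nonzero coefficient choose one of maximal degree in y and differentiate
    along its word. The terms with another y-monomial disappear, and a relation between monomials in
    x, multiplied by [e], is left. *)
Lemma Dword_independent (s : seq ('X_{1..m} * 'X_{1..m})) (k : _ -> K) : uniq s ->
  \sum_(t <- s) k t *: (mu (ev F 'X_[t.1]) * Dword (mnm_word t.2)) = 0 ->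
  forall t, t \in s -> k t = 0.
Proof.
move=> us sum0 t0 st0; apply/eqP; apply: contraT => kt0.
pose sz (t : 'X_{1..m} * 'X_{1..m}) := size (mnm_word t.2).
pose Q d := has (fun t => (k t != 0) && (sz t == d)) s.
have exQ : exists d, Q d by exists (sz t0); apply/hasP; exists t0; rewrite // kt0 /=.
have ubQ d : Q d -> (d <= \max_(t <- s) sz t)%N.
  by move=> /hasP[t st /andP[_ /eqP <-]]; exact: leq_bigmax_seq.
case: (ex_maxnP exQ ubQ) => d /hasP[[a1 b1] st1 /andP[kt1 /eqP szt1]] maxd.
have := congr1 (thetas (mnm_word b1)) sum0; rewrite thetas0 thetas_sum.
under eq_bigr do rewrite thetasZ thetas_mu.
have -> : \sum_(t <- s) k t *: (mu (ev F 'X_[t.1]) * thetas (mnm_word b1) (Dword (mnm_word t.2))) =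
    mu (\sum_(t <- s | t.2 == b1) cst (k t) * ev F 'X_[t.1]) * thetas (mnm_word b1) (Dword (mnm_word b1)).
  rewrite rmorph_sum mulr_suml [RHS]big_mkcond /=; apply: eq_big_seq => -[a b] st /=.
  have [->|bb1] := eqVneq b b1.
    by rewrite rmorphM /= mulop_cst -mulrA mulr_algl.
  have [->|kt] := eqVneq (k (a, b)) 0; first by rewrite scale0r.
  have : (sz (a, b) <= sz (a1, b1))%N.
    by rewrite szt1; apply: maxd; apply/hasP; exists (a, b); rewrite // kt /=.
  rewrite /sz /= leq_eqVlt => /orP[/eqP sE|slt]; last by rewrite thetas_small // mulr0 scaler0.
  have [N' [-> hN']] := thetas_Dword (esym sE).
  suff : ~~ perm_eq (mnm_word b1) (mnm_word b).
    by rewrite hN' negbK => /eqP ->; rewrite scale0r mulr0 scaler0.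
  by apply: contra bb1 => /mnm_word_inj ->.
have [N2 [-> hN2]] := @thetas_Dword (mnm_word b1) (mnm_word b1) erefl.
rewrite -scalerAr => /(congr1 ( *:%R N2%:R^-1)); rewrite scalerA mulVf ?scale1r ?scaler0; last first.
  by rewrite pnatr_eq0 -hN2 perm_refl.
move=> /mu_symz_inj sum1.
have := @ev_monomials_independent [seq t.1 | t <- s & t.2 == b1] (fun a => k (a, b1)).
move=> /(_ _ _ a1) h; move: kt1; rewrite h ?eqxx //.
- rewrite map_inj_in_uniq ?filter_uniq // => -[a b] [a' b'].
  by rewrite !mem_filter /= => /andP[/eqP -> _] /andP[/eqP -> _] ->.
- rewrite big_map big_filter -[RHS]sum1; apply: eq_bigr => -[a b] /= /eqP ->.
  by [].
- by apply/mapP; exists (a1, b1); rewrite // mem_filter /= eqxx.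
Qed.
End Independence.

(** * Spanning by the PBW monomials *)

Section Span.
Variables (K : pzRingType) (R : pzRingType) (kh : {rmorphism K -> R}).
Hypothesis kh_central : forall a r, kh a * r = r * kh a.

(** The quotient ring [cherednik] is only given a ring structure, so scalars act through the central
    morphism [kh]. *)
Inductive lspan (T : Type) (M : T -> R) : R -> Prop :=
| lspan_gen t : lspan M (M t)
| lspan0 : lspan M 0
| lspan_add r s : lspan M r -> lspan M s -> lspan M (r + s)
| lspan_scale a r : lspan M r -> lspan M (kh a * r).

Lemma lspanN T (M : T -> R) r : lspan M r -> lspan M (- r).
Proof. by move=> h; rewrite -mulN1r -(rmorph1 kh) -rmorphN; exact: lspan_scale. Qed.
Lemma lspan_sum T (M : T -> R) L (s : seq L) (P : pred L) (G : L -> R) :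
  (forall t, P t -> lspan M (G t)) -> lspan M (\sum_(t <- s | P t) G t).
Proof. by move=> h; apply: (big_ind (lspan M)) => //; [exact: lspan0|exact: lspan_add]. Qed.
Lemma lspan_mulr T U (M : T -> R) (N : U -> R) g r :
  (forall t, lspan N (g * M t)) -> lspan M r -> lspan N (g * r).
Proof.
move=> h; elim=> [//||r1 r2 _ h1 _ h2|a r1 _ h1]; first by rewrite mulr0; exact: lspan0.
  by rewrite mulrDr; exact: lspan_add.
by rewrite mulrA -kh_central -mulrA; exact: lspan_scale.
Qed.
Lemma lspan_trans T U (M : T -> R) (N : U -> R) r :
  (forall t, lspan N (M t)) -> lspan M r -> lspan N r.
Proof.
move=> h hr; rewrite -[r]mul1r; apply: lspan_mulr hr => t; rewrite mul1r; exact: h.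
Qed.

(** Collecting equal generators gives the form in which [Dword_independent] applies. *)
Lemma lspan_uniq (T : eqType) (M : T -> R) r : lspan M r ->
  exists (s : seq T) (k : T -> K), uniq s /\ r = \sum_(t <- s) kh (k t) * M t.
Proof.
elim=> [t||r1 r2 _ [s1 [k1 [u1 ->]]] _ [s2 [k2 [u2 ->]]]|a r1 _ [s [k [us ->]]]].
- by exists [:: t], (fun=> 1); rewrite big_seq1 rmorph1 mul1r.
- by exists [::], (fun=> 0); rewrite big_nil.
- exists (undup (s1 ++ s2)),
    (fun t => (if t \in s1 then k1 t else 0) + (if t \in s2 then k2 t else 0)).
  split; first exact: undup_uniq.
  have sumE s' k : uniq s' -> {subset s' <= undup (s1 ++ s2)} ->
      \sum_(t <- s') kh (k t) * M t =
      \sum_(t <- undup (s1 ++ s2)) kh (if t \in s' then k t else 0) * M t.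
    move=> us' sub; rewrite [RHS](bigID (mem s')) /= [X in _ + X]big1 ?addr0.
      rewrite -[RHS]big_filter; transitivity
        (\sum_(t <- s') kh (if t \in s' then k t else 0) * M t).
        by apply: eq_big_seq => t ->.
      apply: perm_big; apply: uniq_perm => //; first by rewrite filter_uniq ?undup_uniq.
      by move=> t; rewrite mem_filter; apply/idP/andP => [ts|[]//]; rewrite ts sub.
    by move=> t /negPf ->; rewrite rmorph0 mul0r.
  rewrite (sumE s1 k1 u1) ?(sumE s2 k2 u2) -?big_split /=.
  + by apply: eq_bigr => t _; rewrite rmorphD mulrDl.
  + by move=> t ts; rewrite mem_undup mem_cat ts orbT.
  + by move=> t ts; rewrite mem_undup mem_cat ts.
- exists s, (fun t => a * k t); split=> //; rewrite mulr_sumr; apply: eq_bigr => t _.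
  by rewrite rmorphM mulrA.
Qed.
End Span.

Section Spanning.
Variables (K : pzRingType) (R : pzRingType) (kh : {rmorphism K -> R}) (m : nat).
Local Notation n := m.+1.
Variables (xh yh : 'I_n -> R) (sh : 'S_n -> R) (e : R) (gam : 'I_n -> 'I_n -> 'S_n -> K).
Implicit Types (i j : 'I_n) (w : 'S_n).
Hypothesis kh_central : forall a r, kh a * r = r * kh a.
Hypothesis sum_xh : \sum_i xh i = 0.
Hypothesis sum_yh : \sum_i yh i = 0.
Hypothesis xhC : forall i j, xh i * xh j = xh j * xh i.
Hypothesis yhC : forall i j, yh i * yh j = yh j * yh i.
Hypothesis sh_xh : forall w i, sh w * xh i = xh (w^-1%g i) * sh w.
Hypothesis sh_yh : forall w i, sh w * yh i = yh (w^-1%g i) * sh w.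
Hypothesis sh_e : forall w, sh w * e = e.
Hypothesis yh_xh : forall i j, yh i * xh j = xh j * yh i + \sum_w kh (gam i j w) * sh w.

Definition hword (z : 'I_n -> R) (s : seq 'I_n) (r : R) : R := foldr (fun i r => z i * r) r s.
Local Notation lft := (lift (@ord_max m)).
(** The last letter is left out, being minus the sum of the others. *)
Definition pbw (t : 'X_{1..m} * 'X_{1..m}) : R :=
  hword xh (map lft (mnm_word t.1)) (hword yh (map lft (mnm_word t.2)) e).

Section Letters.
Variable z : 'I_n -> R.
Hypothesis zC : forall i j, z i * z j = z j * z i.
Hypothesis sum_z : \sum_i z i = 0.

Lemma hword_perm s s' r : perm_eq s s' -> hword z s r = hword z s' r.
Proof.
elim: s s' => [|i s IH] s' ss'; first by move: ss'; rewrite perm_sym => /perm_nilP ->.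
have is' : i \in s' by rewrite -(perm_mem ss') mem_head.
have -> : hword z s' r = hword z (i :: rem i s') r.
  elim: s' is' {ss'} => //= a s' IH'; rewrite inE eq_sym.
  case: eqVneq => [->//|ai] /= is'; rewrite IH' //= !mulrA zC.
  by [].
rewrite /=; congr (_ * _); apply: IH.
by rewrite -(perm_cons i) (permPl ss'); exact: perm_to_rem.
Qed.

Lemma z_max : z ord_max = - \sum_(j < m) z (lft j).
Proof.
have := sum_z; rewrite big_ord_recr /= => /eqP; rewrite addrC addr_eq0 => /eqP ->.
by congr (- _); apply: eq_bigr => j _; congr (z _); apply: val_inj; exact: esym (lift_max j).
Qed.

Lemma lspan_letter T (M : T -> R) r :
  (forall j : 'I_m, lspan kh M (z (lft j) * r)) -> forall i, lspan kh M (z i * r).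
Proof.
move=> h i; case: (unliftP ord_max i) => [j ->|->]; first exact: h.
by rewrite z_max mulNr mulr_suml; apply/lspanN/lspan_sum => j _; exact: h.
Qed.

Lemma lspan_hword T (M : T -> R) s r : (forall t i, lspan kh M (z i * M t)) ->
  lspan kh M r -> lspan kh M (hword z s r).
Proof.
move=> h; elim: s => //= i s IH hr; apply: (lspan_mulr kh_central) (IH hr) => t.
exact: h.
Qed.
End Letters.

Lemma mnm_word_cons (j : 'I_m) a :
  perm_eq (j :: mnm_word a) (mnm_word (a + U_(j))%MM).
Proof.
apply/allP => i _ /=; rewrite !count_mnm_word mnmDE mnm1E addnC.
by [].
Qed.

Definition ypbw (b : 'X_{1..m}) : R := hword yh (map lft (mnm_word b)) e.

Lemma lspan_y i b : lspan kh ypbw (yh i * ypbw b).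
Proof.
apply: (lspan_letter sum_yh) => {i} j.
have -> : yh (lft j) * ypbw b = ypbw (b + U_(j))%MM; last exact: lspan_gen.
rewrite -[LHS]/(hword yh (map lft (j :: mnm_word b)) e).
by apply: (hword_perm yhC); rewrite perm_map // mnm_word_cons.
Qed.
Lemma lspan_x i t : lspan kh pbw (xh i * pbw t).
Proof.
apply: (lspan_letter sum_xh) => {i} j; case: t => a b.
have -> : xh (lft j) * pbw (a, b) = pbw ((a + U_(j))%MM, b); last exact: lspan_gen.
rewrite -[LHS]/(hword xh (map lft (j :: mnm_word a)) _).
by apply: (hword_perm xhC); rewrite perm_map // mnm_word_cons.
Qed.

Lemma ypbw0 : ypbw 0%MM = e. Proof. by rewrite /ypbw mnm_word0. Qed.

Lemma lspan_xy s s' : lspan kh pbw (hword xh s (hword yh s' e)).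
Proof.
apply: lspan_hword => [t i|]; first exact: lspan_x.
have : lspan kh ypbw (hword yh s' e).
  apply: lspan_hword => [t i|]; first exact: lspan_y.
  by rewrite -ypbw0; exact: lspan_gen.
apply: (lspan_trans kh_central) => b.
have -> : ypbw b = pbw (0%MM, b) by rewrite /pbw /= mnm_word0.
exact: lspan_gen.
Qed.

Lemma sh_hword (z : 'I_n -> R) w s r : (forall i, sh w * z i = z (w^-1%g i) * sh w) ->
  sh w * hword z s r = hword z (map w^-1%g s) (sh w * r).
Proof. by move=> h; elim: s => //= i s IH; rewrite mulrA h -mulrA IH. Qed.

Lemma lspan_sh w r : lspan kh pbw r -> lspan kh pbw (sh w * r).
Proof.
apply: (lspan_mulr kh_central) => t.
by rewrite /pbw sh_hword // sh_hword // sh_e; exact: lspan_xy.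
Qed.
Lemma lspan_xh i r : lspan kh pbw r -> lspan kh pbw (xh i * r).
Proof. by apply: (lspan_mulr kh_central) => t; exact: lspan_x. Qed.
(** The letter y moves right through the x-word. Each commutator leaves group elements, which
    permute the remaining letters and are absorbed by [e]. *)
Lemma lspan_yh i r : lspan kh pbw r -> lspan kh pbw (yh i * r).
Proof.
apply: (lspan_mulr kh_central) => -[a b]; rewrite /pbw /=.
elim: (map lft (mnm_word a)) => [|j s IH] /=.
  exact: (lspan_xy [::] (i :: map lft (mnm_word b))).
rewrite mulrA yh_xh mulrDl -mulrA; apply: lspan_add; first exact: lspan_xh.
rewrite mulr_suml; apply: lspan_sum => w _; rewrite -mulrA; apply/lspan_scale/lspan_sh.
exact: lspan_xy.
Qed.
Lemma lspan_e : lspan kh pbw e.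
Proof. exact: (lspan_xy [::] [::]). Qed.
End Spanning.

(** * The smash product with a tensor algebra *)

Section TensorInduction.
Import monalg.
Variables (K : fieldType) (V : vectType K).
Lemma tensor_ind (P : tensor_alg V -> Prop) :
  P 1 -> (forall v, P (tensor_inj v)) ->
  (forall a b, P a -> P b -> P (a + b)) -> (forall a b, P a -> P b -> P (a * b)) ->
  (forall k a, P a -> P (k *: a)) -> forall a, P a.
Proof.
move=> P1 Pv PD PM PZ a.
pose W (u : {fmonom 'I_(\dim {:V})}) : tensor_alg V := << u >>.
have PW u : P (W u).
  case: u; elim=> [|i s IHs].
    have -> : W (FMonom [::]) = 1 by rewrite /W -fmoneE.
    exact: P1.
  have -> : W (FMonom (i :: s)) = tensor_gen i * W (FMonom s).
    rewrite /W /tensor_gen [RHS]fgmulUU mulr1; congr (<< _ >>).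
    by apply/eqP; rewrite fmP fmM fmU.
  by rewrite -tensor_injE; apply: (PM).
rewrite [a]monalgE; apply: (big_ind P) => [||u _]; [|exact: PD|].
  by rewrite -(scale0r 1); exact: PZ.
set k := mcoeff _ _.
have -> : mkmalgU u k = k *: W u.
  by apply/malgP => m'; rewrite mcoeffZ !mcoeffU mulrnAr mulr1.
exact: PZ.
Qed.
End TensorInduction.

Section Smash.
Variables (K : fieldType) (gT : finGroupType) (A : algType K) (act : alg_action gT A).
Local Notation smash := (smash_of act).

Lemma smash_decomp (u : smash) : u = \sum_g smash_alg act (u g) * smash_grp act g.
Proof.
apply/ffunP => k; rewrite sum_ffunE (bigD1 k) //= big1 ?addr0.
  rewrite ffunE (bigD1 1%g) //= big1 ?addr0 => [|g /negPf g1].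
    by rewrite !ffunE eqxx invg1 mul1g eqxx rmorph1 mulr1.
  by rewrite ffunE g1 mul0r.
move=> g gk; rewrite ffunE (bigD1 1%g) //= big1 ?addr0 => [|h /negPf h1].
  by rewrite !ffunE eqxx invg1 mul1g eq_sym (negPf gk) raddf0 mulr0.
by rewrite ffunE h1 mul0r.
Qed.
Lemma smash_algD a b : smash_alg act (a + b) = smash_alg act a + smash_alg act b.
Proof. by apply/ffunP => g; rewrite !ffunE; case: ifP => // _; rewrite addr0. Qed.
Lemma smash_algZ k a : smash_alg act (k *: a) = k *: smash_alg act a.
Proof. by apply/ffunP => g; rewrite !ffunE; case: ifP => // _; rewrite scaler0. Qed.
Lemma smash_alg1 : smash_alg act 1 = 1.
Proof. by apply/ffunP => g; rewrite !ffunE; case: ifP. Qed.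
Lemma smash_algM a b : smash_alg act (a * b) = smash_alg act a * smash_alg act b.
Proof.
apply/ffunP => g; rewrite !ffunE (bigD1 1%g) //= big1 ?addr0 => [|h /negPf h1].
  by rewrite !ffunE eqxx invg1 mul1g alg_act1; case: ifP => // _; rewrite mulr0.
by rewrite ffunE h1 mul0r.
Qed.
Lemma smash_grp_alg g a : smash_grp act g * smash_alg act a = smash_alg act (act g a) * smash_grp act g.
Proof.
apply/ffunP => k; rewrite !ffunE (bigD1 g) //= [in RHS](bigD1 1%g) //= !big1 ?addr0.
- rewrite !ffunE !eqxx invg1 mul1g mul1r -eq_mulVg1 eq_sym.
  by case: eqP => _; rewrite ?rmorph1 ?mulr1 // !raddf0 mulr0.
- by move=> h /negPf h1; rewrite ffunE h1 mul0r.
- by move=> h /negPf h1; rewrite ffunE h1 mul0r.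
Qed.
End Smash.

(** * Coordinates on the reflection representation *)

Section ReflectionCoordinates.
Variables (K : numFieldType) (m : nat).
Local Notation n := m.+1.
Local Notation h := (refl_space K n).
Local Notation h' := 'Hom(refl_space K n, K^o).

Definition crd (y : h) (i : 'I_n) : K := vsval y 0 i.

Lemma crdP (y z : h) : (forall i, crd y i = crd z i) -> y = z.
Proof. by move=> yz; apply: val_inj; apply/rowP => i; exact: yz. Qed.

Definition coord_form i (y : h) : K^o := crd y i.
Fact coord_form_is_linear i : linear (coord_form i).
Proof.
move=> a y z; rewrite /coord_form /crd.
have -> : vsval (a *: y + z) = a *: vsval y + vsval z by rewrite linearP.
by rewrite !mxE.
Qed.
HB.instance Definition _ i :=
  GRing.isLinear.Build K h K^o _ (coord_form i) (coord_form_is_linear i).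

Definition xcoord i : h' := linfun (coord_form i).
Lemma xcoordE i y : xcoord i y = crd y i. Proof. by rewrite lfunE. Qed.

Lemma sum_crd y : \sum_i crd y i = 0.
Proof. exact/refl_spaceP/subvsP. Qed.

(** With [xcoord] these form redundant coordinates that [S_n] permutes, which avoids choosing a
    basis of h. *)
Definition ybar i : h := vsproj _ (\row_j ((j == i)%:R - n%:R^-1)).
Lemma crd_ybar i j : crd (ybar i) j = (j == i)%:R - n%:R^-1.
Proof.
rewrite /crd vsprojK ?mxE //; apply/refl_spaceP.
under eq_bigr do rewrite mxE; rewrite sumrB sumr_const card_ord.
rewrite (bigD1 i) //= eqxx big1 ?addr0 => [|k /negPf -> //].
by rewrite -[_ *+ n]mulr_natr mulVf ?subrr // pnatr_eq0.
Qed.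

Lemma refl_space_decomp (y : h) : y = \sum_i crd y i *: ybar i.
Proof.
apply: crdP => j.
have -> : crd (\sum_i crd y i *: ybar i) j = \sum_i crd y i * crd (ybar i) j.
  rewrite -xcoordE linear_sum; apply: eq_bigr => i _.
  by rewrite linearZ /= xcoordE.
under eq_bigr do rewrite crd_ybar mulrBr; rewrite sumrB -mulr_suml sum_crd mul0r subr0.
by rewrite (bigD1 j) //= eqxx mulr1 big1 ?addr0 // => k; rewrite eq_sym => /negPf ->; rewrite mulr0.
Qed.
Lemma dual_sumE (x : h') y : x y = \sum_i crd y i * x (ybar i).
Proof. by rewrite {1}[y]refl_space_decomp linear_sum; apply: eq_bigr => i _; rewrite linearZ. Qed.
Lemma refl_dual_decomp (x : h') : x = \sum_i x (ybar i) *: xcoord i.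
Proof.
apply/lfunP => y; rewrite dual_sumE sum_lfunE; apply: eq_bigr => i _.
by rewrite scale_lfunE xcoordE mulrC.
Qed.
Lemma sum_ybar : \sum_i ybar i = 0.
Proof.
apply: crdP => j; rewrite -!xcoordE linear0 linear_sum.
under eq_bigr do rewrite /= xcoordE crd_ybar.
rewrite sumrB sumr_const card_ord (bigD1 j) //= eqxx big1 ?addr0 => [|k].
  by rewrite -[_ *+ n]mulr_natr mulVf ?subrr // pnatr_eq0.
by rewrite eq_sym => /negPf ->.
Qed.
Lemma sum_xcoord : \sum_i xcoord i = 0.
Proof. by apply/lfunP => y; rewrite sum_lfunE zero_lfunE -[RHS](sum_crd y); apply: eq_bigr => i _; exact: xcoordE. Qed.

Lemma crd_act w y i : crd (refl_rep K n w y) i = crd y (w i).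
Proof. by rewrite lfunE /crd /= refl_actE mxE. Qed.
Lemma act_ybar w i : refl_rep K n w (ybar i) = ybar (w^-1%g i).
Proof.
apply: crdP => j; rewrite crd_act !crd_ybar.
by congr ((_ : bool)%:R - _); rewrite -[in RHS](inj_eq (@perm_inj _ w)) permKV.
Qed.
Lemma dual_actE w (x : h') y : dual_rep (refl_rep K n) w x y = x (refl_rep K n w^-1%g y).
Proof. by rewrite lfunE /= comp_lfunE. Qed.
Lemma act_xcoord w i : dual_rep (refl_rep K n) w (xcoord i) = xcoord (w^-1%g i).
Proof. by apply/lfunP => y; rewrite dual_actE !xcoordE crd_act. Qed.

(** The eigenlines contain [xcoord i - xcoord j] and [ybar i - ybar j], which are therefore
    multiples p and q of the chosen root and coroot. Both pairs have pairing 2, so [p * q = 1] and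
    the scalings cancel. *)
Lemma root_datum_pairing alpha alphav (x : h') (y : h) i j :
  @is_root_datum K n alpha alphav -> i != j ->
  alpha (tperm i j) y * x (alphav (tperm i j)) =
  (crd y i - crd y j) * (x (ybar i) - x (ybar j)).
Proof.
move=> rd ij; set s := tperm i j.
have sT : s \in transpositions n by apply/imsetP; exists (i, j); rewrite ?inE.
have [] := rd s sT.
set a := alpha s; set b := alphav s => ha hb ab2.
have : xcoord i - xcoord j \in end_eigenspace (dual_rep (refl_rep K n) s) (-1).
  rewrite memv_ker; apply/eqP; rewrite !lfunE /= opp_lfunE scale_lfunE id_lfunE scaleN1r opprK.
  by rewrite linearB /= !act_xcoord tpermV tpermL tpermR addrA subrK subrr.
rewrite ha => /vlineP[p pE].
have : ybar i - ybar j \in end_eigenspace (refl_rep K n s) (-1).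
  rewrite memv_ker; apply/eqP; rewrite !lfunE /= opp_lfunE scale_lfunE id_lfunE scaleN1r opprK.
  by rewrite linearB /= !act_ybar tpermV tpermL tpermR addrA subrK subrr.
rewrite hb => /vlineP[q qE].
have pq : p * q = 1.
  have : (xcoord i - xcoord j) (ybar i - ybar j) = 2.
    rewrite add_lfunE opp_lfunE !linearB /= !xcoordE !crd_ybar !eqxx (eq_sym j) (negPf ij) /=.
    by rewrite -[LHS]/((1 - n%:R^-1 - (0 - n%:R^-1) + (- (0 - n%:R^-1) - - (1 - n%:R^-1))) : K); ring.
  rewrite pE qE scale_lfunE linearZ /= ab2 => /eqP.
  rewrite -[p *: _]/(p * (q * 2)) mulrA -[X in _ == X]mul1r (inj_eq (mulIf _)) ?pnatr_eq0 //.
  by move/eqP.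
have -> : crd y i - crd y j = p * a y.
  by rewrite -!xcoordE -[RHS]/(p *: a y) -scale_lfunE -pE add_lfunE opp_lfunE.
have -> : x (ybar i) - x (ybar j) = q * x b by rewrite -linearB qE linearZ.
by rewrite mulrACA pq mul1r.
Qed.

Lemma sum_transpositions (V : zmodType) (G : 'S_n -> V) :
  \sum_(s in transpositions n) G s = \sum_(p : 'I_n * 'I_n | (p.1 < p.2)%N) G (tperm p.1 p.2).
Proof.
have -> : transpositions n = [set tperm p.1 p.2 | p : 'I_n * 'I_n & (p.1 < p.2)%N]%SET.
  apply/setP => s; apply/imsetP/imsetP => -[[i j]]; rewrite inE /= => ij ->.
    have [lij|lji] := ltnP i j; first by exists (i, j); rewrite ?inE.
    exists (j, i); last by rewrite tpermC.
    by rewrite inE ltn_neqAle lji eq_sym ij.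
  by exists (i, j); rewrite ?inE //= neq_ltn ij.
rewrite big_imset /=; first by apply: eq_bigl => p; rewrite inE.
move=> [i j] [k l]; rewrite !inE /= => ij kl E.
have := congr1 (fun s : 'S_n => s i) E; rewrite tpermL.
move: ij kl; case: tpermP => [->|->|_ _] + + ji; rewrite ji ?ltnn // => lk kl.
by have := ltn_trans lk kl; rewrite ltnn.
Qed.

Lemma sum_offdiag (V : zmodType) (G : 'I_n -> 'I_n -> V) :
  \sum_i \sum_(k | k != i) G i k = \sum_(p : 'I_n * 'I_n | (p.1 < p.2)%N) (G p.1 p.2 + G p.2 p.1).
Proof.
rewrite pair_big_dep /= (bigID (fun p : 'I_n * 'I_n => (p.1 < p.2)%N)) big_split /=.
congr (_ + _); first by apply: eq_bigl => p; rewrite eq_sym neq_ltn; case: ltnP; rewrite ?andbF.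
rewrite (reindex_inj (h := fun p : 'I_n * 'I_n => (p.2, p.1))) /=; last first.
  by move=> [i j] [k l] [-> ->].
apply: eq_bigl => -[i j] /=; rewrite -(inj_eq val_inj) /=; lia.
Qed.
End ReflectionCoordinates.

(** * The Dunkl representation *)

Section SmashTensor.
Variables (K : numFieldType) (n : nat).
Local Notation h := (refl_space K n).
Local Notation h' := 'Hom(refl_space K n, K^o).
Local Notation act := (tensor_action (sum_rep (refl_rep K n) (dual_rep (refl_rep K n)))).

Lemma y_elt_is_linear : linear (@y_elt K n).
Proof.
move=> a y z; rewrite /y_elt -(smash_algZ act).
rewrite -[RHS](smash_algD act) -linearP; congr (smash_alg _ (tensor_inj _)).
by rewrite /GRing.scale /GRing.add /= /scale_pair /add_pair /= scaler0 addr0.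
Qed.
HB.instance Definition _ :=
  GRing.isLinear.Build K h (smash_tensor K n) _ (@y_elt K n) y_elt_is_linear.
Lemma x_elt_is_linear : linear (@x_elt K n).
Proof.
move=> a y z; rewrite /x_elt -(smash_algZ act).
rewrite -[RHS](smash_algD act) -linearP; congr (smash_alg _ (tensor_inj _)).
by rewrite /GRing.scale /GRing.add /= /scale_pair /add_pair /= scaler0 addr0.
Qed.
HB.instance Definition _ :=
  GRing.isLinear.Build K h' (smash_tensor K n) _ (@x_elt K n) x_elt_is_linear.

Lemma grp_eltM (g w : 'S_n) : grp_elt K (g * w)%g = grp_elt K g * grp_elt K w.
Proof. exact: smash_grpM. Qed.
Lemma grp_elt1 : grp_elt K (1%g : 'S_n) = 1.
Proof. by apply/ffunP => g; rewrite !ffunE. Qed.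

Lemma smash_alg_inj y x : smash_alg act (tensor_inj (y, x)) = y_elt y + x_elt x.
Proof.
rewrite -[RHS](smash_algD act) -linearD; congr (smash_alg _ (tensor_inj _)).
by rewrite /GRing.add /= /add_pair /= addr0 add0r.
Qed.
Lemma grp_y_elt w y : grp_elt K w * y_elt y = y_elt (refl_rep K n w y) * grp_elt K w.
Proof.
rewrite [LHS](smash_grp_alg act); congr (smash_alg _ _ * _).
rewrite [LHS]tensor_map_inj; congr tensor_inj.
by rewrite lfunE /= /sum_act /= linear0.
Qed.
Lemma grp_x_elt w x :
  grp_elt K w * x_elt x = x_elt (dual_rep (refl_rep K n) w x) * grp_elt K w.
Proof.
rewrite [LHS](smash_grp_alg act); congr (smash_alg _ _ * _).
rewrite [LHS]tensor_map_inj; congr tensor_inj.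
by rewrite lfunE /= /sum_act /= linear0.
Qed.

Lemma smash_tensor_ind (P : smash_tensor K n -> Prop) :
  (forall w, P (grp_elt K w)) -> (forall y, P (y_elt y)) -> (forall x, P (x_elt x)) ->
  (forall a b, P a -> P b -> P (a + b)) -> (forall a b, P a -> P b -> P (a * b)) ->
  (forall k a, P a -> P (k *: a)) -> forall u, P u.
Proof.
move=> Pg Py Px PD PM PZ u.
rewrite [u](smash_decomp (act := act)); apply: (big_ind P) => [||g _]; [|exact: PD|].
  by rewrite -(scale0r (grp_elt K 1%g)); exact: PZ.
apply: (PM) (Pg g); elim/tensor_ind: (u g) => [|[y x]|a b Pa Pb|a b Pa Pb|k a Pa].
- by rewrite smash_alg1 -grp_elt1.
- by rewrite smash_alg_inj; apply: (PD).
- by rewrite smash_algD; apply: (PD).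
- by rewrite smash_algM; apply: (PM).
- by rewrite smash_algZ; apply: (PZ).
Qed.
End SmashTensor.

Section DunklRepresentation.
Variables (K : numFieldType) (m : nat) (F : refl_field K m) (c : K).
Local Notation n := m.+1.
Local Notation h := (refl_space K n).
Local Notation h' := 'Hom(refl_space K n, K^o).
Local Notation cst := (rf_cst F).
Local Notation E := (endo cst).
Local Notation mu := (mulop cst).
Local Notation sg := (sg F).
Local Notation D := (dunkl F (fun _ _ : 'I_n => c)).
Local Notation act := (tensor_action (sum_rep (refl_rep K n) (dual_rep (refl_rep K n)))).

Definition dunkl_lin (u : h * h') : E :=
  \sum_i crd u.1 i *: D i + \sum_i u.2 (ybar K i) *: mu (rf_x F i).
Lemma dunkl_lin_is_linear : linear dunkl_lin.
Proof.
move=> a u v; rewrite /dunkl_lin scalerDr addrACA !scaler_sumr.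
congr (_ + _); rewrite -big_split; apply: eq_bigr => i _ /=; rewrite scalerA -scalerDl; congr (_ *: _).
  exact: (linearP (coord_form i)).
by rewrite add_lfunE scale_lfunE.
Qed.
HB.instance Definition _ :=
  GRing.isLinear.Build K (h * h')%type E _ dunkl_lin dunkl_lin_is_linear.

(* Locked, since a failed unification of two of its values would unfold T(h + h'). *)
Definition dunkl_lift : tensor_alg (h * h')%type -> E :=
  locked_with dunkl_key (tensor_lift dunkl_lin).
Lemma dunkl_liftE : dunkl_lift = tensor_lift dunkl_lin.
Proof. by rewrite [LHS]unlock. Qed.
Lemma dunkl_lift_is_linear : linear dunkl_lift.
Proof. by rewrite dunkl_liftE => k a b; rewrite linearP. Qed.
HB.instance Definition _ :=
  GRing.isLinear.Build K (tensor_alg (h * h')%type) E _ dunkl_lift dunkl_lift_is_linear.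
Lemma dunkl_lift_is_monoid_morphism : monoid_morphism dunkl_lift.
Proof. by rewrite dunkl_liftE; exact: tensor_lift_is_monoid_morphism. Qed.
HB.instance Definition _ := GRing.isMonoidMorphism.Build (tensor_alg (h * h')%type) E
  dunkl_lift dunkl_lift_is_monoid_morphism.
Local Notation tl := dunkl_lift.

Lemma dunkl_lift_inj y x : tl (tensor_inj (y, x)) =
  \sum_i crd y i *: D i + \sum_i x (ybar K i) *: mu (rf_x F i).
Proof. rewrite dunkl_liftE; exact: (tensor_lift_inj dunkl_lin). Qed.

Lemma sg_dunkl_lin (g : 'S_n) (y y' : h) (x x' : h') :
  (forall i, crd y' i = crd y (g i)) ->
  (forall i, x' (ybar K i) = x (ybar K (g i))) ->
  sg g * (\sum_i crd y i *: D i + \sum_i x (ybar K i) *: mu (rf_x F i)) =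
  (\sum_i crd y' i *: D i + \sum_i x' (ybar K i) *: mu (rf_x F i)) * sg g.
Proof.
move=> yE xE; rewrite mulrDr mulrDl; congr (_ + _).
  rewrite mulr_sumr mulr_suml (reindex_inj (@perm_inj _ g)) /=.
  apply: eq_bigr => i _; rewrite yE -scalerAr -scalerAl sg_dunkl // permK.
  by [].
rewrite mulr_sumr mulr_suml (reindex_inj (@perm_inj _ g)) /=.
apply: eq_bigr => i _; rewrite xE -scalerAr -scalerAl sg_mu.
by rewrite rf_act_x permK.
Qed.

Lemma sg_tensor_lift g a : sg g * tl a = tl (act g a) * sg g.
Proof.
elim/tensor_ind: a => [|[y x]|a b ha hb|a b ha hb|k a ha].
- by rewrite !rmorph1 mulr1 mul1r.
- have -> : act g (tensor_inj (y, x)) =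
      tensor_inj (refl_rep K n g y, dual_rep (refl_rep K n) g x).
    by rewrite [LHS]tensor_map_inj lfunE.
  rewrite [X in _ = X * _]dunkl_lift_inj [X in _ * X = _]dunkl_lift_inj.
  apply: sg_dunkl_lin => i; first exact: crd_act.
  by rewrite dual_actE act_ybar invgK.
- by rewrite !rmorphD /= mulrDr mulrDl ha hb.
- rewrite rmorphM (rmorphM (act g)) rmorphM /= mulrA ha -!mulrA.
  by congr (_ * _).
- by rewrite !linearZ /= -scalerAr ha -scalerAl.
Qed.

Definition dunkl_rep (u : smash_tensor K n) : E :=
  locked_with dunkl_key (\sum_g tl (u g) * sg g).
Lemma dunkl_repE u : dunkl_rep u = \sum_g tl (u g) * sg g.
Proof. by rewrite [LHS]unlock. Qed.

Lemma dunkl_rep_is_linear : linear dunkl_rep.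
Proof.
move=> a u v; rewrite !dunkl_repE scaler_sumr -big_split; apply: eq_bigr => g _ /=.
by rewrite !ffunE linearP mulrDl scalerAl.
Qed.
HB.instance Definition _ :=
  GRing.isLinear.Build K (smash_tensor K n) E _ dunkl_rep dunkl_rep_is_linear.

Lemma dunkl_rep_grp w : dunkl_rep (grp_elt K w) = sg w.
Proof.
rewrite dunkl_repE (bigD1 w) //= big1 => [|g /negPf gw].
  by rewrite ffunE eqxx rmorph1 mul1r addr0.
by rewrite ffunE gw rmorph0 mul0r.
Qed.
Lemma dunkl_rep_alg a : dunkl_rep (smash_alg act a) = tl a.
Proof.
rewrite dunkl_repE (bigD1 1%g) //= big1 => [|g /negPf g1].
  by rewrite ffunE eqxx sg1 mulr1 addr0.
by rewrite ffunE g1 raddf0 mul0r.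
Qed.
Lemma dunkl_rep_is_monoid_morphism : monoid_morphism dunkl_rep.
Proof.
split=> [|u v]; first by rewrite -grp_elt1 dunkl_rep_grp sg1.
rewrite !dunkl_repE mulr_suml.
under eq_bigr => k _ do rewrite ffunE raddf_sum mulr_suml.
rewrite exchange_big; apply: eq_bigr => g _ /=.
rewrite mulr_sumr (reindex_inj (mulgI g)) /=; apply: eq_bigr => k _.
by rewrite mulKg rmorphM /= sgM !mulrA; congr (_ * _); rewrite -!mulrA sg_tensor_lift.
Qed.
HB.instance Definition _ := GRing.isMonoidMorphism.Build (smash_tensor K n) E
  dunkl_rep dunkl_rep_is_monoid_morphism.

Lemma dunkl_rep_y y : dunkl_rep (y_elt y) = \sum_i crd y i *: D i.
Proof.
rewrite dunkl_rep_alg dunkl_lift_inj [X in _ + X]big1 ?addr0 // => i _.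
by rewrite zero_lfunE scale0r.
Qed.
Lemma dunkl_rep_x x : dunkl_rep (x_elt x) = \sum_i x (ybar K i) *: mu (rf_x F i).
Proof.
rewrite dunkl_rep_alg dunkl_lift_inj [X in X + _]big1 ?add0r // => i _.
by rewrite -xcoordE linear0 scale0r.
Qed.

(** The sum kills 1 and commutes with each [x j]: the reflections cancel, and [1 - n^-1] cancels
    against the other n - 1 terms [- n^-1]. It matches the vanishing of the sum of the [ybar i]. *)
Lemma sum_dunkl : \sum_i D i = 0.
Proof.
apply: commute_pol_eq0 => [j|]; last first.
  by rewrite sumEndoE big1 // => i _; rewrite -(rmorph1 cst) dunkl_cst.
apply/eqP; rewrite -subr_eq0 mulr_suml mulr_sumr -sumrB.
under eq_bigr do rewrite dunkl_x.
rewrite (bigD1 j) //= eqxx; rewrite [X in _ + X](eq_bigr (fun i => (- n%:R^-1)%:A + c *: sg (tperm i j))); last first.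
  by move=> i /negPf ->.
rewrite big_split /= sumr_const cardC1 card_ord /=.
apply/eqP; rewrite addrACA -[RHS]addr0; congr (_ + _).
  rewrite scalerBl scale1r scaleNr mulNrn -addrA -opprD -mulrS.
  rewrite -scaler_nat scalerA mulfV ?scale1r ?subrr //.
  by rewrite pnatr_eq0.
by rewrite -sumrN -big_split big1 // => i _ /=; rewrite tpermC addNr.
Qed.

Lemma dunkl_rep_ybar i : dunkl_rep (y_elt (ybar K i)) = D i.
Proof.
rewrite dunkl_rep_y; under eq_bigr do rewrite crd_ybar scalerBl.
rewrite sumrB -scaler_sumr sum_dunkl scaler0 subr0.
rewrite (bigD1 i) //= eqxx scale1r big1 ?addr0 // => j /negPf ->.
by rewrite scale0r.
Qed.
Lemma dunkl_rep_xcoord i : dunkl_rep (x_elt (xcoord K i)) = mu (rf_x F i).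
Proof.
rewrite dunkl_rep_x; under eq_bigr do rewrite xcoordE crd_ybar scalerBl.
rewrite sumrB -scaler_sumr -rmorph_sum rf_sum_x rmorph0 scaler0 subr0.
rewrite (bigD1 i) //= eqxx scale1r big1 ?addr0 // => j; rewrite eq_sym => /negPf ->.
by rewrite scale0r.
Qed.
Lemma dunkl_rep_symmetrizer : dunkl_rep (symmetrizer K n) = symz F.
Proof.
rewrite /symmetrizer linearZ linear_sum /symz; congr (_ *: _); apply: eq_bigr => w _.
exact: dunkl_rep_grp.
Qed.

Lemma dunkl_rep_dunkl_alg u : dunkl_alg c (dunkl_rep u).
Proof.
elim/smash_tensor_ind: u => [w|y|x|a b ha hb|a b ha hb|k a ha].
- by rewrite dunkl_rep_grp; exact: Dunkl_sg.
- by rewrite dunkl_rep_y; apply: dunkl_alg_sum => i _; apply/Dunkl_scale/Dunkl_D.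
- by rewrite dunkl_rep_x; apply: dunkl_alg_sum => i _; apply/Dunkl_scale/Dunkl_x.
- by rewrite linearD; exact: Dunkl_add.
- by rewrite rmorphM; exact: Dunkl_mul.
- by rewrite linearZ; exact: Dunkl_scale.
Qed.
Lemma dunkl_alg_dunkl_rep T : dunkl_alg c T -> exists u, T = dunkl_rep u.
Proof.
elim=> [i|w|i|S S' _ [u ->] _ [v ->]|S S' _ [u ->] _ [v ->]|a S _ [u ->]].
- by exists (x_elt (xcoord K i)); rewrite dunkl_rep_xcoord.
- by exists (grp_elt K w); rewrite dunkl_rep_grp.
- by exists (y_elt (ybar K i)); rewrite dunkl_rep_ybar.
- by exists (u + v); rewrite linearD.
- by exists (u * v); rewrite rmorphM.
- by exists (a *: u); rewrite linearZ.
Qed.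
End DunklRepresentation.

(** * Faithfulness on the symmetrizer *)

Lemma rmorph_commutator (K : numFieldType) n (B : pzRingType)
    (f : {rmorphism smash_tensor K n -> B}) u v A A' : f u = A -> f v = A' ->
  f (Defs.commutator u v) = A * A' - A' * A.
Proof.
move=> <- <-; rewrite /Defs.commutator (rmorphB f).
by congr (_ - _); exact: (rmorphM f).
Qed.

Section Cherednik.
Variables (K : numFieldType) (m : nat) (F : refl_field K m) (c : K).
Local Notation n := m.+1.
Local Notation h := (refl_space K n).
Local Notation h' := 'Hom(refl_space K n, K^o).
Local Notation cst := (rf_cst F).
Local Notation E := (endo cst).
Local Notation mu := (mulop cst).
Local Notation sg := (sg F).
Local Notation D := (dunkl F (fun _ _ : 'I_n => c)).
Variables (alpha : 'S_n -> h') (alphav : 'S_n -> h).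
Hypothesis rd : is_root_datum alpha alphav.
Local Notation rep := (dunkl_rep F c).
Local Notation rels := (cherednik_relations alpha alphav c).
Local Notation H := (cherednik alpha alphav c).
Local Notation proj := (quot_proj rels).

Lemma dunkl_mu_linear i (x : h') :
  let X := \sum_j x (ybar K j) *: mu (rf_x F j) in
  D i * X - X * D i = (x (ybar K i))%:A
    - c *: \sum_(k | k != i) (x (ybar K i) - x (ybar K k)) *: sg (tperm i k).
Proof.
move=> X; rewrite /X mulr_sumr mulr_suml -sumrB.
under eq_bigr => j _ do rewrite -scalerAr -scalerAl -scalerBr dunkl_x.
rewrite (bigD1 i) //= eqxx.
rewrite [X in _ + X](eq_bigr (fun j =>
  x (ybar K j) *: (- n%:R^-1)%:A + x (ybar K j) *: (c *: sg (tperm i j)))); last first.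
  by move=> j; rewrite eq_sym => /negPf ->; rewrite scalerDr.
rewrite big_split /= scalerBr addrACA; congr (_ + _).
  rewrite scalerA mulrBr mulr1 scalerBl -addrA -[RHS]addr0; congr (_ + _).
  under eq_bigr do rewrite scalerA mulrN scaleNr.
  rewrite sumrN -opprD; apply/eqP; rewrite oppr_eq0; apply/eqP.
  rewrite -scaler_suml -scalerDl -mulr_suml -mulrDl.
  have -> : x (ybar K i) + \sum_(j | j != i) x (ybar K j) = \sum_j x (ybar K j).
    by rewrite [RHS](bigD1 i).
  by rewrite -linear_sum sum_ybar linear0 mul0r scale0r.
rewrite !scaler_sumr -sumrN -big_split -sumrN; apply: eq_bigr => k _ /=.
rewrite !scalerA -scaleNr -scalerDl -scaleNr; congr (_ *: _).
by rewrite -[LHS]/(- (x (ybar K i) * c) + x (ybar K k) * c : K); ring.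
Qed.

Lemma dunkl_rep_commutator (y : h) (x : h') :
  rep (Defs.commutator (y_elt y) (x_elt x)) = (x y)%:A
    - c *: \sum_(s in transpositions n) (alpha s y * x (alphav s)) *: sg s.
Proof.
rewrite (@rmorph_commutator _ _ _ rep _ _ _ _ (dunkl_rep_y _ _ y) (dunkl_rep_x _ _ x)).
rewrite mulr_suml [X in _ - X]mulr_sumr -sumrB.
under eq_bigr => i _ do rewrite -scalerAl -scalerAr -scalerBr dunkl_mu_linear scalerBr.
rewrite sumrB; congr (_ - _).
  by rewrite [x y]dual_sumE scaler_suml; apply: eq_bigr => i _; rewrite scalerA.
under eq_bigr => i _ do rewrite scalerA mulrC -scalerA scaler_sumr.
rewrite -scaler_sumr; congr (_ *: _); rewrite sum_offdiag sum_transpositions.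
apply: eq_bigr => -[i k] /= ik; rewrite (tpermC k i) !scalerA -scalerDl; congr (_ *: _).
rewrite (root_datum_pairing _ _ rd); last by rewrite neq_ltn ik.
by rewrite -[LHS]/(crd y i * (x (ybar K i) - x (ybar K k)) + crd y k * (x (ybar K k) - x (ybar K i)) : K); ring.
Qed.

Lemma rep_scalar k : rep k%:A = k%:A.
Proof. by rewrite linearZ /= rmorph1. Qed.

Lemma dunkl_rep_relations r : rels r -> rep r = 0.
Proof.
case=> [[[x [x' ->]]|[y [y' ->]]]|[y [x ->]]].
- rewrite (@rmorph_commutator _ _ _ rep _ _ _ _ (dunkl_rep_x _ _ x) (dunkl_rep_x _ _ x')).
  apply/eqP; rewrite subr_eq0; apply/eqP; rewrite mulr_suml mulr_sumr; apply: eq_bigr => i _.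
  rewrite mulr_suml mulr_sumr; apply: eq_bigr => j _.
  by rewrite -!scalerAl -!scalerAr mulopC !scalerA mulrC.
- rewrite (@rmorph_commutator _ _ _ rep _ _ _ _ (dunkl_rep_y _ _ y) (dunkl_rep_y _ _ y')).
  apply/eqP; rewrite subr_eq0; apply/eqP; rewrite mulr_suml mulr_sumr; apply: eq_bigr => i _.
  rewrite mulr_suml mulr_sumr; apply: eq_bigr => j _.
  by rewrite -!scalerAl -!scalerAr dunkl_comm !scalerA mulrC.
- rewrite (linearB rep) /=; apply/eqP; rewrite subr_eq0; apply/eqP.
  apply: (etrans (dunkl_rep_commutator y x)).
  rewrite [RHS](linearB rep) /=; congr (_ - _); first by rewrite rep_scalar.
  rewrite [RHS]linearZ; congr (_ *: _); rewrite [RHS](linear_sum rep) /=.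
  apply: eq_bigr => s _.
  by rewrite [RHS]linearZ /= (dunkl_rep_grp F c s).
Qed.

Lemma dunkl_rep_ideal r : ideal_generated rels r -> rep r = 0.
Proof.
move=> hr; apply: (hr (fun r => rep r = 0)); split; last exact: dunkl_rep_relations.
split=> [|u v hu hv|u v hv|u v hu].
- exact: linear0.
- by rewrite linearD /= hu hv addr0.
- by rewrite rmorphM /= hv mulr0.
- by rewrite rmorphM /= hu mul0r.
Qed.

Definition cherednik_rep (u : H) : E := rep (quot_lift u).
Local Notation rhob := cherednik_rep.
Lemma cherednik_rep_proj t : rhob (proj t) = rep t.
Proof.
apply/eqP; rewrite -subr_eq0 -linearB; apply/eqP/dunkl_rep_ideal/quot_proj_eq.
exact: quot_liftK.
Qed.
Lemma cherednik_rep_is_zmod_morphism : zmod_morphism rhob.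
Proof.
move=> u v; rewrite -[u]quot_liftK -[v]quot_liftK -rmorphB !cherednik_rep_proj.
exact: linearB.
Qed.
HB.instance Definition _ := GRing.isZmodMorphism.Build H E rhob cherednik_rep_is_zmod_morphism.
Lemma cherednik_rep_is_monoid_morphism : monoid_morphism rhob.
Proof.
split=> [|u v]; first by rewrite -(rmorph1 proj) cherednik_rep_proj rmorph1.
rewrite -[u]quot_liftK -[v]quot_liftK -rmorphM !cherednik_rep_proj.
exact: rmorphM.
Qed.
HB.instance Definition _ := GRing.isMonoidMorphism.Build H E rhob cherednik_rep_is_monoid_morphism.
Lemma cherednik_rep_e : rhob (cherednik_e alpha alphav c) = symz F.
Proof. by rewrite cherednik_rep_proj dunkl_rep_symmetrizer. Qed.

Local Notation kh := (proj \o in_alg (smash_tensor K n)).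
Definition chered_x i : H := proj (x_elt (xcoord K i)).
Definition chered_y i : H := proj (y_elt (ybar K i)).
Definition chered_s w : H := proj (grp_elt K w).
Local Notation xh := chered_x.
Local Notation yh := chered_y.
Local Notation sh := chered_s.
Local Notation eh := (cherednik_e alpha alphav c).

Lemma projZ a u : proj (a *: u) = kh a * proj u.
Proof. by rewrite /= -rmorphM mulr_algl. Qed.
Lemma kh_central a r : kh a * r = r * kh a.
Proof. by rewrite -[r]quot_liftK /= -!rmorphM mulr_algl mulr_algr. Qed.

Lemma proj_rel r : rels r -> proj r = 0.
Proof.
move=> hr; rewrite -(rmorph0 proj); apply/quot_proj_eq; rewrite subr0.
by move=> I [_]; apply.
Qed.

Lemma proj_cross u v r : rels (Defs.commutator u v - r) ->
  proj u * proj v = proj v * proj u + proj r.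
Proof.
move=> /proj_rel; rewrite (rmorphB proj).
rewrite (@rmorph_commutator _ _ _ proj u v _ _ erefl erefl).
by move/eqP; rewrite subr_eq0 subr_eq addrC => /eqP.
Qed.
Lemma proj_comm u v : rels (Defs.commutator u v) -> proj u * proj v = proj v * proj u.
Proof. by move=> uv; rewrite (@proj_cross u v 0) ?subr0 // rmorph0 addr0. Qed.
Lemma xh_comm i j : xh i * xh j = xh j * xh i.
Proof. by apply: proj_comm; left; left; exists (xcoord K i), (xcoord K j). Qed.
Lemma yh_comm i j : yh i * yh j = yh j * yh i.
Proof. by apply: proj_comm; left; right; exists (ybar K i), (ybar K j). Qed.

(** The right-hand side of the defining relation as one combination of group elements, the pairing
    being the coefficient of the identity. *)
Definition cross_coef i j (w : 'S_n) : K :=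
  (w == 1%g)%:R * crd (ybar K i) j
  - c * ((w \in transpositions n)%:R * (alpha w (ybar K i) * xcoord K j (alphav w))).

Lemma yh_xh i j : yh i * xh j = xh j * yh i + \sum_w kh (cross_coef i j w) * sh w.
Proof.
apply: (etrans (@proj_cross (y_elt (ybar K i)) (x_elt (xcoord K j))
  ((xcoord K j (ybar K i))%:A - c *: \sum_(s in transpositions n)
     (alpha s (ybar K i) * xcoord K j (alphav s)) *: grp_elt K s) _)).
  by right; exists (ybar K i), (xcoord K j).
congr (_ + _); transitivity (\sum_w proj (cross_coef i j w *: grp_elt K w)); last first.
  by apply: eq_bigr => w _; exact: projZ.
rewrite -(rmorph_sum proj); congr proj.
rewrite [RHS](eq_bigr (fun w => ((w == 1%g)%:R * crd (ybar K i) j) *: grp_elt K w -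
  (c * ((w \in transpositions n)%:R * (alpha w (ybar K i) * xcoord K j (alphav w))))
     *: grp_elt K w)); last by move=> w _; exact: scalerBl.
rewrite [RHS]sumrB; congr (_ - _).
  rewrite [RHS](bigD1 1%g) //= [X in _ = _ + X]big1; last first.
    by move=> w /negPf ->; rewrite mul0r scale0r.
  by rewrite addr0 eqxx mul1r grp_elt1 xcoordE.
rewrite [LHS]scaler_sumr [LHS]big_mkcond; apply: eq_bigr => w _.
by case: ifP => _; rewrite ?mul1r ?scalerA // mul0r mulr0 scale0r.
Qed.

Lemma sh_eh w : sh w * eh = eh.
Proof.
rewrite /chered_s -(rmorphM proj) /cherednik_e; congr proj; rewrite /symmetrizer -scalerAr.
congr (_ *: _); rewrite mulr_sumr [RHS](reindex_inj (mulgI w)) /=.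
by apply: eq_bigr => v _; rewrite [RHS]grp_eltM.
Qed.
Lemma proj_eqM u v u' v' : u * v = u' * v' -> proj u * proj v = proj u' * proj v'.
Proof.
by move=> E; apply: etrans (esym (rmorphM proj u v)) _; rewrite E; exact: rmorphM.
Qed.
Lemma sh_xh w i : sh w * xh i = xh (w^-1%g i) * sh w.
Proof. by apply: proj_eqM; rewrite [LHS]grp_x_elt act_xcoord. Qed.
Lemma sh_yh w i : sh w * yh i = yh (w^-1%g i) * sh w.
Proof. by apply: proj_eqM; rewrite [LHS]grp_y_elt act_ybar. Qed.
Lemma sum_xh : \sum_i xh i = 0.
Proof. by rewrite -(rmorph_sum proj) -linear_sum sum_xcoord !raddf0. Qed.
Lemma sum_yh : \sum_i yh i = 0.
Proof. by rewrite -(rmorph_sum proj) -linear_sum sum_ybar !raddf0. Qed.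

Local Notation PBW := (pbw xh yh eh).

Lemma lspan_cherednik_e (r : H) : lspan kh PBW (r * eh).
Proof.
have hx := lspan_xh (e := eh) kh_central sum_xh xh_comm.
have hs := lspan_sh kh_central sum_xh sum_yh xh_comm yh_comm sh_xh sh_yh sh_eh.
have hy := lspan_yh kh_central sum_xh sum_yh xh_comm yh_comm sh_xh sh_yh sh_eh yh_xh.
have he := lspan_e eh kh_central sum_xh sum_yh xh_comm yh_comm.
suff key t s : lspan kh PBW s -> lspan kh PBW (proj t * s).
  by rewrite -[r]quot_liftK; exact: key.
elim/smash_tensor_ind: t s => [w|y|x|a b ha hb|a b ha hb|k a ha] s hs'.
- exact: hs.
- rewrite [y]refl_space_decomp linear_sum rmorph_sum mulr_suml; apply: lspan_sum => i _.
  rewrite linearZ /= projZ -mulrA; apply: lspan_scale; exact: hy.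
- rewrite [x]refl_dual_decomp linear_sum rmorph_sum mulr_suml; apply: lspan_sum => i _.
  rewrite linearZ /= projZ -mulrA; apply: lspan_scale; exact: hx.
- by rewrite rmorphD mulrDl; apply: lspan_add; [exact: ha|exact: hb].
- by rewrite rmorphM -mulrA; apply: (ha); exact: hb.
- by rewrite projZ -mulrA; apply: lspan_scale; exact: ha.
Qed.

Lemma ev_monomial (a : 'X_{1..m}) :
  ev F 'X_[a] = \prod_(j <- mnm_word a) rf_x F (lift ord_max j).
Proof.
rewrite /ev mmapX /mmap1 /mnm_word big_flatten big_map big_enum /=; apply: eq_bigr => i _.
by rewrite big_nseq; elim: (a i) => [|k IH] //=; rewrite exprS IH.
Qed.

Lemma cherednik_rep_x i : rhob (xh i) = mu (rf_x F i).
Proof. by apply: etrans (cherednik_rep_proj _) _; exact: dunkl_rep_xcoord. Qed.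
Lemma cherednik_rep_y i : rhob (yh i) = D i.
Proof. by apply: etrans (cherednik_rep_proj _) _; exact: dunkl_rep_ybar. Qed.

Lemma cherednik_rep_yword (s : seq 'I_m) :
  rhob (hword yh (map (lift ord_max) s) eh) = Dword F c s.
Proof.
elim: s => [|j s IH] /=; first exact: cherednik_rep_e.
by apply: etrans (rmorphM rhob _ _) _; congr (_ * _); first exact: cherednik_rep_y.
Qed.
Lemma cherednik_rep_xword (s : seq 'I_m) r : rhob (hword xh (map (lift ord_max) s) r) =
  mu (\prod_(j <- s) rf_x F (lift ord_max j)) * rhob r.
Proof.
elim: s => [|j s IH] /=; first by rewrite big_nil rmorph1 mul1r.
rewrite big_cons (rmorphM mu) -[RHS]mulrA.
by apply: etrans (rmorphM rhob _ _) _; congr (_ * _); first exact: cherednik_rep_x.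
Qed.
Lemma cherednik_rep_pbw t : rhob (PBW t) = mu (ev F 'X_[t.1]) * Dword F c (mnm_word t.2).
Proof. by rewrite ev_monomial -cherednik_rep_yword -cherednik_rep_xword. Qed.

Lemma cherednik_rep_inj (r : H) : rhob (r * eh) = 0 -> r * eh = 0.
Proof.
have [s [k [us ->]]] := lspan_uniq (lspan_cherednik_e r).
rewrite rmorph_sum /=.
have -> : \sum_(t <- s) rhob (kh (k t) * PBW t) =
    \sum_(t <- s) k t *: (mu (ev F 'X_[t.1]) * Dword F c (mnm_word t.2)).
  apply: eq_bigr => t _; rewrite rmorphM /= cherednik_rep_pbw cherednik_rep_proj.
  by rewrite rep_scalar mulr_algl.
move=> /(Dword_independent us) k0; rewrite big_seq big1 // => t /k0 ->.
by rewrite /= scale0r (rmorph0 proj) mul0r.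
Qed.

Lemma faithful_on_symmetrizer : exists rho : {rmorphism H -> E},
  [/\ rho eh = symz F, forall r, rho (r * eh) = 0 -> r * eh = 0,
      forall r, dunkl_alg c (rho r) & forall T, dunkl_alg c T -> exists r, T = rho r].
Proof.
exists (rhob : {rmorphism H -> E}); split=> [|r|r|T].
- exact: cherednik_rep_e.
- exact: cherednik_rep_inj.
- exact: dunkl_rep_dunkl_alg.
- move=> /dunkl_alg_dunkl_rep[u ->]; exists (proj u).
  by apply: esym; exact: cherednik_rep_proj.
Qed.
End Cherednik.

(** * Simplicity *)

Section Simplicity.
Variables (K : numClosedFieldType) (m : nat) (F : refl_field K m) (c : K).
Hypothesis c_bounds : -1 < c < 0.
Variables (H : pzRingType) (e : H) (ee : e * e = e) (rho : {rmorphism H -> endo (rf_cst F)}).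
Hypothesis rho_e : rho e = symz F.
Hypothesis rho_inj : forall r, rho (r * e) = 0 -> r * e = 0.
Hypothesis rho_alg : forall r, dunkl_alg c (rho r).
Hypothesis rho_surj : forall T, dunkl_alg c T -> exists r, T = rho r.
Local Notation A := (corner_ring ee).

Lemma corner_valE (u : A) : exists r, corner_val u = e * r * e.
Proof. by case: u => r /= /in_cornerP. Qed.

(** A nonzero ideal is carried by [rho] to the Dunkl side, where it contains the symmetrizer;
    injectivity on [H e] brings the unit back. *)
Lemma corner_simple : simple_ring A.
Proof.
split.
  move=> /(congr1 (@corner_val _ _)) /= e0; have /eqP := symz1 F.
  by rewrite -rho_e e0 rmorph0 eq_sym oner_eq0.
move=> I [I0 ID Il Ir].
have [[u Iu u0]|allz] := pselect (exists2 u, I u & u <> 0); last first.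
  left; apply/classical_sets.seteqP; split=> [u Iu|_ ->//].
  by apply: contrapT => u0; apply: allz; exists u.
right; apply/classical_sets.seteqP; split=> // v _.
suff I1 : I 1 by rewrite -[v]mulr1; exact: Il.
pose J T := exists2 u : A, I u & T = rho (corner_val u).
have mkc r : e * r * e \in in_corner e by apply/in_cornerP; exists r.
have eu (w : A) : e * corner_val w * e = corner_val w.
  by have [r ->] := corner_valE w; rewrite !mulrA ee -!mulrA ee.
have : J (symz F).
  apply: (corner_ideal_unit c_bounds).
  - by move=> _ [w _ ->]; exact: rho_alg.
  - by move=> _ [w _ ->]; rewrite -rho_e -!rmorphM eu.
  - by move=> _ _ [w Iw ->] [w' Iw' ->]; exists (w + w'); [exact: ID|rewrite -rmorphD].
  - move=> S _ /rho_surj[r ->] [w Iw ->].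
    by exists ((Corner (mkc r) : A) * w); [exact: Il|rewrite -rho_e -!rmorphM].
  - move=> S _ /rho_surj[r ->] [w Iw ->].
    by exists (w * (Corner (mkc r) : A)); [exact: Ir|rewrite -rho_e -!rmorphM].
  - exists (rho (corner_val u)); first by exists u.
    have [r uE] := corner_valE u; rewrite uE => /rho_inj e0; apply: u0.
    by apply: val_inj; rewrite /= uE.
move=> [w Iw]; have [r wE] := corner_valE w; rewrite -rho_e => e1.
suff <- : w = 1 by [].
apply: val_inj => /=; apply/eqP; rewrite -subr_eq0; apply/eqP.
(* The difference is written as an element of [H e], where [rho] is injective. *)
have weh : corner_val w - e = (e * r - 1) * e by rewrite mulrBl mul1r wE.
by rewrite weh; apply: rho_inj; rewrite -weh rmorphB e1 subrr.
Qed.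
End Simplicity.

Local Open Scope complex_scope.

Theorem theorem4p10 (R : realType) (n : nat) (n_gt0 : (0 < n)%N)
    (alpha : 'S_n -> 'Hom(refl_space R[i] n, R[i]^o))
    (alphav : 'S_n -> refl_space R[i] n)
    (alpha_roots : is_root_datum alpha alphav)
    (c : R) (c_bounds : -1 < c < 0) :
  simple_ring (spherical alpha alphav c%:C).
Proof.
case: n n_gt0 alpha alphav alpha_roots => // m _ alpha alphav rd.
have [rho [rho_e rho_inj rho_alg rho_surj]] :=
  faithful_on_symmetrizer (rational_refl_field R[i] m) c%:C rd.
apply: (corner_simple _ _ rho_e rho_inj rho_alg rho_surj).
(* The order on the complex numbers extends that of [R], so the bounds on [c] carry over. *)
by rewrite -(rmorph1 (real_complex R)) -rmorphN -(rmorph0 (real_complex R)) !ltcR.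
Qed.
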